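(* Let $\Lambda$ be an artin algebra. Every infinite submodule-closed subcategory $\mathcal C$ of $\operatorname{mod}\Lambda$ contains a minimal subcategory, that is, there is a minimal infinite submodule-closed subcategory $\mathcal C'$ of $\operatorname{mod}\Lambda$ with $\mathcal C'\subseteq \mathcal C$.
   Context: $\operatorname{mod}\Lambda$ is the category of $\Lambda$-modules of finite length. All subcategories of $\operatorname{mod}\Lambda$ are full subcategories closed under isomorphisms, finite direct sums and direct summands. A subcategory $\mathcal C$ is finite if it contains only finitely many isomorphism classes of indecomposable modules, and infinite otherwise. It is submodule-closed if for every module $C$ in $\mathcal C$, every submodule of $C$ belongs to $\mathcal C$. A subcategory $\mathcal C$ is called minimal infinite submodule-closed, or just minimal, if it is infinite and submodule-closed, and no proper subcategory of $\mathcal C$ is both infinite and submodule-closed. *)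

(* Defs.v *)
From mathcomp Require Import all_boot all_algebra.

Set Implicit Arguments.
Unset Strict Implicit.
Unset Printing Implicit Defensive.

Import GRing.Theory.
Local Open Scope ring_scope.

(* Plain MathComp.  Modules over L are left modules, [lmodType L], on arbitrary,
   possibly infinite, carriers.  Submodules of M are boolean predicates S with
   [submod_closed S]; under classical logic these are all the submodules. *)

Definition artinian (R : pzRingType) (M : lmodType R) : Prop :=
  forall S : nat -> {pred M},
    (forall i, submod_closed (S i)) ->
    (forall i, {subset S i.+1 <= S i}) ->
    exists n, forall m, (n <= m)%N -> S m =i S n.

(* The k-algebra structure on L is a ring morphism from k to the centre of L;
   [algType k] is not used because it excludes the zero ring. *)
Record artin_algebra (k : comPzRingType) (L : pzRingType)
    (phi : {rmorphism k -> L}) : Prop := ArtinAlgebra {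
  artin_base : artinian k^o;
  artin_central : forall (a : k) (x : L), phi a * x = x * phi a;
  artin_fg : exists n (g : 'I_n -> L), forall x : L,
    exists a : 'I_n -> k, x = \sum_i phi (a i) * g i
}.

Section Modules.
Variable L : pzRingType.
Implicit Types M N : lmodType L.

Definition zero_module M : Prop := forall x : M, x = 0.

Definition lmod_iso M N : Prop := exists f : {linear M -> N}, bijective f.

Definition maximal_submodule M (S T : {pred M}) : Prop :=
  [/\ {subset S <= T}, ~ {subset T <= S}
    & forall U : {pred M}, submod_closed U ->
        {subset S <= U} -> {subset U <= T} -> U =i S \/ U =i T].

(* S 0, ..., S n is a composition series; the values S i with i > n are
   irrelevant. *)
Definition finite_length M : Prop :=
  exists n (S : nat -> {pred M}),
    [/\ forall i, (i <= n)%N -> submod_closed (S i),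
        S 0 =i pred1 0,
        S n =i predT
      & forall i, (i < n)%N -> maximal_submodule (S i) (S i.+1)].

Definition indecomposable M : Prop :=
  ~ zero_module M /\
  forall A B : lmodType L, lmod_iso M (A * B)%type ->
    zero_module A \/ zero_module B.

(* A full subcategory of mod L is given by its class of objects.  The zero
   module is the empty direct sum. *)
Record subcategory (C : lmodType L -> Prop) : Prop := Subcategory {
  subcat_finite_length : forall M, C M -> finite_length M;
  subcat_iso : forall M N, lmod_iso M N -> C M -> C N;
  subcat_zero : forall M, zero_module M -> C M;
  subcat_sum : forall M N, C M -> C N -> C (M * N)%type;
  subcat_summand : forall M N, C (M * N)%type -> C M
}.

Definition finite_subcat (C : lmodType L -> Prop) : Prop :=
  exists n (F : 'I_n -> lmodType L), forall M,
    C M -> indecomposable M -> exists i, lmod_iso M (F i).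

Definition submodule_closed (C : lmodType L -> Prop) : Prop :=
  forall M (S : {pred M}) (N : subLmodType S), C M -> C N.

Record infinite_submodule_closed (C : lmodType L -> Prop) : Prop :=
  InfiniteSubmoduleClosed {
    isc_subcategory : subcategory C;
    isc_infinite : ~ finite_subcat C;
    isc_submodule_closed : submodule_closed C
  }.

Definition minimal_subcat (C : lmodType L -> Prop) : Prop :=
  infinite_submodule_closed C /\
  forall D : lmodType L -> Prop, infinite_submodule_closed D ->
    (forall M, D M -> C M) -> forall M, C M -> D M.

End Modules.

(* Main.v *)
From HB Require Import structures.
From mathcomp Require Import all_boot all_algebra.
From mathcomp Require Import boolp functions.
Require Import Defs.
Set Implicit Arguments.
Unset Strict Implicit.
Unset Printing Implicit Defensive.
Import GRing.Theory.
Local Open Scope ring_scope.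

(** Why an infinite submodule-closed subcategory contains a minimal one.

    Let N be a finite submodule-closed subcategory of C.  An indecomposable module of C
    outside N all of whose proper submodules lie in N is called critical over N.  Every
    module of C outside N contains a critical one ([critical_exists]), and critical
    modules have bounded length ([critical_bounded]): if U is a maximal submodule of M and
    an indecomposable X occurs too often in U, then the extension M of the simple module
    M / U by U splits off a copy of X, because the extension classes are elements of a
    k-module of bounded length and become linearly dependent.

    Add to N the critical modules of maximal length.  The result [extend] is again
    submodule-closed ([extend_closed]): a critical module cogenerated by N and by critical
    modules of maximal length either lies in N or maps onto one of the latter, and then
    isomorphically.  The main point is that [extend] is again finite, that is, that the
    critical modules of maximal length are finite in number up to isomorphism
    ([top_critical_finitely_many]).  This is a first Brauer-Thrall theorem for a very
    special subcategory of bounded length, and it is where the duality of an artin algebra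
    enters.  For an indecomposable X there are finitely many linear equations over L that
    have no solution in X but acquire one along every map out of X which is not a split
    monomorphism ([left_almost_split]); this is a left almost split map, written as a
    system of equations.  Given maps X -> M_a to many pairwise non-isomorphic critical
    modules of maximal length, the images of X and of the solutions generate a submodule Z
    of the product of the M_a whose length is bounded independently of their number.  The
    summands of Z lie in N or are among the M_a, so some M_a is missing, and the map from
    X to that M_a is a sum of maps factoring through N by non-isomorphisms
    ([nonradical_finitely_many]).  Let X run through the indecomposables of N and the
    indecomposable summands of L.  If there were infinitely many M_a, then for one of them
    all maps from all X would be of this kind, hence zero by a Nakayama argument
    ([nakayama]), and the module itself would be zero.

    Iterating [extend] from the zero modules gives finite stages; their union [stages] is
    infinite and submodule-closed.  For each stage t, all critical modules over stage t
    that lie in [stages] lie in one common stage ([stages_critical]).  Now choose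
    infinite submodule-closed subcategories, each inside the preceding one, the (t+1)-st
    containing as few indecomposables of stage t as possible.  Their intersection [core]
    is minimal by this choice.  It is infinite: if it were contained in stage T, then
    every one of the chosen subcategories would contain a module critical over stage T
    from a fixed finite stage, and past that stage the choice freezes membership, so that
    the critical module would lie in the intersection.

    The duality used for [left_almost_split] is that of finite length modules over the
    commutative artinian ring k.  Such a ring has finite length ([artinian_length]), and
    the dualizing module is found as a module of maximal length among those whose socle
    contains each simple module at most once ([matlis_exists]); it separates points
    ([matlis_sep]) and finite length modules are reflexive for it ([dual_reflexive]). *)

(** * Linear maps, submodules and quotients *)

Definition onto (A B : Type) (f : A -> B) := forall y, exists x, f x = y.

Definition submodule (R : pzRingType) (V : lmodType R) (S : V -> Prop) :=
  S 0 /\ forall a u v, S u -> S v -> S (a *: u + v).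

Section Linear.
Variable R : pzRingType.
Implicit Types U V W A B : lmodType R.

Lemma lin_of_fun U V (f : U -> V) :
  (forall a u v, f (a *: u + v) = a *: f u + f v) ->
  exists g : {linear U -> V}, forall x, g x = f x.
Proof.
move=> fl; pose h := GRing.isLinear.Build R U V *:%R f fl.
by exists (HB.pack f h : {linear U -> V}).
Qed.

Lemma idlin U : exists f : {linear U -> U}, forall x, f x = x.
Proof. exact: lin_of_fun. Qed.
Lemma lin_fst A B : exists f : {linear (A * B)%type -> A}, forall x, f x = x.1.
Proof. by apply: lin_of_fun. Qed.
Lemma lin_snd A B : exists f : {linear (A * B)%type -> B}, forall x, f x = x.2.
Proof. by apply: lin_of_fun. Qed.
Lemma lin_inl A B : exists f : {linear A -> (A * B)%type}, forall x, f x = (x, 0).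
Proof.
apply: lin_of_fun => a u v; apply/eqP.
by rewrite xpair_eqE /= scaler0 addr0 !eqxx.
Qed.
Lemma lin_inr A B : exists f : {linear B -> (A * B)%type}, forall x, f x = (0, x).
Proof.
apply: lin_of_fun => a u v; apply/eqP.
by rewrite xpair_eqE /= scaler0 addr0 !eqxx.
Qed.
Lemma lin_pair U A B (f : {linear U -> A}) (g : {linear U -> B}) :
  exists h : {linear U -> (A * B)%type}, forall x, h x = (f x, g x).
Proof. by apply: lin_of_fun => a u v; rewrite !linearP. Qed.
Lemma lin_copair U A B (f : {linear A -> U}) (g : {linear B -> U}) :
  exists h : {linear (A * B)%type -> U}, forall x, h x = f x.1 + g x.2.
Proof.
by apply: lin_of_fun => a u v; rewrite !linearP /= scalerDr addrACA.
Qed.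

Lemma lin_zero U V : exists f : {linear U -> V}, forall x, f x = 0.
Proof. by apply: lin_of_fun => *; rewrite scaler0 addr0. Qed.

Lemma lin_add U V (f g : {linear U -> V}) :
  exists h : {linear U -> V}, forall x, h x = f x + g x.
Proof. by apply: lin_of_fun => a x y; rewrite !linearP /= scalerDr addrACA. Qed.

Lemma lin_orbit V (x : V) : exists f : {linear R^o -> V}, forall a, f a = (a : R) *: x.
Proof. by apply: lin_of_fun => a u v; rewrite scalerDl scalerA. Qed.

(** The graph of a linear map determines it, so maps can be given by a relation that is
    total, linear and trivial over 0; quotients and partial inverses are then handled
    without choosing representatives. *)
Lemma lin_of_rel U V (G : U -> V -> Prop) :
  (forall x, exists y, G x y) ->
  (forall a x y x' y', G x y -> G x' y' -> G (a *: x + x') (a *: y + y')) ->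
  (forall y, G 0 y -> y = 0) ->
  exists f : {linear U -> V}, forall x, G x (f x).
Proof.
move=> /choice[f fG] Gl G0.
have Gu x y y' : G x y -> G x y' -> y = y'.
  move=> /(Gl (-1) _ _ _ _)/[apply]; rewrite scaleN1r addNr => /G0.
  by rewrite scaleN1r addrC => /eqP; rewrite subr_eq0 => /eqP.
have [g gE] : exists g : {linear U -> V}, forall x, g x = f x.
  by apply: lin_of_fun => a u v; apply: Gu (fG _) _; apply: Gl.
by exists g => x; rewrite gE.
Qed.

Lemma lin_inj U V (f : {linear U -> V}) : (forall x, f x = 0 -> x = 0) -> injective f.
Proof.
move=> f0 x y e; apply/eqP; rewrite -subr_eq0; apply/eqP/f0.
by rewrite linearB /= e subrr.
Qed.

Lemma lin_inv U V (f : {linear U -> V}) : injective f -> onto f ->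
  exists g : {linear V -> U}, cancel f g /\ cancel g f.
Proof.
move=> fi fs; have [||g gE] := @lin_of_rel V U (fun y x => f x = y) fs.
- by move=> a x y x' y' <- <-; rewrite linearP.
- by move=> y; rewrite -(linear0 f) => /fi.
by exists g; split=> // x; apply: fi.
Qed.

Lemma bij_onto (A B : Type) (f : A -> B) : bijective f -> onto f.
Proof. by case=> g _ fg y; exists (g y). Qed.

Lemma inj_onto_bij U V (f : {linear U -> V}) : injective f -> onto f -> bijective f.
Proof. by move=> fi /(lin_inv fi)[g []]; exists g. Qed.

Lemma bij_inv U V (f : {linear U -> V}) : bijective f ->
  exists g : {linear V -> U}, cancel f g /\ cancel g f.
Proof. by move=> fb; apply: lin_inv; [apply: bij_inj | apply: bij_onto]. Qed.

End Linear.

Section Sub.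
Variables (R : pzRingType) (V : lmodType R) (S : V -> Prop) (hS : submodule S).
Definition submodule_pred of submodule S : {pred V} := fun x => `[< S x >].
Local Notation P := (submodule_pred hS).
Lemma submodule_pred_closed : submod_closed P.
Proof.
case: (hS) => S0 Sl; split; first exact/asboolP.
by move=> a u v /asboolP Su /asboolP Sv; apply/asboolP/Sl.
Qed.
HB.instance Definition _ := GRing.isSubmodClosed.Build R V P submodule_pred_closed.
Definition submodule_type := {x : V | x \in P}.
HB.instance Definition _ := SubType.on submodule_type.
HB.instance Definition _ := Choice.on submodule_type.
HB.instance Definition _ := [SubChoice_isSubLmodule of submodule_type by <:].
End Sub.

Section SubQuot.
Variable R : pzRingType.
Implicit Types U V W A B : lmodType R.

(** Submodules are used only through an embedding with the prescribed image, so the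
    concrete subtype does not matter afterwards. *)
Lemma submodule_embedding V (S : V -> Prop) : submodule S ->
  exists (A : lmodType R) (i : {linear A -> V}), injective i /\
    forall x, S x <-> exists a, i a = x.
Proof.
move=> hS; exists (submodule_type hS), (val : {linear submodule_type hS -> V}).
split=> [|x]; first exact: val_inj.
split=> [Sx|[a <-]]; last by case: a => a /= /asboolP.
have Px : x \in submodule_pred hS by exact/asboolP.
by exists (exist _ x Px).
Qed.

Lemma submodule_zero V : submodule (fun x : V => x = 0).
Proof. by split=> // a u v -> ->; rewrite scaler0 addr0. Qed.

Lemma zero_module_exists : exists A : lmodType R, zero_module A.
Proof.
have [A [i [ii iE]]] := submodule_embedding (submodule_zero (R^o : lmodType R)).
by exists A => a; apply: ii; rewrite linear0; apply/iE; exists a.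
Qed.

Lemma submodule_ker U V (f : {linear U -> V}) : submodule (fun x => f x = 0).
Proof.
by split=> [|a u v fu fv]; rewrite ?linear0 // linearP fu fv scaler0 addr0.
Qed.

Lemma submodule_im U V (f : {linear U -> V}) : submodule (fun y => exists x, f x = y).
Proof.
split=> [|a u v [x <-] [y <-]]; first by exists 0; rewrite linear0.
by exists (a *: x + y); rewrite linearP.
Qed.

Lemma image_factorization U V (f : {linear U -> V}) :
  exists (I : lmodType R) (p : {linear U -> I}) (i : {linear I -> V}),
    [/\ onto p, injective i & forall x, i (p x) = f x].
Proof.
have [I [i [ii iE]]] := submodule_embedding (submodule_im f).
have H x : exists y, i y = f x by apply/iE; exists x.
have [||p pE] := @lin_of_rel _ _ _ (fun x y => i y = f x) H.
- by move=> a x y x' y' e e'; rewrite !linearP e e'.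
- by move=> y; rewrite linear0 -(linear0 i) => /ii.
exists I, p, i; split=> // y; have [x fx] : exists x, f x = i y by apply/iE; exists y.
by exists x; apply: ii; rewrite pE.
Qed.
End SubQuot.

Section Quotient.
Variables (R : pzRingType) (V : lmodType R) (S : V -> Prop) (hS : submodule S).

Lemma sub_opp x : S x -> S (- x).
Proof. by case: hS => S0 Sl Sx; rewrite -[- x]addr0 -scaleN1r; apply: Sl. Qed.
Lemma sub_add x y : S x -> S y -> S (x + y).
Proof. by case: hS => S0 Sl Sx Sy; rewrite -[x]scale1r; apply: Sl. Qed.
Lemma sub_sub x y : S x -> S y -> S (x - y).
Proof. by move=> Sx Sy; apply: sub_add => //; apply: sub_opp. Qed.
Lemma sub_scale a x : S x -> S (a *: x).
Proof. by case: hS => S0 Sl Sx; rewrite -[_ *: _]addr0; apply: Sl. Qed.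
Lemma sub_zero : S 0. Proof. by case: hS. Qed.
Lemma sub_sum (I : Type) (r : seq I) (P : pred I) (F : I -> V) :
  (forall i, P i -> S (F i)) -> S (\sum_(i <- r | P i) F i).
Proof.
by move=> h; elim/big_rec: _ => [|i x Pi]; [apply: sub_zero | apply/sub_add/h].
Qed.

(** A canonical representative of the coset of x: the choice operator returns the same
    element for cosets with the same members. *)
Definition qrep (x : V) : V := choose (fun y => `[< S (y - x) >]) x.
Lemma qrepP x : S (qrep x - x).
Proof.
have h : (fun y => `[< S (y - x) >]) x.
  by apply/asboolP; rewrite subrr; apply: sub_zero.
exact: asboolW (@chooseP V (fun y => `[< S (y - x) >]) x h).
Qed.
Lemma qrep_eq x y : S (x - y) -> qrep x = qrep y.
Proof.
move=> Sxy; rewrite /qrep.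
have E : (fun z => `[< S (z - x) >]) =1 (fun z => `[< S (z - y) >]).
  move=> z; apply/asboolP/asboolP => h.
    by have := sub_add h Sxy; rewrite addrA subrK.
  by have := sub_sub h Sxy; rewrite opprB addrA subrK.
rewrite (eq_choose E); apply: choose_id; apply/asboolP.
  by [].
by rewrite subrr; apply: sub_zero.
Qed.
Definition quotient_type of submodule S := {x : V | qrep x == x}.
Local Notation Q := (quotient_type hS).
HB.instance Definition _ := SubType.on Q.
HB.instance Definition _ := Choice.on Q.
Lemma qrep_idem x : qrep (qrep x) == qrep x.
Proof. exact/eqP/qrep_eq/qrepP. Qed.
Definition qpi (x : V) : Q := exist _ (qrep x) (qrep_idem x).
Lemma qpi_eq x y : S (x - y) -> qpi x = qpi y.
Proof. by move=> h; apply: val_inj; apply: qrep_eq. Qed.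
Lemma qpi_eqE x y : qpi x = qpi y -> S (x - y).
Proof.
move=> /(congr1 val)/= e; have := sub_sub (qrepP y) (qrepP x).
by rewrite e opprB addrC addrA subrK.
Qed.
Lemma qpiK (x : Q) : qpi (val x) = x.
Proof. by apply: val_inj; case: x => x /= /eqP. Qed.
Lemma qpi_val x : S (val (qpi x) - x). Proof. exact: qrepP. Qed.
Definition qadd (x y : Q) := qpi (val x + val y).
Definition qopp (x : Q) := qpi (- val x).
Definition qscale a (x : Q) := qpi (a *: val x).
Lemma qaddE x y : qadd (qpi x) (qpi y) = qpi (x + y).
Proof.
by apply: qpi_eq; rewrite opprD addrACA; apply: sub_add; apply: qpi_val.
Qed.
Lemma qoppE x : qopp (qpi x) = qpi (- x).
Proof. by apply: qpi_eq; rewrite -opprD; apply/sub_opp/qpi_val. Qed.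
Lemma qscaleE a x : qscale a (qpi x) = qpi (a *: x).
Proof. by apply: qpi_eq; rewrite -scalerBr; apply/sub_scale/qpi_val. Qed.
Lemma qaddA : associative qadd.
Proof. by move=> x y z; rewrite -(qpiK x) -(qpiK y) -(qpiK z) !qaddE addrA. Qed.
Lemma qaddC : commutative qadd.
Proof. by move=> x y; rewrite -(qpiK x) -(qpiK y) !qaddE addrC. Qed.
Lemma qadd0 : left_id (qpi 0) qadd.
Proof. by move=> x; rewrite -(qpiK x) !qaddE add0r. Qed.
Lemma qaddN : left_inverse (qpi 0) qopp qadd.
Proof. by move=> x; rewrite -(qpiK x) qoppE qaddE addNr. Qed.
HB.instance Definition _ := GRing.isZmodule.Build Q qaddA qaddC qadd0 qaddN.
Lemma qscaleA a b v : qscale a (qscale b v) = qscale (a * b) v.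
Proof. by rewrite -(qpiK v) !qscaleE scalerA. Qed.
Lemma qscale1 : left_id 1 qscale.
Proof. by move=> v; rewrite -(qpiK v) qscaleE scale1r. Qed.
Lemma qscaleDr : right_distributive qscale +%R.
Proof.
move=> a u v; rewrite -(qpiK u) -(qpiK v).
by rewrite [qpi (val u) + _]qaddE !qscaleE [RHS]qaddE scalerDr.
Qed.
Lemma qscaleDl v : {morph qscale^~ v : a b / a + b}.
Proof. by move=> a b /=; rewrite -(qpiK v) !qscaleE [RHS]qaddE scalerDl. Qed.
HB.instance Definition _ :=
  GRing.Zmodule_isLmodule.Build R Q qscaleA qscale1 qscaleDr qscaleDl.

Lemma quotient_exists : exists (W : lmodType R) (p : {linear V ->
    W}), onto p /\ forall x, p x = 0 <-> S x.
Proof.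
have [|p pE] := @lin_of_fun R V Q qpi.
  by move=> a u v; rewrite [a *: qpi u]qscaleE [RHS]qaddE.
exists Q, p; split=> [y|x]; first by exists (val y); rewrite pE qpiK.
rewrite pE; split=> [|Sx]; last by apply: qpi_eq; rewrite subr0.
by move/qpi_eqE; rewrite subr0.
Qed.
End Quotient.

Record is_dual (k : comPzRingType) (V E D : lmodType k) (ev : D -> V -> E) : Prop := IsDual {
  dual_linl : forall a d d' x, ev (a *: d + d') x = a *: ev d x + ev d' x;
  dual_linr : forall d a x y, ev d (a *: x + y) = a *: ev d x + ev d y;
  dual_ext : forall d d', (forall x, ev d x = ev d' x) -> d = d';
  dual_full : forall f : {linear V -> E}, exists d, forall x, ev d x = f x }.

Section Dual.
Variables (k : comPzRingType) (V E : lmodType k).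

(** The linear forms on V are a submodule of the module of all functions from V to E. *)
Lemma dual_exists : exists (D : lmodType k) (ev : D -> V -> E), is_dual ev.
Proof.
pose S (f : V -> E) := forall a x y, f (a *: x + y) = a *: f x + f y.
have hS : submodule S.
  split=> [a x y|b f g fl gl a x y]; first by rewrite /= scaler0 addr0.
  change (b *: f (a *: x + y) + g (a *: x + y) =
          a *: (b *: f x + g x) + (b *: f y + g y)).
  by rewrite fl gl !scalerDr !scalerA addrACA mulrC.
have [D [i [ii iE]]] := submodule_embedding hS.
exists D, (fun d => i d); split=> [a d d' x|d||f].
- by rewrite linearP.
- by have /iE : exists a, i a = i d by exists d.
- by move=> d d' e; apply: ii; apply/funext.
have /iE[d dE] : S f by move=> a x y; rewrite linearP.
by exists d => x; rewrite dE.
Qed.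
End Dual.

(** * Length *)

Definition has_chain (R : pzRingType) (V : lmodType R) (n : nat) :=
  exists S : nat -> V -> Prop,
    [/\ forall i, submodule (S i),
        forall i x, S i x -> S i.+1 x
      & forall i, (i < n)%N -> exists2 x, S i.+1 x & ~ S i x].

(** A filtration of S with n steps, each of which is zero or simple: an element y of the
    upper term is a multiple of any new element x modulo the lower term. Allowing zero
    steps makes the notion stable under submodules and images with the same n. *)
Definition part_length_le (R : pzRingType) (V : lmodType R) (S : V -> Prop) (n : nat) :=
  exists T : nat -> V -> Prop,
    [/\ forall i, submodule (T i),
        forall x, T 0%N x -> x = 0,
        forall x, T n x <-> S x,
        forall i x, T i x -> T i.+1 x
      & forall i x y, T i.+1 x -> T i.+1 y -> ~ T i x -> exists a, T i (y - a *: x)].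

Definition length_le (R : pzRingType) (V : lmodType R) n := part_length_le (fun _ : V => True) n.

Section Chains.
Variable R : pzRingType.
Implicit Types V A B : lmodType R.

Lemma submodule_true V : submodule (fun x : V => True).
Proof. by []. Qed.

Lemma chain0 V : has_chain V 0.
Proof. by exists (fun _ _ => True); split. Qed.

Lemma chain_leq V m n : (m <= n)%N -> has_chain V n -> has_chain V m.
Proof.
move=> mn [S [S1 S2 S3]]; exists S; split=> // i im; apply: S3.
exact: leq_trans im mn.
Qed.

(** The Jordan-Hoelder inequality. A submodule C is measured by the set of steps of the
    filtration in which it contains something new; this set grows strictly with C,
    because a submodule C' above C with the same set can be exhausted from C one step at
    a time. *)
Lemma length_chain V n m : length_le V n -> has_chain V m -> (m <= n)%N.
Proof.
move=> [T [T1 T2 T3 T4 T5]] [S [S1 S2 S3]].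
pose r (C : V -> Prop) : {set 'I_n} :=
  [set i : 'I_n | `[< exists x, [/\ C x, T i.+1 x & ~ T i x] >]].
have r_sub (C C' : V -> Prop) : (forall x, C x -> C' x) -> r C \subset r C'.
  move=> CC'; apply/subsetP=> i; rewrite !inE => /asboolP[x [Cx Tx nTx]].
  by apply/asboolP; exists x; split=> //; apply: CC'.
have r_eq (C C' : V -> Prop) : submodule C -> submodule C' -> (forall x, C x -> C' x) ->
    r C' \subset r C -> forall x, C' x -> C x.
  move=> hC hC' CC' rr.
  suff H i : (i <= n)%N -> forall x, C' x -> T i x -> C x.
    by move=> x C'x; apply: (H n) => //; apply/T3.
  elim: i => [_ x _ /T2 ->|i IH lin x C'x Tx]; first exact: sub_zero hC.
  case: (pselect (T i x)) => [|nTx]; first by apply: IH => //; apply: ltnW.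
  have : Ordinal lin \in r C' by rewrite inE; apply/asboolP; exists x.
  move=> /(subsetP rr); rewrite inE => /asboolP[t [Ct Tt nTt]].
  have [a Ta] := T5 _ _ _ Tt Tx nTt.
  rewrite -(subrK (a *: t) x); apply: sub_add => //; last exact: sub_scale.
  apply: IH => //; first exact: ltnW.
  by apply: sub_sub => //; apply: sub_scale => //; apply: CC'.
have H i : (i <= m)%N -> (i <= #|r (S i)|)%N.
  elim: i => // i IH lim; apply: leq_ltn_trans (IH (ltnW lim)) _.
  have [x Sx nSx] := S3 _ lim.
  apply: proper_card; rewrite properE r_sub /=; last exact: S2.
  by apply/negP => /r_eq h; apply: nSx; apply: (h _ _ _ x) => //; exact: S2.
by apply: leq_trans (H m (leqnn _)) _; rewrite -[X in (_ <= X)%N]card_ord max_card.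
Qed.

Lemma part_length_leq V (S : V -> Prop) n m : (n <= m)%N -> part_length_le S n ->
    part_length_le S m.
Proof.
move=> nm [T [T1 T2 T3 T4 T5]].
have nT i : (n <= i)%N -> minn i n = n by move/minn_idPr.
exists (fun i => T (minn i n)); split=> // [x|x|i x|i x y].
- by rewrite min0n; apply: T2.
- by rewrite nT.
- have [ni|ni] := leqP n i; first by rewrite !nT ?(leqW ni).
  by rewrite (minn_idPl ni); apply: T4.
- have [ni|ni] := leqP n i; first by rewrite !nT ?(leqW ni).
  by rewrite (minn_idPl ni); apply: T5.
Qed.

(** Subadditivity of length: filter S first, then its translates by the images of a
    filtration of A. Images, products and cyclic extensions are special cases. *)
Lemma part_length_extend V A (S : V -> Prop) n m (g : {linear A -> V}) :
  part_length_le S n -> length_le A m ->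
  part_length_le (fun x => exists a, S (x - g a)) (n + m).
Proof.
move=> [T [T1 T2 T3 T4 T5]] [U [U1 U2 U3 U4 U5]].
have hS : submodule S.
  split=> [|a u v Su Sv]; first by apply/T3; apply: sub_zero (T1 n).
  by apply/T3; have [_] := T1 n; apply; apply/T3.
pose T' i x := if (i < n)%N then T i x else exists a, U (i - n)%N a /\ S (x - g a).
have T'n x : T' n x <-> T n x.
  rewrite /T' ltnn subnn; split=> [[a [/U2 ->]]|Sx].
    by rewrite linear0 subr0; apply: (T3 x).2.
  by exists 0; split; [by case: (U1 0%N)|rewrite linear0 subr0; apply: (T3 x).1].
have T'lt i x : (i <= n)%N -> T' i x <-> T i x.
  by rewrite leq_eqVlt => /orP[/eqP ->|lt]; [apply: T'n|rewrite /T' lt].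
have T'ge i x : (n <= i)%N -> T' i x <-> exists a, U (i - n)%N a /\ S (x - g a).
  by rewrite /T' leqNgt => /negbTE ->.
exists T'; split.
- move=> i; rewrite /T'; case: (i < n)%N => //; split=> [|a u v [b [Ub Sb]] [c [Uc Sc]]].
    by exists 0; split; [by case: (U1 (i - n)%N)|rewrite linear0 subr0; apply: sub_zero hS].
  exists (a *: b + c); split; first by have [_] := U1 (i - n)%N; apply.
  rewrite linearP opprD addrACA -scalerBr.
  by have [_] := hS; apply.
- by move=> x /(T'lt 0%N x (leq0n _)) /T2.
- move=> x; rewrite T'ge ?leq_addr // addKn; split=> [[a [_]]|[a Sa]]; exists a => //.
  by split=> //; apply/U3.
- move=> i x; have [ni|ni] := leqP n i.
    rewrite !T'ge ?(leqW ni) // subSn // => -[a [Ua Sa]].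
    by exists a; split=> //; apply: U4.
  by rewrite !T'lt ?(ltnW ni) //; apply: T4.
move=> i x y; have [ni|ni] := leqP n i; last first.
  rewrite !T'lt ?(ltnW ni) // => h1 h2 h3; have [a Ta] := T5 _ _ _ h1 h2 h3.
  by exists a; apply/T'lt => //; apply: ltnW.
rewrite !T'ge ?(leqW ni) // subSn // => -[a [Ua Sa]] [b [Ub Sb]] nx.
have nUa : ~ U (i - n)%N a by move=> h; apply: nx; exists a.
have [c Uc] := U5 _ _ _ Ua Ub nUa.
exists c; apply/T'ge => //; exists (b - c *: a); split=> //.
have -> : y - c *: x - g (b - c *: a) = (y - g b) - c *: (x - g a).
  rewrite linearB [g (c *: a)]linearZ scalerBr !opprB [LHS]addrACA [RHS]addrACA.
  by congr (_ + _); rewrite addrC.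
by apply: sub_sub => //; apply: sub_scale.
Qed.

Lemma eq_part_length V (S S' : V -> Prop) n : (forall x, S x <-> S' x) -> part_length_le S n ->
    part_length_le S' n.
Proof.
by move=> e [T [T1 T2 T3 T4 T5]]; exists T; split=> // x; rewrite T3.
Qed.

Lemma part_length0 V : part_length_le (fun x : V => x = 0) 0.
Proof.
exists (fun _ x => x = 0); split=> // i; exact: submodule_zero.
Qed.

Lemma part_length_inj V A (S : V -> Prop) n (f : {linear A -> V}) : injective f ->
  (forall a, S (f a)) -> part_length_le S n -> length_le A n.
Proof.
move=> fi fS [T [T1 T2 T3 T4 T5]]; exists (fun i a => T i (f a)); split.
- move=> i; split=> [|a u v]; first by rewrite linear0; apply: sub_zero (T1 i).
  by rewrite linearP; have [_] := T1 i; apply.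
- by move=> x /T2; rewrite -(linear0 f) => /fi.
- by move=> x; split=> // _; apply/T3.
- by move=> i x; apply: T4.
move=> i x y h1 h2 h3; have [a Ta] := T5 _ _ _ h1 h2 h3.
by exists a; rewrite linearB linearZ.
Qed.

Lemma length_inj V A n (f : {linear A -> V}) : injective f -> length_le V n -> length_le A n.
Proof. by move=> fi; apply: (part_length_inj fi). Qed.

Lemma length_onto V B n (f : {linear V -> B}) : onto f -> length_le V n -> length_le B n.
Proof.
move=> fs /(part_length_extend f (part_length0 B)); rewrite add0n; apply: eq_part_length => x.
by split=> // _; have [a <-] := fs x; exists a; rewrite subrr.
Qed.

Lemma length_prod A B n m : length_le A n -> length_le B m -> length_le (A * B)%type (n + m).
Proof.
move=> fA fB.
have [f fE] := lin_inl A B; have [g gE] := lin_inr A B.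
have := part_length_extend g (part_length_extend f (part_length0 _) fA) fB.
rewrite add0n; apply: eq_part_length => -[x y]; split=> // _.
exists y, x; rewrite fE gE; apply/eqP.
by rewrite xpair_eqE /= !oppr0 !addr0 !subrr !eqxx.
Qed.

(** One generator per step of the filtration in which W contains something new. *)
Lemma length_generators V n (W : V -> Prop) : length_le V n -> submodule W ->
  exists x : nat -> V, (forall i, W (x i)) /\
    forall w, W w -> exists a : nat -> R, w = \sum_(i < n) a i *: x i.
Proof.
move=> [T [T1 T2 T3 T4 T5]] hW.
have /choice[x xP] i : exists x, W x /\ T i.+1 x /\
    ((exists y, [/\ W y, T i.+1 y & ~ T i y]) -> ~ T i x).
  case: (pselect (exists y, [/\ W y, T i.+1 y & ~ T i y])) => [[y [Wy Ty nTy]]|h].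
    by exists y.
  by exists 0; split; [|split=> //]; apply: sub_zero; [exact: hW | exact: T1].
exists x; split=> [i|w Ww]; first by have [] := xP i.
suff H i w' : W w' -> T i w' -> exists a : nat -> R, w' = \sum_(j < i) a j *: x j.
  by apply: H Ww _; apply/T3.
elim: i w' => [|i IH] w' Ww' Tw'; first by exists (fun=> 0); rewrite big_ord0 (T2 _ Tw').
case: (pselect (exists y, [/\ W y, T i.+1 y & ~ T i y])) => h; last first.
  case: (IH w') => // [|a ->].
    by apply: contrapT => nT; apply: h; exists w'.
  exists (fun j => if (j < i)%N then a j else 0); rewrite big_ord_recr /= ltnn scale0r addr0.
  by apply: eq_bigr => j _; rewrite ltn_ord.
have [Wx [Tx nTx]] := xP i; have [c Tc] := T5 _ _ _ Tx Tw' (nTx h).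
have [|a aE] := IH _ _ Tc; first by apply: sub_sub => //; apply: sub_scale.
exists (fun j => if (j < i)%N then a j else c); rewrite big_ord_recr /= ltnn.
rewrite -[w'](subrK (c *: x i)) aE; congr (_ + _).
by apply: eq_bigr => j _; rewrite ltn_ord.
Qed.

Definition span V (v : nat -> V) n (x : V) := exists a : nat -> R, x = \sum_(i < n) a i *: v i.

Lemma submodule_span V (v : nat -> V) n : submodule (span v n).
Proof.
split=> [|c x y [a ->] [b ->]].
  by exists (fun=> 0); rewrite big1 // => i _; rewrite scale0r.
exists (fun i => c * a i + b i); rewrite scaler_sumr -big_split; apply: eq_bigr => i _.
by rewrite scalerA scalerDl.
Qed.

Lemma spanS V (v : nat -> V) n x : span v n x -> span v n.+1 x.
Proof.
move=> [a ->]; exists (fun i => if (i < n)%N then a i else 0).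
rewrite big_ord_recr /= ltnn scale0r addr0; apply: eq_bigr => i _.
by rewrite ltn_ord.
Qed.

Lemma span_last V (v : nat -> V) n : span v n.+1 (v n).
Proof.
exists (fun i => (i == n)%:R); rewrite big_ord_recr /= eqxx scale1r big1 ?add0r // => i _.
by rewrite ltn_eqF ?scale0r.
Qed.

(** Otherwise the spans of initial segments would form a chain of length n + 1. *)
Lemma length_dependent V n (v : nat -> V) : length_le V n ->
    exists2 j, (j <= n)%N & span v j (v j).
Proof.
move=> fV; apply: contrapT => h.
suff /(length_chain fV) : has_chain V n.+1 by rewrite ltnn.
exists (span v); split=> [i|i x|i lin]; [exact: submodule_span | exact: spanS |].
exists (v i); first exact: span_last.
by move=> s; apply: h; exists i.
Qed.

Lemma length_maximal V n (Q : (V -> Prop) -> Prop) S0 : length_le V n -> Q S0 ->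
  (forall S, Q S -> submodule S) ->
  exists2 S, Q S & forall S', Q S' -> (forall x, S x -> S' x) -> forall x, S' x -> S x.
Proof.
move=> fV Q0 Qs; apply: contrapT => h.
have /choice[f fP] (S : {S | Q S}) : exists S' : {S | Q S},
    (forall x, sval S x -> sval S' x) /\ exists2 x, sval S' x & ~ sval S x.
  case: S => S QS /=; apply: contrapT => h'; apply: h; exists S => // S' QS' SS' x S'x.
  apply: contrapT => nSx; apply: h'; exists (exist _ S' QS'); split=> //=.
  by exists x.
pose s i := iter i f (exist _ S0 Q0).
suff /(length_chain fV) : has_chain V n.+1 by rewrite ltnn.
exists (fun i => sval (s i)); split=> [i|i|i _].
- by apply: Qs; apply: svalP.
- exact: (fP (s i)).1.
- exact: (fP (s i)).2.
Qed.

Lemma length_minimal V n (Q : (V -> Prop) -> Prop) S0 : length_le V n -> Q S0 ->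
  (forall S, Q S -> submodule S) ->
  exists2 S, Q S & forall S', Q S' -> (forall x, S' x -> S x) -> forall x, S x -> S' x.
Proof.
move=> fV Q0 Qs; apply: contrapT => h.
have /choice[f fP] (S : {S | Q S}) : exists S' : {S | Q S},
    (forall x, sval S' x -> sval S x) /\ exists2 x, sval S x & ~ sval S' x.
  case: S => S QS /=; apply: contrapT => h'; apply: h; exists S => // S' QS' SS' x Sx.
  apply: contrapT => nSx; apply: h'; exists (exist _ S' QS'); split=> //=.
  by exists x.
pose s i := iter i f (exist _ S0 Q0).
suff /(length_chain fV) : has_chain V n.+1 by rewrite ltnn.
exists (fun i => sval (s (n.+1 - i)%N)); split=> [i|i|i lin].
- by apply: Qs; apply: svalP.
- have [ni|ni] := ltnP i n.+1; first by rewrite -(subnSK ni); apply: (fP (s _)).1.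
  have /eqP-> : (n.+1 - i == 0)%N by rewrite subn_eq0.
  by have /eqP-> : (n.+1 - i.+1 == 0)%N by rewrite subn_eq0 leqW.
- by rewrite -(subnSK lin); apply: (fP (s _)).2.
Qed.

Lemma chain_inj V A n (f : {linear A -> V}) : injective f -> has_chain A n -> has_chain V n.
Proof.
move=> fi [S [S1 S2 S3]]; exists (fun i x => exists2 a, S i a & f a = x); split.
- move=> i; split=> [|c x y [a Sa <-] [b Sb <-]].
    by exists 0; rewrite ?linear0 //; apply: sub_zero (S1 i).
  by exists (c *: a + b); rewrite ?linearP //; have [_] := S1 i; apply.
- by move=> i x [a /S2 Sa <-]; exists a.
move=> i /S3[a Sa nSa]; exists (f a); first by exists a.
by move=> [b Sb /fi e]; apply: nSa; rewrite -e.
Qed.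

Lemma chain_inj_proper V A n (f : {linear A -> V}) : injective f -> ~ onto f ->
  has_chain A n -> has_chain V n.+1.
Proof.
move=> fi fs [S [S1 S2 S3]].
exists (fun i x => if (i <= n)%N then exists2 a, S i a & f a = x else True); split.
- move=> i; case: (i <= n)%N => //; split=> [|c x y [a Sa <-] [b Sb <-]].
    by exists 0; rewrite ?linear0 //; apply: sub_zero (S1 i).
  by exists (c *: a + b); rewrite ?linearP //; have [_] := S1 i; apply.
- move=> i x; have [h|h] := leqP i.+1 n; last by case: ifP.
  by rewrite (ltnW h) => -[a /S2 Sa <-]; exists a.
move=> i le_in; have [lin|nin] := ltnP i n; last first.
  have ->: i = n by apply/eqP; rewrite eqn_leq nin -ltnS le_in.
  rewrite leqnn; apply: contrapT => h; apply: fs => y; apply: contrapT => h'.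
  by apply: h; exists y => // -[a _ e]; apply: h'; exists a.
rewrite (ltnW lin); have [a Sa nSa] := S3 _ lin; exists (f a); first by exists a.
by move=> [b Sb /fi e]; apply: nSa; rewrite -e.
Qed.

Lemma chain_surj_proper V B n (f : {linear V -> B}) : onto f -> ~ injective f ->
  has_chain B n -> has_chain V n.+1.
Proof.
move=> fs fi [S [S1 S2 S3]].
exists (fun i x => if i is j.+1 then S j (f x) else x = 0); split.
- case=> [|i]; first exact: submodule_zero.
  split=> [|c x y Sx Sy]; rewrite ?linear0 ?linearP; first exact: sub_zero (S1 i).
  by have [_] := S1 i; apply.
- case=> [x ->|i x]; last exact: S2.
  by rewrite linear0; apply: sub_zero (S1 _).
case=> [_|i]; last first.
  by rewrite ltnS => /S3[b Sb nSb]; have [x xE] := fs b; exists x; rewrite xE.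
apply: contrapT => h; apply: fi; apply: lin_inj => x fx; apply: contrapT => x0.
by apply: h; exists x => //; rewrite fx; apply: sub_zero (S1 _).
Qed.

Lemma longest_chain V n : length_le V n -> exists2 m, has_chain V m & ~ has_chain V m.+1.
Proof.
move=> fV; apply: contrapT => h.
suff /(_ n.+1)/(length_chain fV) : forall m, has_chain V m by rewrite ltnn.
elim=> [|m IH]; first exact: chain0.
by apply: contrapT => h'; apply: h; exists m.
Qed.

(** A proper submodule has strictly smaller length. The hypothesis on chains says that A
    is at least as long as V. *)
Lemma length_inj_onto V A n (f : {linear A -> V}) : length_le V n ->
  (forall m, has_chain V m -> has_chain A m) -> injective f -> onto f.
Proof.
move=> /longest_chain[m cm ncm] h fi; apply: contrapT => /(chain_inj_proper fi).
by move=> /(_ m (h _ cm)).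
Qed.

Lemma length_onto_inj V B n (f : {linear V -> B}) : length_le V n ->
  (forall m, has_chain V m -> has_chain B m) -> onto f -> injective f.
Proof.
move=> /longest_chain[m cm ncm] h fs; apply: contrapT => /(chain_surj_proper fs).
by move=> /(_ m (h _ cm)).
Qed.
End Chains.

(** * Commutative artinian rings have finite length *)

Section Ext2.
Variable R : pzRingType.
Implicit Types V C : lmodType R.

(** Extensions of modules of finite length have finite length, in the form needed for a
    multiplication map of an ideal into itself. *)
Lemma part_length_ker_im V C (I : V -> Prop) n m (f : {linear V -> C}) : submodule I ->
  part_length_le (fun x => I x /\ f x = 0) n ->
    part_length_le (fun y => exists2 x, I x & f x = y) m ->
  part_length_le I (n + m).
Proof.
move=> hI [T [T1 T2 T3 T4 T5]] [U [U1 U2 U3 U4 U5]].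
pose T' i x := if (i < n)%N then T i x else I x /\ U (i - n)%N (f x).
have T'n x : T' n x <-> T n x.
  rewrite /T' ltnn subnn; split=> [[Ix /U2 fx]|/T3[Ix fx]]; first exact/T3.
  by split=> //; rewrite fx; case: (U1 0%N).
have T'lt i x : (i <= n)%N -> T' i x <-> T i x.
  by rewrite leq_eqVlt => /orP[/eqP ->|lt]; [apply: T'n|rewrite /T' lt].
have T'ge i x : (n <= i)%N -> T' i x <-> I x /\ U (i - n)%N (f x).
  by rewrite /T' leqNgt => /negbTE ->.
exists T'; split.
- move=> i; rewrite /T'; case: (i < n)%N => //; split=> [|a u v [Iu Uu] [Iv Uv]].
    by split; [case: hI | rewrite linear0; case: (U1 (i - n)%N)].
  by split; [case: hI => _; apply | rewrite linearP; case: (U1 (i - n)%N) => _; apply].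
- by move=> x /(T'lt 0%N x (leq0n _)) /T2.
- move=> x; rewrite T'ge ?leq_addr // addKn; split=> [[]//|Ix]; split=> //.
  by apply/U3; exists x.
- move=> i x; have [ni|ni] := leqP n i; last by rewrite !T'lt ?(ltnW ni) //; apply: T4.
  by rewrite !T'ge ?(leqW ni) // subSn // => -[Ix /U4].
move=> i x y; have [ni|ni] := leqP n i; last first.
  rewrite !T'lt ?(ltnW ni) // => h1 h2 h3; have [a Ta] := T5 _ _ _ h1 h2 h3.
  by exists a; apply/T'lt => //; apply: ltnW.
rewrite !T'ge ?(leqW ni) // subSn // => -[Ix Ux] [Iy Uy] nx.
have [|a Ua] := U5 _ _ _ Ux Uy; first by move=> h; apply: nx.
exists a; apply/T'ge => //; split; last by rewrite linearB linearZ.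
by apply: sub_sub => //; apply: sub_scale.
Qed.
End Ext2.

Section Artin.
Variable k : comPzRingType.
Hypothesis art : artinian k^o.

Lemma artinian_dcc (S : nat -> k^o -> Prop) : (forall i, submodule (S i)) ->
  (forall i x, S i.+1 x -> S i x) ->
  exists n, forall m x, (n <= m)%N -> S n x -> S m x.
Proof.
move=> hS dS; pose P i : {pred k^o} := fun x => `[< S i x >].
have [|i x /asboolP Sx|n h] := @art P.
- by move=> i; split=> [|a u v /asboolP Su /asboolP Sv]; apply/asboolP; case: (hS i) => // _;
  apply.
- exact/asboolP/dS.
exists n => m x nm Sx; have e := h m nm x.
suff : x \in P m by move/asboolP.
by rewrite e; apply/asboolP.
Qed.

Lemma artinian_minimal (Q : (k^o -> Prop) -> Prop) S0 : Q S0 ->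
  (forall S, Q S -> submodule S) ->
  exists2 S, Q S & forall S', Q S' -> (forall x, S' x -> S x) -> forall x, S x -> S' x.
Proof.
move=> Q0 Qs; apply: contrapT => h.
have /choice[f fP] (S : {S | Q S}) : exists S' : {S | Q S},
    (forall x, sval S' x -> sval S x) /\ exists2 x, sval S x & ~ sval S' x.
  case: S => S QS /=; apply: contrapT => h'; apply: h; exists S => // S' QS' SS' x Sx.
  apply: contrapT => nSx; apply: h'; exists (exist _ S' QS'); split=> //=.
  by exists x.
pose s i := iter i f (exist _ S0 Q0).
have [i|i|n hn] := @artinian_dcc (fun i => sval (s i)).
- by apply: Qs; apply: svalP.
- exact: (fP (s i)).1.
have [x Sx nSx] := (fP (s n)).2; apply: nSx.
exact: (hn n.+1 x (leqnSn _) Sx).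
Qed.

Lemma sum_pad (v a : nat -> k^o) m d : (forall i, (m <= i)%N -> a i = 0) ->
  \sum_(i < m + d) a i *: v i = \sum_(i < m) a i *: v i.
Proof.
move=> h; elim: d => [|d IH]; first by rewrite addn0.
by rewrite addnS big_ord_recr /= IH h ?leq_addr // scale0r addr0.
Qed.

Section MinInf.
Variable I : k^o -> Prop.
Hypothesis hI : submodule I.
Hypothesis nI : ~ exists n, part_length_le I n.
Hypothesis mI : forall J : k^o -> Prop, submodule J -> (forall x, J x -> I x) ->
  (exists2 x, I x & ~ J x) -> exists n, part_length_le J n.

(** Multiplication by a maps I onto aI with kernel the annihilator of a in I. If both
    were proper submodules of I, then both would have finite length, and so would I. *)
Lemma minimal_infinite_mul (a : k) :
  (forall x, I x -> a * x = 0) \/ (forall x, I x -> exists2 y, I y & a * y = x).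
Proof.
apply: contrapT => /not_orP[/existsNP[x0 /not_implyP[Ix0 nx0]] /existsNP[y0 /not_implyP[Iy0
  ny0]]].
have [f fE] : exists f : {linear k^o -> k^o}, forall x, f x = a * x.
  apply: lin_of_fun => c u v.
  by rewrite mulrDr; congr (_ + _); rewrite /GRing.scale /= mulrCA.
apply: nI; have [|||n fn] := mI (J := fun x => I x /\ f x = 0).
- split=> [|c u v [Iu fu] [Iv fv]]; first by rewrite linear0; split=> //; case: hI.
  by rewrite linearP fu fv scaler0 addr0; split=> //; case: hI => _; apply.
- by move=> x [].
- by exists x0 => // -[_]; rewrite fE.
have [|||m fm] := mI (J := fun y => exists2 x, I x & f x = y).
- split=> [|c u v [u' Iu fu] [v' Iv fv]]; first by exists 0; rewrite ?linear0 //; case: hI.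
  by exists (c *: u' + v'); rewrite ?linearP ?fu ?fv //; case: hI => _; apply.
- by move=> y [x Ix <-]; rewrite fE; apply: (sub_scale hI a).
- by exists y0 => // -[x Ix]; rewrite fE => e; apply: ny0; exists x.
by exists (n + m)%N; apply: part_length_ker_im fn fm.
Qed.

(** The descending powers of a give a relation between a^n and a^(n+1); as a maps I onto
    I, this makes a act invertibly on I. Thus I is a vector space over a residue field
    of k. *)
Lemma minimal_infinite_inv (a : k) :
  (forall x, I x -> a * x = 0) \/ (exists b, forall x, I x -> b * (a * x) = x).
Proof.
have [|aI] := minimal_infinite_mul a; [by left | right].
have [i|i x|n h] := @artinian_dcc (fun i x => exists y : k, x = a ^+ i * y).
- split=> [|c u v [u' ->] [v' ->]]; first by exists 0; rewrite mulr0.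
  by exists (c * u' + v'); rewrite mulrDr mulrCA.
- by move=> [y ->]; exists (a * y); rewrite exprSr mulrA.
have [b bE] := h n.+1 (a ^+ n) (leqnSn n) (ex_intro _ 1 (esym (mulr1 _))).
exists b => x Ix.
have [y ->] : exists y, x = a ^+ n * y.
  elim: {bE h} n x Ix => [x _|n IH x Ix]; first by exists x; rewrite expr0 mul1r.
  have [x' /IH[y ->] <-] := aI _ Ix.
  by exists y; rewrite exprS mulrA.
suff e : b * (a * a ^+ n) = a ^+ n by rewrite -[in RHS]e !mulrA.
by rewrite -exprS [RHS]bE mulrC.
Qed.

(** In a vector space the spans of initial segments are a filtration with simple or zero
    steps, so a finite spanning family would give I finite length. *)
Lemma minimal_infinite_span (v : nat -> k^o) n : (forall i, I (v i)) ->
    exists2 x, I x & ~ span v n x.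
Proof.
move=> Iv; apply: contrapT => h; apply: nI; exists n.
exists (span v); split=> [i|x [a ->]|x|i x|i x y].
- exact: submodule_span.
- by rewrite big_ord0.
- split=> [[a ->]|Ix]; last by apply: contrapT => h'; apply: h; exists x.
  by apply: sub_sum => // i _; apply: sub_scale.
- exact: spanS.
move=> [a ->] [c ->] nx.
have [a0|[b ab]] := minimal_infinite_inv (a i).
  case: nx; exists a; rewrite big_ord_recr /= [X in _ + X](_ : _ = 0) ?addr0 //.
  exact: a0.
exists (c i * b), (fun j => c j - c i * b * a j).
rewrite !big_ord_recr /= scalerDr scaler_sumr opprD addrACA -sumrB.
rewrite [X in _ + X](_ : _ = 0) ?addr0.
  by apply: eq_bigr => j _; rewrite scalerBl scalerA.
rewrite scalerA -scalerBl -mulrA scalerBl -scalerA; apply/eqP; rewrite subr_eq0; apply/eqP.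
by congr (_ *: _); rewrite -scalerA; exact/esym/ab.
Qed.

(** An infinite linearly independent sequence in I has strictly decreasing spans of
    tails, against the descending chain condition. *)
Lemma minimal_infinite_false : False.
Proof.
have /choice[g gP] (p : (nat -> k^o) * nat) : exists x,
    I x /\ ((forall i, I (p.1 i)) -> ~ span p.1 p.2 x).
  case: p => v n; case: (pselect (forall i, I (v i))) => Iv.
    by have [x Ix nx] := minimal_infinite_span n Iv; exists x.
  by exists 0; split; [case: hI | move/Iv].
pose w := fix w n : nat -> k^o := if n is m.+1 then
  (fun i => if (i < m)%N then w m i else g (w m, m)) else (fun=> 0).
pose v i := w i.+1 i.
have Iw n i : I (w n i).
  by elim: n i => [|n IH] i /=; [case: hI | case: ifP => // _; apply: (gP _).1].
have wE n i : (i < n)%N -> w n i = v i.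
  elim: n i => // n IH i; rewrite ltnS => lin.
  rewrite /= /v /= ltnn; have [|ni] := ltnP i n; first by move=> /IH ->; rewrite /v /= ltnn.
  by have -> : i = n by apply/eqP; rewrite eqn_leq lin.
have vP n : ~ span v n (v n).
  have := (gP (w n, n)).2 (Iw n); rewrite /= [v n]/v /= ltnn => h [a aE]; apply: h.
  by exists a; rewrite aE; apply: eq_bigr => i _; rewrite wE.
have Iv n : I (v n) by apply: Iw.
have indep m (a : nat -> k) : \sum_(i < m) a i *: v i = 0 -> forall i, (i < m)%N ->
  a i *: v i = 0.
  elim: m a => // m IH a; rewrite big_ord_recr /= => e.
  have [a0|[b ab]] := minimal_infinite_inv (a m).
    move=> i; rewrite ltnS leq_eqVlt => /orP[/eqP ->|]; first exact: a0.
    by apply: IH; move: e; rewrite [X in _ + X](_ : _ = 0) ?addr0 //; apply: a0.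
  case: (vP m); exists (fun i => - b * a i).
  rewrite -[LHS](ab (v m)) //; have -> : a m * v m = - \sum_(i < m) a i *: v i.
    by apply/eqP; rewrite -addr_eq0 addrC; apply/eqP.
  rewrite mulrN -mulNr mulr_sumr; apply: eq_bigr => i _; exact: mulrA.
pose S n x := exists m (a : nat -> k),
  [/\ forall i, (i < n)%N -> a i = 0, forall i, (m <= i)%N -> a i = 0 &
      x = \sum_(i < m) a i *: v i].
have [n|n x [m [a [a1 a2 ->]]]|n hn] := @artinian_dcc S.
- split=> [|c x y [m [a [a1 a2 ->]]] [m' [b [b1 b2 ->]]]].
    by exists 0%N, (fun=> 0); split=> //; rewrite big_ord0.
  exists (m + m')%N, (fun i => c * a i + b i); split=> [i lin|i lmi|].
  - by rewrite a1 // b1 // mulr0 addr0.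
  - by rewrite a2 ?b2 ?mulr0 ?addr0 //; apply: leq_trans lmi; rewrite ?leq_addr ?leq_addl.
  rewrite -(sum_pad v m' a2) -(sum_pad v m b2) addnC scaler_sumr [(m' + m)%N]addnC -big_split.
  by apply: eq_bigr => i _ /=; rewrite scalerA -scalerDl.
- by exists m, a; split=> // i lin; apply: a1; apply: leqW.
have [|m [a [a1 a2 vE]]] := hn n.+1 (v n) (leqnSn n).
  exists n.+1, (fun i => (i == n)%:R); split=> [i lin|i lni|].
  - by rewrite ltn_eqF.
  - by rewrite gtn_eqF.
  rewrite big_ord_recr /= eqxx scale1r big1 ?add0r // => i _.
  by rewrite ltn_eqF ?scale0r.
pose c i := (i == n)%:R - a i.
have c0 : \sum_(i < m + n.+1) c i *: v i = 0.
  under eq_bigr do rewrite scalerBl.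
  rewrite sumrB (sum_pad v n.+1 a2) -vE; apply/eqP; rewrite subr_eq0; apply/eqP.
  rewrite (bigD1 (Ordinal (leq_addl m n.+1))) //= eqxx scale1r big1 ?addr0 // => i.
  by rewrite -val_eqE /= => /negbTE ->; rewrite scale0r.
have := indep _ _ c0 n (leq_addl m n.+1); rewrite /c eqxx a1 // subr0 scale1r => v0.
by apply: (vP n); rewrite v0; apply: sub_zero (submodule_span _ _).
Qed.
End MinInf.

(** The descending chain condition gives an ideal minimal among those not of finite
    length; it would be an infinite-dimensional vector space, still with the descending
    chain condition. *)
Lemma artinian_length : exists n, length_le k^o n.
Proof.
apply: contrapT => h.
have [||I [hI nI] mI] := @artinian_minimal (fun I => submodule I /\ ~ exists n,
  part_length_le I n) (fun=> True).
- by split.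
- by move=> S [].
apply: (@minimal_infinite_false I hI nI) => J hJ JI [x Ix nJx].
apply: contrapT => nJ; apply: nJx; exact: (mI J).
Qed.
End Artin.

(** * Duality over a commutative artinian ring *)

(** The submodule k x is simple. *)
Definition simple_generator (k : comPzRingType) (E : lmodType k) (x : E) :=
  x <> 0 /\ forall a, a *: x <> 0 -> exists b, x = b *: (a *: x).

(** Isomorphic simple submodules coincide: the socle contains every simple module at
    most once. The second hypothesis says that y is 0 or generates a simple submodule
    isomorphic to k x. *)
Definition multfree_socle (k : comPzRingType) (E : lmodType k) :=
  forall x y : E, simple_generator x -> (forall a, a *: x = 0 -> a *: y = 0) ->
  exists b, y = b *: x.

Section Dual.
Variables (k : comPzRingType) (E : lmodType k).
Hypothesis uE : multfree_socle E.
Variables (V D : lmodType k) (ev : D -> V -> E).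
Hypothesis dD : is_dual ev.

Lemma ev0r d : ev d 0 = 0.
Proof.
have e := dual_linr dD d (-1) 0 0.
by rewrite scaler0 add0r scaleN1r addNr in e.
Qed.
Lemma ev0l x : ev 0 x = 0.
Proof.
have e := dual_linl dD (-1) 0 0 x.
by rewrite scaler0 add0r scaleN1r addNr in e.
Qed.
Lemma evDr d x y : ev d (x + y) = ev d x + ev d y.
Proof. by have := dual_linr dD d 1 x y; rewrite !scale1r. Qed.
Lemma evDl d d' x : ev (d + d') x = ev d x + ev d' x.
Proof. by have := dual_linl dD 1 d d' x; rewrite !scale1r. Qed.
Lemma evZr d a x : ev d (a *: x) = a *: ev d x.
Proof. by have := dual_linr dD d a x 0; rewrite !addr0 ev0r addr0. Qed.
Lemma evZl d a x : ev (a *: d) x = a *: ev d x.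
Proof. by have := dual_linl dD a d 0 x; rewrite !addr0 ev0l addr0. Qed.
Lemma evBr d x y : ev d (x - y) = ev d x - ev d y.
Proof. by rewrite evDr -scaleN1r evZr scaleN1r. Qed.
Lemma evBl d d' x : ev (d - d') x = ev d x - ev d' x.
Proof. by rewrite evDl -scaleN1r evZl scaleN1r. Qed.

Section Step.
Variables (S S' : V -> Prop).
Hypothesis SS' : forall x y, S' x -> S' y -> ~ S x -> exists a, S (y - a *: x).
Let A d := forall x, S x -> ev d x = 0.
Let A' d := forall x, S' x -> ev d x = 0.

Lemma dual_simple f x : A f -> S' x -> ev f x <> 0 -> submodule S' -> simple_generator (ev f x).
Proof.
move=> Af Sx fx hS'; split=> // a afx.
have [||b /Af] := SS' (y := x) (sub_scale hS' a Sx) => //.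
  by move=> /Af; rewrite evZr.
by rewrite evBr !evZr => /eqP; rewrite subr_eq0 => /eqP e; exists b.
Qed.

Lemma dual_ann f x a : submodule S' -> A f -> S' x -> ev f x <> 0 -> a *: ev f x = 0 ->
    S (a *: x).
Proof.
move=> hS' Af Sx fx afx; apply: contrapT => nS.
have [b /Af] := SS' (y := x) (sub_scale hS' a Sx) Sx nS.
by rewrite evBr !evZr afx scaler0 subr0.
Qed.

(** On the annihilator of S inside the dual, evaluation at x in S' is injective modulo
    the annihilator of S', and its values lie in one simple submodule of E; hence this
    step of the dual filtration is again simple or zero. *)
Lemma dual_step f x d : submodule S' -> A f -> A d -> S' x -> ev f x <> 0 ->
  exists2 c, ev d x = c *: ev f x & A' (d - c *: f).
Proof.
move=> hS' Af Ad Sx fx.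
have [|c cE] := uE (y := ev d x) (dual_simple Af Sx fx hS').
  by move=> a /(dual_ann hS' Af Sx fx) /Ad; rewrite evZr.
exists c => // z Sz.
have [b Sb] := SS' Sx Sz (fun h => fx (Af _ h)).
rewrite -(subrK (b *: x) z) evDr evBl evZl (Af _ Sb) (Ad _ Sb) scaler0 subr0 add0r.
by rewrite evZr evBl evZl cE subrr scaler0.
Qed.
End Step.

(** The annihilators of the terms of a filtration of V filter the dual, with simple or
    zero steps. *)
Lemma dual_length n : length_le V n -> length_le D n.
Proof.
move=> [T [T1 T2 T3 T4 T5]].
exists (fun i d => forall x, T (n - i)%N x -> ev d x = 0); split.
- move=> i; split=> [x _|a d d' h h' x Tx]; first exact: ev0l.
  by rewrite (dual_linl dD) h // h' // scaler0 addr0.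
- move=> d h; apply: (dual_ext dD) => x; rewrite ev0l; apply: h.
  by rewrite subn0; apply/T3.
- move=> d; split=> // _ x; rewrite subnn => /T2 ->; exact: ev0r.
- move=> i d h x; move=> Tx; apply: h; move: Tx; case: (ltnP i n) => [lin|nin].
    by rewrite -(subnSK lin); apply: T4.
  have /eqP-> : (n - i == 0)%N by rewrite subn_eq0.
  have /eqP e : (n - i.+1 == 0)%N by rewrite subn_eq0 leqW.
  by rewrite -e.
move=> i f d; case: (ltnP i n) => [lin|nin]; last first.
  have /eqP-> : (n - i == 0)%N by rewrite subn_eq0.
  by have /eqP-> : (n - i.+1 == 0)%N by rewrite subn_eq0 leqW.
rewrite -(subnSK lin); move: (n - i.+1)%N => j Af Ad nf.
have [x Tx fx] : exists2 x, T j.+1 x & ev f x <> 0.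
  by apply: contrapT => h; apply: nf => x Tx; apply: contrapT => fx; apply: h; exists x.
by have [c _ h] := dual_step (T5 j) (T1 _) Af Ad Tx fx; exists c.
Qed.

(** A linear form on the dual is corrected step by step along the filtration of V: on
    each step the dual is generated by one form f, and the value required at f is a
    multiple of f x, because the socle of E is multiplicity free. *)
Lemma dual_reflexive n (Phi : {linear D -> E}) : length_le V n ->
    exists v, forall d, Phi d = ev d v.
Proof.
move=> [T [T1 T2 T3 T4 T5]].
suff H i : (i <= n)%N -> exists v, forall d, (forall x, T (n - i)%N x -> ev d x = 0) ->
  Phi d = ev d v.
  have [v vE] := H n (leqnn n); exists v => d; apply: vE => x.
  by rewrite subnn => /T2 ->; exact: ev0r.
elim: i => [_|i IH lin].
  exists 0 => d h; have -> : d = 0.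
    by apply: (dual_ext dD) => x; rewrite ev0l; apply: h; rewrite subn0; apply/T3.
  by rewrite linear0 ev0l.
have [v] := IH (ltnW lin); rewrite -(subnSK lin); move: (n - i.+1)%N => j {IH}vE.
case: (pselect (exists f x, [/\ forall x, T j x -> ev f x = 0, T j.+1 x & ev f x <> 0]));
  last first.
  move=> h; exists v => d Ad; apply: vE => x Tx; apply: contrapT => fx.
  by apply: h; exists d, x.
move=> [f [x [Af Tx fx]]].
have [|b bE] := uE (y := Phi f - ev f v) (dual_simple (T5 j) Af Tx fx (T1 _)).
  move=> a afx; rewrite scalerBr -evZl -linearZ /=; apply/eqP; rewrite subr_eq0;
    apply/eqP/vE => z Tz.
  have [c Tc] := T5 _ _ _ Tx Tz (fun h => fx (Af _ h)).
  by rewrite -(subrK (c *: x) z) evDr !evZl evZr (Af _ Tc) scaler0 add0r scalerA mulrC -scalerA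
    afx scaler0.
exists (v + b *: x) => d Ad.
have [c cE /vE] := dual_step (T5 j) (T1 _) Af Ad Tx fx.
rewrite linearB linearZ /= evBl evZl evDr evZr cE => /eqP; rewrite subr_eq => /eqP ->.
rewrite -addrA [- _ + _]addrC -scalerBr bE; congr (_ + _).
by rewrite !scalerA mulrC.
Qed.
End Dual.

Section Matlis.
Variables (k : comPzRingType) (n0 : nat).
Hypothesis fk : length_le k^o n0.

(** E is the dual of k with values in E. *)
Lemma multfree_socle_length (E : lmodType k) : multfree_socle E -> length_le E n0.
Proof.
move=> uE; have [D [ev dD]] := dual_exists k^o E; have [h1 h2 h3 h4] := dD.
have [e|||f fE] := @lin_of_rel _ E D (fun e d => forall a, ev d a = a *: e).
- have [f fE] := lin_orbit e.
  by have [d dE] := h4 f; exists d => a; rewrite dE.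
- by move=> a x y x' y' h h' c; rewrite h1 h h' scalerDr !scalerA mulrC.
- by move=> y h; apply: h3 => a; rewrite h scaler0 (ev0l dD).
apply: (length_inj (f := f)); last exact: (dual_length uE dD fk).
apply: lin_inj => e fe; have := fE e 1; rewrite fe scale1r => <-.
exact: ev0l dD _.
Qed.

(** Modules with multiplicity free socle have length at most that of k, so there is one
    of maximal length; it has no proper extension of the same kind. *)
Lemma matlis_exists : exists E : lmodType k, multfree_socle E /\
  forall (E' : lmodType k) (f : {linear E -> E'}), multfree_socle E' -> injective f -> onto f.
Proof.
pose P m := exists E : lmodType k, multfree_socle E /\ has_chain E m.
have Pb m : P m -> (m <= n0)%N.
  by move=> [E [/multfree_socle_length uE cE]]; apply: length_chain uE cE.
have P0 : P 0%N.
  have [A zA] := zero_module_exists k.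
  by exists A; split; [move=> x y [[]] | exact: chain0].
have [m Pm nPm] : exists2 m, P m & ~ P m.+1.
  apply: contrapT => h; suff /Pb : P n0.+1 by rewrite ltnn.
  by elim: n0.+1 => // m Pm; apply: contrapT => nPm; apply: h; exists m.
case: Pm => E [uE cE]; exists E; split=> // E' f uE' fi; apply: contrapT => fs.
by apply: nPm; exists E'; split=> //; exact: (chain_inj_proper fi fs cE).
Qed.

Section Sep.
Variable E : lmodType k.
Hypothesis uE : multfree_socle E.
Hypothesis mE : forall (E' : lmodType k) (f : {linear E -> E'}), multfree_socle E' ->
  injective f -> onto f.

(** Inside E * V choose a submodule G maximal among those containing 0 * V', meeting E *
    0 trivially and avoiding (0, v). Every nonzero submodule of the quotient P by G
    meets E or contains the class of v. Then P again has a multiplicity free socle: a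
    coincidence between a simple submodule of E and the one generated by v would allow G
    to be enlarged by (t, - v). By maximality of E the map from E to P is onto, so that
    G is the graph, up to sign, of a map from V to E with the required properties. *)
Lemma matlis_sep (V : lmodType k) n (V' : V -> Prop) v : length_le V n -> submodule V' ->
    ~ V' v ->
  exists2 f : {linear V -> E}, forall x, V' x -> f x = 0 & f v <> 0.
Proof.
move=> fV hV' nv.
pose W : lmodType k := (E * V)%type.
pose Q (G : W -> Prop) := [/\ submodule G, forall x, V' x -> G (0, x),
  forall e, G (e, 0) -> e = 0 & ~ G (0, v)].
have pairP (a : k) (x y : W) : a *: x + y = (a *: x.1 + y.1, a *: x.2 + y.2) by [].
have [||G [hG GV GE Gv] Gmax] := @length_maximal _ W _ Q (fun w => w.1 = 0 /\
  V' w.2) (length_prod (multfree_socle_length uE) fV).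
- split=> //.
  + split=> [|a x y [x1 x2] [y1 y2]]; first by split=> //; case: hV'.
    rewrite pairP /= x1 y1 scaler0 addr0; split=> //.
    by case: hV' => _; apply.
  + by move=> e [].
  + by case.
- by move=> S [].
have [P [p [ps pE]]] := quotient_exists hG.
have [j jE] : exists j : {linear E -> P}, forall e, j e = p (e, 0).
  apply: lin_of_fun => a u w; rewrite -linearP pairP /=; congr (p (_, _)).
  by rewrite scaler0 addr0.
have ji : injective j by apply: lin_inj => e; rewrite jE => /pE /GE.
pose vb := p (0, v).
have vb0 : vb <> 0 by move=> /pE.
have ext (x : P) : (forall e a, j e = a *: x -> e = 0) -> (forall a, vb <> a *: x) -> x = 0.
  move=> h1 h2; have [w wE] := ps x.
  suff : G w by move=> /pE; rewrite wE.
  apply: (Gmax (fun g => exists a, p g = a *: x)).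
  - split.
    + split=> [|a g g' [b bE] [c cE]]; first by exists 0; rewrite linear0 scale0r.
      by exists (a * b + c); rewrite linearP bE cE scalerA scalerDl.
    + by move=> y /GV /pE ->; exists 0; rewrite scale0r.
    + by move=> e [a]; rewrite -jE => /h1.
    + by move=> [a] /h2.
  - by move=> g /pE ->; exists 0; rewrite scale0r.
  - by exists 1; rewrite scale1r.
have sim (x : P) : simple_generator x -> (exists e, x = j e) \/ (exists a, vb = a *: x).
  move=> [x0 xs]; apply: contrapT => /not_orP[n1 n2]; apply: x0; apply: ext.
    move=> e a je; apply: contrapT => e0.
    have [|b bE] := xs a; first by rewrite -je -(linear0 j) => /ji.
    by apply: n1; exists (b *: e); rewrite linearZ /= je.
  by move=> a e; apply: n2; exists a.
have vbE (t : E) : simple_generator vb -> (forall c, c *: t = 0 <-> c *: vb = 0) ->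
  exists e, vb = j e.
  move=> [_ vs] ann; apply: contrapT => nv'.
  have kill c e : c *: vb = j e -> c *: vb = 0.
    move=> ce; apply: contrapT => /vs[b bE]; apply: nv'; exists (b *: e).
    by rewrite linearZ /= -ce.
  suff /eqP : j t - vb = 0.
    by rewrite subr_eq0 => /eqP /esym e; apply: nv'; exists t.
  apply: ext => [e a|a].
    rewrite scalerBr -linearZ /= => h.
    have av : a *: vb = j (a *: t - e).
      by rewrite linearB h opprB addrC subrK.
    have at0 := kill _ _ av; move: h; rewrite at0 subr0 => /ji ->.
    by apply/ann.
  rewrite scalerBr -linearZ /= => /eqP; rewrite eq_sym subr_eq eq_sym => /eqP h.
  have h1 : (1 + a) *: vb = j (a *: t) by rewrite scalerDl scale1r h.
  have h2 := kill _ _ h1; have /ann := h2.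
  move: h1; rewrite h2 -(linear0 j) => /ji a0.
  rewrite scalerDl scale1r -a0 addr0 => t0; apply: vb0.
  by rewrite -[vb]scale1r; apply/ann; rewrite scale1r.
have simE (x y : P) : simple_generator x -> (forall a, a *: x = 0 -> a *: y = 0) -> y <> 0 ->
    simple_generator y /\ forall a, a *: y = 0 -> a *: x = 0.
  move=> [x0 xs] xy y0.
  have fixy a b : x = b *: (a *: x) -> y = b *: (a *: y).
    move=> e; have /xy/eqP : (1 - b * a) *: x = 0.
      by rewrite scalerBl scale1r -scalerA -e subrr.
    by rewrite scalerBl scale1r -scalerA subr_eq0 => /eqP.
  split; first split=> // a ay.
    have [|b e] := xs a; first by move=> /xy.
    by exists b; apply: fixy e.
  by move=> a ay; apply: contrapT => /xs[b /fixy]; rewrite ay scaler0.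
have vbs (x : P) a : simple_generator x -> vb = a *: x ->
    simple_generator vb /\ exists b, x = b *: vb.
  move=> [x0 xs] e; have ax0 : a *: x <> 0 by rewrite -e.
  split; last by have [b bE] := xs a ax0; exists b; rewrite e.
  split=> // c cv; have [|b bE] := xs (c * a); first by rewrite -scalerA -e.
  by exists (a * b); rewrite e [in LHS]bE -!scalerA.
have annE (x y : P) e a : simple_generator x -> simple_generator y ->
    (forall c, c *: x = 0 <-> c *: y = 0) -> x = j e -> vb = a *: y ->
    exists e', y = j e'.
  move=> sx sy xy xe ye; have [vs [b bE]] := vbs _ _ sy ye.
  have [|e' e'E] := vbE (a *: e) vs; last by exists (b *: e'); rewrite bE e'E linearZ.
  move=> c; rewrite ye scalerA; split.
    by move=> h; rewrite scalerA; apply/xy; rewrite xe -linearZ /= h linear0.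
  by rewrite scalerA => /xy; rewrite xe -linearZ /= -(linear0 j) => /ji.
have uP : multfree_socle P.
  move=> x y sx xy; case: (pselect (y = 0)) => [->|y0]; first by exists 0; rewrite scale0r.
  have [sy yx] := simE _ _ sx xy y0.
  suff [] : ((exists e, x = j e) /\ exists e, y = j e) \/ exists a b, vb = a *: x /\ vb = b *: y.
  - move=> [[e xe] [e' ye]].
    have [||b bE] := uE (x := e) (y := e').
    + split=> [e0|a ae]; first by case: sx; rewrite xe e0 linear0.
      have [|b bE] := sx.2 a; first by rewrite xe -linearZ -(linear0 j) => /ji.
      by exists b; apply: ji; rewrite !linearZ /= -xe.
    + move=> a ae; apply: ji; rewrite linearZ linear0 /= -ye; apply: xy.
      by rewrite xe -linearZ /= ae linear0.
    by exists b; rewrite ye bE linearZ /= xe.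
  - move=> [a [b [xa yb]]]; have [_ [c cE]] := vbs _ _ sy yb.
    by exists (c * a); rewrite cE xa scalerA.
  have ann c : c *: x = 0 <-> c *: y = 0 by split; [apply: xy | apply: yx].
  have [[e xe]|[a xa]] := sim _ sx; have [[e' ye]|[b yb]] := sim _ sy.
  - by left; split; [exists e | exists e'].
  - by left; split; [exists e | apply: annE xe yb].
  - by left; split; [apply: (annE y x e' a) => // c; split=> /ann | exists e'].
  - by right; exists a, b.
have js := mE uP ji.
have [x|a x e x' e' h h'|e|f fE] := @lin_of_rel _ V E (fun x e => p (0, x) = j e).
- by have [e eE] := js (p (0, x)); exists e.
- by rewrite linearP -h -h' -linearP pairP /= scaler0 addr0.
- by rewrite (_ : (0, 0) = 0) // linear0 -(linear0 j) => /ji.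
exists f => [x V'x|fv]; last by apply: vb0; rewrite /vb fE fv linear0.
by apply: ji; rewrite -fE linear0; apply/pE/GV.
Qed.
End Sep.
End Matlis.

(** * Modules over an algebra and their length over the base ring *)

Section Iso.
Variable L : pzRingType.
Implicit Types M N A B X T : lmodType L.

Lemma iso_refl M : lmod_iso M M.
Proof. by have [f fE] := @lin_of_fun _ M M id (fun _ _ _ => erefl); exists f; exists id => x;
  rewrite fE. Qed.

Lemma iso_sym M N : lmod_iso M N -> lmod_iso N M.
Proof. by case=> f /bij_inv[g [fg gf]]; exists g; exists f. Qed.

Lemma iso_trans M N A : lmod_iso M N -> lmod_iso N A -> lmod_iso M A.
Proof. by case=> f fb [g gb]; exists (g \o f); apply: bij_comp. Qed.

Lemma iso_zero M N : lmod_iso M N -> zero_module M -> zero_module N.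
Proof. by case=> f [g fg gf] z y; rewrite -(gf y) (z (g y)) linear0. Qed.

Lemma iso_indec M N : lmod_iso M N -> indecomposable M -> indecomposable N.
Proof.
move=> i [nz h]; split; first by move/(iso_zero (iso_sym i)).
by move=> A B j; apply: h; apply: iso_trans i j.
Qed.

Lemma sum_iso M A B (f : {linear A -> M}) (g : {linear B -> M}) :
  injective f -> injective g -> (forall a b, f a = g b -> f a = 0) ->
  (forall x, exists a b, x = f a + g b) -> lmod_iso M (A * B)%type.
Proof.
move=> fi gi fg0 fgs; have [h hE] := lin_copair f g.
apply: iso_sym; exists h; apply: inj_onto_bij.
  apply: lin_inj => -[a b]; rewrite hE /= => e.
  have /[dup] fa : f a = 0.
    apply: (fg0 a (- b)); rewrite linearN; apply/eqP; rewrite -addr_eq0 e //.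
  move: e => /[swap] ->; rewrite add0r -(linear0 g) => /gi ->.
  by move: fa; rewrite -(linear0 f) => /fi ->.
by move=> x; have [a [b ->]] := fgs x; exists (a, b); rewrite hE.
Qed.

(** A split submodule of an indecomposable module is zero or everything. *)
Lemma retract_bij X T (u : {linear X -> T}) (r : {linear T -> X}) :
  (forall x, r (u x) = x) -> indecomposable T -> ~ zero_module X -> bijective u.
Proof.
move=> ru [nz dT] nX; have ui : injective u by apply: can_inj ru.
apply: inj_onto_bij => //.
have [K [i [ii iE]]] := submodule_embedding (submodule_ker r).
have iso : lmod_iso T (X * K)%type.
  apply: (@sum_iso _ _ _ u i) => // [a b e|x].
    have : r (i b) = 0 by apply/iE; exists b.
    by rewrite -e ru => ->; rewrite linear0.
  have /iE[b bE] : r (x - u (r x)) = 0 by rewrite linearB ru subrr.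
  by exists (r x), b; rewrite bE addrC subrK.
have [//|zK] := dT _ _ iso.
move=> y; have /iE[b bE] : r (y - u (r y)) = 0 by rewrite linearB ru subrr.
exists (r y); apply/esym/eqP; rewrite -subr_eq0 -bE (zK b) linear0 //.
Qed.
End Iso.

Section Restr.
Variables (k : comPzRingType) (L : pzRingType) (phi : {rmorphism k -> L}).

(** A copy of the carrier of M that carries the k-module structure obtained through phi. *)
Definition restr of {rmorphism k -> L} : lmodType L -> Type := fun M => M.
Variable M : lmodType L.
Local Notation rM := (restr phi M).
HB.instance Definition _ := GRing.Zmodule.on rM.
Definition rscale (a : k) (x : rM) : rM := phi a *: (x : M).
Lemma rscaleA a b v : rscale a (rscale b v) = rscale (a * b) v.
Proof. by rewrite /rscale scalerA rmorphM. Qed.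
Lemma rscale1 : left_id 1 rscale.
Proof. by move=> v; rewrite /rscale rmorph1 scale1r. Qed.
Lemma rscaleDr : right_distributive rscale +%R.
Proof. by move=> a u v; apply: scalerDr. Qed.
Lemma rscaleDl v : {morph rscale^~ v : a b / a + b}.
Proof. by move=> a b; rewrite /rscale rmorphD; apply: scalerDl. Qed.
HB.instance Definition _ :=
  GRing.Zmodule_isLmodule.Build k rM rscaleA rscale1 rscaleDr rscaleDl.
Lemma rscaleE (a : k) (x : rM) : a *: x = phi a *: (x : M) :> M.
Proof. by []. Qed.
End Restr.

Section Algebra.
Variables (k : comPzRingType) (L : pzRingType) (phi : {rmorphism k -> L}).
Implicit Types M N A B X Y : lmodType L.
Local Notation restr := (restr phi).

(** All lengths are measured over k: every L-submodule is a k-submodule, so these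
    lengths also control chains of L-submodules, and Hom modules and duals have them
    too. *)
Definition klength_le M n := length_le (restr M : lmodType k) n.
Definition finite_klength M := exists n, klength_le M n.
Definition has_kchain M n := has_chain (restr M : lmodType k) n.

Lemma restr_linear A B (f : {linear A -> B}) :
  exists g : {linear (restr A : lmodType k) -> (restr B : lmodType k)}, forall x, g x = f x.
Proof. by apply: lin_of_fun => a u v; rewrite !rscaleE linearP. Qed.

Lemma submodule_restr M (S : M -> Prop) : submodule S -> @submodule k (restr M) S.
Proof. by case=> S0 Sl; split=> // a u v; apply: Sl. Qed.

Lemma klength_inj A B (f : {linear A -> B}) n : injective f -> klength_le B n -> klength_le A n.
Proof.
have [g gE] := restr_linear f; move=> fi; apply: (length_inj (f := g)).
by move=> x y; rewrite !gE => /fi.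
Qed.

Lemma klength_onto A B (f : {linear A -> B}) n : onto f -> klength_le A n -> klength_le B n.
Proof.
have [g gE] := restr_linear f; move=> fs; apply: (length_onto (f := g)).
by move=> y; have [x <-] := fs y; exists x; rewrite gE.
Qed.

Lemma klength_iso A B n : lmod_iso A B -> klength_le A n -> klength_le B n.
Proof. by case=> f /bij_onto; apply: klength_onto. Qed.

Lemma klength_extend M A n m (S : M -> Prop) (g : {linear A -> M}) :
  @part_length_le k (restr M) S n -> klength_le A m ->
    @part_length_le k (restr M) (fun x => exists a, S (x - g a)) (n + m).
Proof.
have [h hE] := restr_linear g; move=> fS fA; apply: eq_part_length (part_length_extend h fS fA)
  => x.
by split=> -[a Sa]; exists a; [rewrite -hE | rewrite hE].
Qed.

Lemma klength_prod A B n m : klength_le A n -> klength_le B m -> klength_le (A * B)%type (n + m).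
Proof.
move=> fA fB; have [i iE] := lin_inl A B; have [j jE] := lin_inr A B.
have := klength_extend j (klength_extend i (part_length0 _) fA) fB; rewrite add0n;
  apply: eq_part_length => -[x y].
split=> // _; exists y, x; rewrite iE jE; apply/eqP.
by rewrite xpair_eqE /= !oppr0 !addr0 !subrr !eqxx.
Qed.

Lemma kchain_inj A B (f : {linear A -> B}) n : injective f -> has_kchain A n -> has_kchain B n.
Proof.
have [g gE] := restr_linear f; move=> fi; apply: (chain_inj (f := g)).
by move=> x y; rewrite !gE => /fi.
Qed.
Lemma kchain_inj_proper A B (f : {linear A -> B}) n : injective f -> ~ onto f ->
  has_kchain A n -> has_kchain B n.+1.
Proof.
have [g gE] := restr_linear f; move=> fi fs; apply: (chain_inj_proper (f := g)).
  by move=> x y; rewrite !gE => /fi.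
by move=> gs; apply: fs => y; have [x <-] := gs y; exists x; rewrite gE.
Qed.
Lemma kchain_iso A B n : lmod_iso A B -> has_kchain A n -> has_kchain B n.
Proof. by case=> f /bij_inj; apply: kchain_inj. Qed.

Lemma klength_inj_onto A B (f : {linear A -> B}) : finite_klength B ->
  (forall m, has_kchain B m -> has_kchain A m) -> injective f -> onto f.
Proof.
case=> n fB h fi; have [g gE] := restr_linear f.
have : onto g by apply: (length_inj_onto fB) => // x y; rewrite !gE => /fi.
by move=> gs y; have [x <-] := gs y; exists x; rewrite gE.
Qed.
Lemma klength_onto_inj A B (f : {linear A -> B}) : finite_klength A ->
  (forall m, has_kchain A m -> has_kchain B m) -> onto f -> injective f.
Proof.
case=> n fB h fs; have [g gE] := restr_linear f.
have : injective g.
  by apply: (length_onto_inj fB) => // y; have [x <-] := fs y; exists x; rewrite gE.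
by move=> gi x y; rewrite -!gE => /gi.
Qed.

Lemma endo_inj_bij M (f : {linear M -> M}) : finite_klength M -> injective f -> bijective f.
Proof. by move=> fM fi; apply: inj_onto_bij => //; apply: klength_inj_onto. Qed.

Lemma sub_maximal M (Q : (M -> Prop) -> Prop) S0 : finite_klength M -> Q S0 ->
  (forall S, Q S -> submodule S) ->
  exists2 S, Q S & forall S', Q S' -> (forall x, S x -> S' x) -> forall x, S' x -> S x.
Proof.
case=> n fM Q0 Qs; apply: (@length_maximal _ (restr M) n Q S0 fM Q0) => S /Qs.
exact: submodule_restr.
Qed.
Lemma sub_minimal M (Q : (M -> Prop) -> Prop) S0 : finite_klength M -> Q S0 ->
  (forall S, Q S -> submodule S) ->
  exists2 S, Q S & forall S', Q S' -> (forall x, S' x -> S x) -> forall x, S x -> S' x.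
Proof.
case=> n fM Q0 Qs; apply: (@length_minimal _ (restr M) n Q S0 fM Q0) => S /Qs.
exact: submodule_restr.
Qed.

Lemma iter_lin M (g : {linear M -> M}) n :
  exists h : {linear M -> M}, forall x, h x = iter n g x.
Proof.
elim: n => [|n [h hE]]; first exact: idlin.
by exists (g \o h) => x; rewrite /= hE.
Qed.

(** For h a large power of g, M is the direct sum of the kernel and the image of h. *)
Lemma fitting M (g : {linear M -> M}) : finite_klength M -> indecomposable M ->
  bijective g \/ exists n, forall x, iter n g x = 0.
Proof.
move=> fM [nz dM].
have [|S [n Sn]|S' [n' nmax]] := @sub_maximal M (fun S => exists n, forall x,
  S x <-> iter n g x = 0)
  (fun x => x = 0) fM.
- by exists 0%N.
- have [h hE] := iter_lin g n; split=> [|a u v]; first by apply/Sn; rewrite -hE linear0.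
  by rewrite !Sn -!hE linearP => -> ->; rewrite scaler0 addr0.
move=> nmax'.
have [|S2 [m Sm]|S2' [m' mmin]] := @sub_minimal M (fun S => exists n, forall x,
  S x <-> exists y, iter n g y = x)
  (fun x => True) fM.
- by exists 0%N => x; split=> // _; exists x.
- have [h hE] := iter_lin g m; split=> [|a u v]; first by apply/Sm; exists 0; rewrite -hE linear0.
  move=> /Sm[x <-] /Sm[y <-]; apply/Sm; exists (a *: x + y).
  by rewrite -!hE linearP.
move=> mmin'.
pose N := (n'.+1 + m')%N;
have NN : (N + N = n' + (m'.+1 + N))%N by rewrite {1}/N -addnA addSnnS addSn.
have [h hE] := iter_lin g N.
have iter0 d : iter d g 0 = 0 by have [e eE] := iter_lin g d; rewrite -eE linear0.
have kerst x d : iter (n' + d) g x = 0 -> iter n' g x = 0.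
  move=> e; apply/nmax; apply: (nmax' (fun x => iter (n' + d) g x = 0)) => //.
    by exists (n' + d)%N.
  by move=> y /nmax yE; rewrite addnC iterD yE iter0.
have imst x d : exists y, iter m' g x = iter (m' + d) g y.
  have /mmin : exists y, iter m' g y = iter m' g x by exists x.
  move=> /(mmin' (fun x => exists y, iter (m' + d) g y = x)) [].
  - by exists (m' + d)%N.
  - by move=> _ [y <-]; apply/mmin; exists (iter d g y); rewrite -iterD.
  - by move=> y <-; exists y.
have [A [i [ii iE]]] := submodule_embedding (submodule_ker h).
have [B [j [ji jE]]] := submodule_embedding (submodule_im h).
have iso : lmod_iso M (A * B)%type.
  apply: (@sum_iso _ _ _ _ i j) => // [a b e|x].
    have ha : h (i a) = 0 by apply/iE; exists a.
    have [y yE] : exists y, h y = j b by apply/jE; exists b.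
    move: ha; rewrite e -yE !hE -iterD NN => /kerst y0.
    by rewrite /N addSnnS addnC iterD y0 iter0.
  have [y yE] := imst x N.
  have hxy : h x = h (iter N g y).
    by rewrite !hE {1}/N iterD yE -!iterD addnA.
  have /iE[a aE] : h (x - iter N g y) = 0 by rewrite linearB hxy subrr.
  have /jE[b bE] : exists z, h z = iter N g y by exists y; rewrite hE.
  by exists a, b; rewrite aE bE subrK.
have [zA|zB] := dM _ _ iso; [left | right].
  apply: endo_inj_bij => //; apply: lin_inj => x gx.
  have /iE[a <-] : h x = 0.
    by rewrite hE /N addSn iterSr gx iter0.
  by rewrite (zA a) linear0.
exists N => x; rewrite -hE; have /jE[b <-] : exists y, h y = h x by exists x.
by rewrite (zB b) linear0.
Qed.
End Algebra.

(** * Decompositions and sums of factorizations *)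

Section Ffun.
Variable R : pzRingType.
Lemma length_ffun (V : lmodType R) n m : length_le V n -> length_le {ffun 'I_m -> V} (m * n).
Proof.
move=> fV; elim: m => [|m IH].
  rewrite mul0n; apply: eq_part_length (part_length0 _) => x; split=> // _.
  by apply/ffunP => -[].
have [f fE] : exists f : {linear {ffun 'I_m.+1 -> V} -> (V * {ffun 'I_m -> V})%type},
    forall x, f x = (x ord0, [ffun i => x (lift ord0 i)]).
  apply: lin_of_fun => a u v; apply/eqP; rewrite xpair_eqE /= !ffunE eqxx /=.
  by apply/eqP/ffunP => i; rewrite !ffunE.
rewrite mulSn; apply: (length_inj (f := f)); last exact: length_prod.
apply: lin_inj => x; rewrite fE => -[x0 /ffunP xS]; apply/ffunP => i; rewrite ffunE.
have [j ->|->] := unliftP ord0 i; last exact: x0.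
by have := xS j; rewrite !ffunE.
Qed.
End Ffun.

Section Summand.
Variable L : pzRingType.

(** Decompositions are families of such triples rather than families of modules with
    separate families of maps: the type of a triple does not depend on the index, so
    that families can be concatenated. *)
Record summand (M : lmodType L) := Summand {
  summand_obj : lmodType L;
  summand_in : {linear summand_obj -> M};
  summand_out : {linear M -> summand_obj} }.

Definition is_decomposition M n (c : nat -> summand M) :=
  [/\ forall i, (i < n)%N -> indecomposable (summand_obj (c i)),
      forall i y, (i < n)%N -> summand_out (c i) (summand_in (c i) y) = y,
      forall i j y, (i < n)%N -> (j < n)%N -> i <> j -> summand_out (c j) (summand_in (c i) y) = 0
    & forall x, x = \sum_(i < n) summand_in (c i) (summand_out (c i) x)].

(** The maps from X to Y that are finite sums of composites v \o u with Q u. With Q a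
    condition on the middle module this is the ideal of maps factoring through sums of
    such modules; with Q saying that u is not an isomorphism it is a radical. *)
Inductive factors (X Y : lmodType L) (Q : forall T : lmodType L, {linear X -> T} -> Prop) :
  (X -> Y) -> Prop :=
| factors0 f : (forall x, f x = 0) -> factors Q f
| factorsD (T : lmodType L) (u : {linear X -> T}) (v : {linear T -> Y}) f f' :
    Q T u -> factors Q f' -> (forall x, f x = v (u x) + f' x) -> factors Q f.

Implicit Types X Y Z T M : lmodType L.

Lemma factors_add X Y Q (f f' g : X -> Y) : factors Q f -> factors Q f' ->
  (forall x, g x = f x + f' x) -> factors Q g.
Proof.
move=> sf sf'; elim: sf g => [{}f f0|T u v {}f f1 QTu _ IH fE] g gE.
  suff -> : g = f' by [].
  by apply/funext => x; rewrite gE f0 add0r.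
by apply: (@factorsD _ _ _ T u v g (fun x => f1 x + f' x) QTu) => [|x];
  [apply: IH | rewrite gE fE addrA].
Qed.

Lemma factors_left X Y Z Q (f : X -> Y) (w : {linear Y -> Z}) :
  factors Q f -> factors Q (fun x => w (f x)).
Proof.
elim=> [{}f f0|T u v {}f f1 QTu _ IH fE].
  by apply: factors0 => x; rewrite f0 linear0.
by apply: (@factorsD _ _ _ T u (w \o v) _ _ QTu IH) => x /=; rewrite fE linearD.
Qed.

Lemma factors_right X X' Y (Q Q' : forall T : lmodType L, {linear _ -> T} -> Prop) (f : X -> Y)
    (w : {linear X' -> X}) :
  (forall T (u : {linear X -> T}), Q T u -> Q' T (u \o w)) ->
  factors Q f -> factors Q' (fun x => f (w x)).
Proof.
move=> QQ'; elim=> [{}f f0|T u v {}f f1 QTu _ IH fE].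
  by apply: factors0 => x; rewrite f0.
by apply: (@factorsD _ _ _ T _ v _ _ (QQ' _ _ QTu) IH) => x; rewrite fE.
Qed.

Lemma factors_one X Y (Q : forall T : lmodType L, {linear X -> T} -> Prop) T (u : {linear X -> T})
  (v : {linear T -> Y}) f : Q T u -> (forall x, f x = v (u x)) -> factors Q f.
Proof.
move=> QTu fE; apply: (@factorsD _ _ _ T u v f (fun=> 0) QTu) => [|x]; first exact: factors0.
by rewrite fE addr0.
Qed.

Lemma factors_sum X Y (Q : forall T : lmodType L, {linear X -> T} -> Prop) n (F : nat -> X ->
    Y) f :
  (forall i, (i < n)%N -> factors Q (F i)) -> (forall x, f x = \sum_(i < n) F i x) -> factors Q f.
Proof.
elim: n f => [|n IH] f QF fE; first by apply: factors0 => x; rewrite fE big_ord0.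
apply: (factors_add (IH (fun x => \sum_(i < n) F i x) _ _) (QF n (ltnSn n))) => // [i lin|x].
  by apply: QF; apply: leqW.
by rewrite fE big_ord_recr.
Qed.
End Summand.

Section Algebra.
Variables (k : comPzRingType) (L : pzRingType) (phi : {rmorphism k -> L}).
Implicit Types M N A B X Y T : lmodType L.
Local Notation restr := (restr phi).
Local Notation finite_klength := (finite_klength phi).
Local Notation has_kchain := (has_kchain phi).

(** The endomorphism ring of an indecomposable module of finite length is local. *)
Lemma bij_sum X Y (f f1 f2 : {linear X -> Y}) : finite_klength X -> indecomposable X ->
  bijective f -> (forall x, f x = f1 x + f2 x) -> bijective f1 \/ bijective f2.
Proof.
move=> fX dX /[dup] fb /bij_inv[g [fg gf]] fE.
have gb : bijective g by exists f.
have cancelb (h : {linear X -> Y}) : bijective (g \o h) -> bijective h.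
  move=> ghb; suff -> : h = f \o (g \o h) :> (X -> Y) by apply: bij_comp.
  by apply/funext => x /=; rewrite gf.
have [/cancelb|[n nil]] := fitting (g \o f1) fX dX; first by left.
right; apply: cancelb; apply: (endo_inj_bij fX); apply: lin_inj => x /= e.
rewrite -(nil x); suff gx : g (f1 x) = x by elim: n {nil} => //= n <-; rewrite gx.
by rewrite -[RHS](fg x) fE linearD e addr0.
Qed.

Lemma finite_klength_inj A B (f : {linear A -> B}) : injective f -> finite_klength B ->
    finite_klength A.
Proof. by move=> fi [n /(klength_inj fi)]; exists n. Qed.

(** Induction on the length: in a proper decomposition both parts are strictly shorter. *)
Lemma decomposition M : finite_klength M -> exists n (c : nat -> summand M), is_decomposition n c.
Proof.
move=> /[dup] fM [n /(length_chain (m := n.+1))]; rewrite ltnn => nc.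
have {nc}: ~ has_kchain M n.+1 by move/nc.
elim: n.+1 M fM => {n} [|n IH] M fM nM; first by case: nM; apply: chain0.
have [id1 id1E] := idlin M.
case: (pselect (zero_module M)) => [z|nz].
  exists 0%N, (fun=> Summand id1 id1); split=> // x; by rewrite big_ord0.
case: (pselect (indecomposable M)) => [dM|ndM].
  exists 1%N, (fun=> Summand id1 id1); split=> //= [i y _|i j y|x]; first by rewrite !id1E.
    by rewrite !ltnS !leqn0 => /eqP-> /eqP->.
  by rewrite big_ord_recr big_ord0 /= !id1E add0r.
have [A [B [[f fb] nzA nzB]]] : exists A B, [/\ lmod_iso M (A * B)%type, ~ zero_module A &
  ~ zero_module B].
  apply: contrapT => h; apply: ndM; split=> // A B iso; apply: contrapT => /not_orP[nA nB].
  by apply: h; exists A, B.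
have [g [fg gf]] := bij_inv fb.
have [fst1 fE] := lin_fst A B; have [snd1 sE] := lin_snd A B.
have [inl1 lE] := lin_inl A B; have [inr1 rE] := lin_inr A B.
pose iA := g \o inl1; pose iB := g \o inr1; pose pA := fst1 \o f; pose pB := snd1 \o f.
have pAiA y : pA (iA y) = y by rewrite /pA /iA /= gf lE fE.
have pBiB y : pB (iB y) = y by rewrite /pB /iB /= gf rE sE.
have pAiB y : pA (iB y) = 0 by rewrite /pA /iB /= gf rE fE.
have pBiA y : pB (iA y) = 0 by rewrite /pB /iA /= gf lE sE.
have sumE x : x = iA (pA x) + iB (pB x).
  rewrite /iA /pA /iB /pB /= -linearD /= lE rE fE sE -[LHS]fg; congr (g _).
  by case: (f x) => a b; apply/eqP; rewrite xpair_eqE /= addr0 add0r !eqxx.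
have iAi : injective iA by apply: can_inj pAiA.
have iBi : injective iB by apply: can_inj pBiB.
have [||n1 [c1 [i1 r1 o1 s1]]] := IH A; first exact: finite_klength_inj iAi fM.
  move=> cA; apply: nM; apply: (kchain_inj_proper iAi) => // sA; apply: nzB => b.
  by rewrite -(pBiB b); have [a <-] := sA (iB b); apply: pBiA.
have [||n2 [c2 [i2 r2 o2 s2]]] := IH B; first exact: finite_klength_inj iBi fM.
  move=> cB; apply: nM; apply: (kchain_inj_proper iBi) => // sB; apply: nzA => a.
  by rewrite -(pAiA a); have [b <-] := sB (iA a); apply: pAiB.
pose mA (c : summand A) : summand M := Summand (iA \o summand_in c) (summand_out c \o pA).
pose mB (c : summand B) : summand M := Summand (iB \o summand_in c) (summand_out c \o pB).
pose c i := if (i < n1)%N then mA (c1 i) else mB (c2 (i - n1)%N).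
have cA i : (i < n1)%N -> c i = mA (c1 i) by rewrite /c => ->.
have cB i : (n1 <= i)%N -> c i = mB (c2 (i - n1)%N) by rewrite /c leqNgt => /negbTE ->.
have lt2 i : (n1 <= i)%N -> (i < n1 + n2)%N -> (i - n1 < n2)%N.
  by move=> ni; rewrite -{1}(subnKC ni) ltn_add2l.
exists (n1 + n2)%N, c; split.
- move=> i lti; have [li|li] := ltnP i n1; first by rewrite cA //; apply: i1.
  by rewrite cB //; apply/i2/lt2.
- move=> i; have [li|li] := ltnP i n1; first by rewrite cA // => y _;
  rewrite -[LHS]/(summand_out (c1 i) (pA (iA (summand_in (c1 i) y)))) pAiA r1.
  by rewrite cB // => y lti; rewrite -[LHS]/(summand_out (c2 (i - n1)%N) (pB (iB (summand_in (c2
    (i - n1)%N) y)))) pBiB r2 //; apply: lt2.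
- move=> i j; have [li|li] := ltnP i n1; have [lj|lj] := ltnP j n1.
  + by rewrite cA // cA // => y _ _ ij; rewrite -[LHS]/(summand_out (c1 j) (pA (iA (summand_in
    (c1 i) y)))) pAiA o1.
  + by rewrite cA // cB // => y _ _ _; rewrite -[LHS]/(summand_out (c2 (j - n1)%N) (pB (iA
    (summand_in (c1 i) y)))) pBiA linear0.
  + by rewrite cB // cA // => y _ _ _; rewrite -[LHS]/(summand_out (c1 j) (pA (iB (summand_in
    (c2 (i - n1)%N) y)))) pAiB linear0.
  rewrite cB // cB // => y lti ltj ij; rewrite -[LHS]/(summand_out (c2 (j - n1)%N) (pB (iB
    (summand_in (c2 (i - n1)%N) y)))) pBiB o2 ?lt2 // => e.
  by apply: ij; rewrite -(subnKC li) e subnKC.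
move=> x; rewrite big_split_ord /= [LHS]sumE; congr (_ + _).
  rewrite [in LHS](s1 (pA x)) /iA linear_sum; apply: eq_bigr => i _.
  by rewrite cA.
rewrite [in LHS](s2 (pB x)) /iB linear_sum; apply: eq_bigr => i _.
by rewrite cB /= ?leq_addr // addKn.
Qed.

(** Each step of a composition series is generated by one element over L, hence adds at
    most the length of L. *)
Lemma finite_length_klength M : finite_klength (L^o : lmodType L) -> finite_length M ->
    finite_klength M.
Proof.
move=> [l fL] [n [S [S1 S2 S3 S4]]].
have H i : (i <= n)%N -> exists m, @part_length_le k (restr M) (fun x => x \in S i) m.
  elim: i => [_|i IH lin].
    by exists 0%N; apply: eq_part_length (part_length0 _) => x; rewrite S2 inE; split=> [->|/eqP].
  have [m fm] := IH (ltnW lin); have [ST nST mST] := S4 i lin.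
  have [x xT nxS] : exists2 x, x \in S i.+1 & x \notin S i.
    apply: contrapT => h; apply: nST => x xT; apply/negPn/negP => xS.
    by apply: h; exists x.
  have [g gE] := lin_orbit x.
  exists (m + l)%N; apply: eq_part_length (klength_extend g fm fL) => y.
  pose U : {pred M} := fun y => `[< exists a, y - g a \in S i >].
  have [Si0 Sil] := S1 i (ltnW lin); have [ST0 STl] := S1 i.+1 lin.
  have [//|z zS|z /asboolP[a Sa]|US|UT] := mST U.
  - split; first by apply/asboolP; exists 0; rewrite linear0 subr0.
    move=> a u v /asboolP[b Sb] /asboolP[c Sc]; apply/asboolP; exists (a *: b + c).
    by rewrite linearP opprD addrACA -scalerBr; apply: Sil.
  - by apply/asboolP; exists 0; rewrite linear0 subr0.
  - rewrite -(subrK (g a) z) addrC gE; apply: STl => //.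
    by apply: ST; rewrite -gE.
  - case/negP: nxS; rewrite -US; apply/asboolP; exists 1.
    by rewrite gE scale1r subrr.
  have -> : (exists a, y - g a \in S i) <-> y \in U by split=> [?|/asboolP //]; exact/asboolP.
  by rewrite UT.
have [m fm] := H n (leqnn n); exists m; apply: eq_part_length fm => x.
by rewrite S3.
Qed.
End Algebra.

(** * Left almost split systems of equations *)

Lemma ffun_lin (R : pzRingType) (V E : lmodType R) m (th : {linear {ffun 'I_m -> V} -> E}) :
  exists eta : 'I_m -> {linear V -> E}, forall z : {ffun 'I_m -> V}, th z = \sum_i eta i (z i).
Proof.
have /choice[eta etaE] (i : 'I_m) : exists e : {linear V -> E},
    forall x, e x = th [ffun j => if j == i then x else 0].
  apply: lin_of_fun => a u v; rewrite -linearP; congr (th _); apply/ffunP => j.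
  by rewrite !ffunE; case: eqP => // _; rewrite scaler0 addr0.
exists eta => z; under eq_bigr do rewrite etaE.
rewrite -linear_sum; congr (th _); apply/ffunP => j; rewrite sum_ffunE (bigD1 j) //=.
rewrite ffunE eqxx big1 ?addr0 // => i; rewrite ffunE eq_sym => /negbTE -> //.
Qed.

Section AR.
Variables (k : comPzRingType) (L : pzRingType) (phi : {rmorphism k -> L}).
Hypothesis hL : artin_algebra phi.
Implicit Types M N A B X Y T : lmodType L.
Local Notation restr M := (restr phi M : lmodType k).
Local Notation finite_klength := (finite_klength phi).

Lemma finite_klength_regular : finite_klength (L^o : lmodType L).
Proof.
have [n0 fk] := artinian_length (artin_base hL).
have [n [g gE]] := artin_fg hL.
have [f fE] : exists f : {linear {ffun 'I_n -> k^o} -> restr L^o},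
    forall v : {ffun 'I_n -> k^o}, f v = \sum_i phi (v i) * g i.
  apply: lin_of_fun => a u v; rewrite scaler_sumr -big_split; apply: eq_bigr => i _.
  by rewrite !ffunE rmorphD rmorphM mulrDl -mulrA.
exists (n * n0)%N; apply: (length_onto (f := f)); last exact: length_ffun.
by move=> x; have [a aE] := gE x; exists [ffun i => a i]; rewrite fE aE; apply: eq_bigr => i _;
  rewrite ffunE.
Qed.

Lemma scale_lin M (a : k) : exists f : {linear M -> M}, forall x, f x = phi a *: x.
Proof.
apply: lin_of_fun => b u v.
by rewrite scalerDr !scalerA (artin_central hL).
Qed.

(** A map from X is determined by its values on finitely many k-generators of X, so
    Hom(X, M) embeds into a finite power of M. *)
Lemma hom_generators X M : finite_klength X -> finite_klength M ->
  exists q (f : nat -> {linear X -> M}),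
  forall g : {linear X -> M}, exists a : nat -> k, forall x, g x = \sum_(b < q) phi (a b) *: f b x.
Proof.
move=> [n fX] [m fM].
have [x [_ xE]] := length_generators fX (submodule_true _).
pose W (v : {ffun 'I_n -> restr M}) := exists g : {linear X -> M}, forall i, v i = g (x i).
have hW : submodule W.
  split=> [|a u v [g gE] [h hE]].
    have [z zE] := lin_zero X M.
    by exists z => i; rewrite zE ffunE.
  have [s sE] := scale_lin M a.
  have [l lE] := lin_add (s \o g) h.
  by exists l => i; rewrite !ffunE gE hE lE /= sE.
have [w [Ww wE]] := length_generators (length_ffun n fM) hW.
have /choice[f fE] : forall b, exists g : {linear X -> M}, forall i : 'I_n, w b i = g (x i) by [].
exists (n * m)%N, f => g.
have [|a aE] := wE [ffun i : 'I_n => g (x i)]; first by exists g => i; rewrite ffunE.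
exists a => y; have [b ->] := xE y I.
have [g' g'E] := restr_linear phi g.
have [f' f'E] : exists f' : {linear restr X ->
  restr M}, forall y, f' y = \sum_(b < (n * m)%N) phi (a b) *: f b y.
  apply: lin_of_fun => c u v; rewrite scaler_sumr -big_split; apply: eq_bigr => i _.
  rewrite rscaleE linearP scalerDr; congr (_ + _).
  by rewrite !rscaleE !scalerA (artin_central hL).
rewrite -f'E -g'E !linear_sum; apply: eq_bigr => i _; rewrite !linearZ /= f'E g'E.
congr (_ *: _); have /ffunP/(_ i) := aE; rewrite ffunE => ->.
by rewrite sum_ffunE; apply: eq_bigr => j _; rewrite ffunE fE.
Qed.

Section Fact1.
Variables (E : lmodType k) (X : lmodType L).
Variables (D : lmodType k) (ev : D -> restr X -> E) (m n nX : nat).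
Hypothesis uE : multfree_socle E.
Hypothesis dD : is_dual ev.
Hypothesis fX : klength_le phi X nX.
Variable xi : 'I_m -> D.
Hypothesis xiE : forall d, exists a : 'I_m -> k, d = \sum_i a i *: xi i.
Hypothesis xisep : forall x, (forall i, ev (xi i) x = 0) -> x = 0.

(** The relations over L between the forms xi, where L acts on linear forms on X by
    composing them with its action on X. *)
Definition relation_on (mu : {ffun 'I_m -> restr L^o}) :=
    forall x : X, \sum_i ev (xi i) ((mu i : L) *: x) = 0.
Variable lam : 'I_n -> {ffun 'I_m -> restr L^o}.
Hypothesis lamE : forall mu, relation_on mu -> exists c : 'I_n -> k, mu = \sum_j c j *: lam j.

Lemma ev_suml (I : Type) (r : seq I) (P : pred I) (F : I -> D) x :
  ev (\sum_(i <- r | P i) F i) x = \sum_(i <- r | P i) ev (F i) x.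
Proof.
by elim/big_rec2: _ => [|i d e _ <-]; [apply: ev0l dD x | rewrite (evDl dD)].
Qed.

(** The forms xi generate the dual of X, and the lam generate their relations over L;
    this is the dual of a presentation. A family eta of forms on Y satisfying the
    relations is a map from the dual of X to the dual of Y, and by reflexivity it comes
    from a map from Y to X. *)
Lemma hom_from_relations Y (eta : 'I_m -> {linear restr Y -> E}) :
  (forall j y, \sum_i eta i ((lam j i : L) *: (y : Y)) = 0) ->
  exists g : {linear Y -> X}, forall i y, ev (xi i) (g y) = eta i y.
Proof.
move=> h.
have hrel mu y : relation_on mu -> \sum_i eta i ((mu i : L) *: (y : Y)) = 0.
  move=> /lamE[c ->]; transitivity (\sum_j c j *: \sum_i eta i ((lam j i : L) *: (y : Y))).
    under [RHS]eq_bigr do rewrite scaler_sumr.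
    rewrite exchange_big; apply: eq_bigr => i _ /=.
    rewrite sum_ffunE scaler_suml linear_sum; apply: eq_bigr => j _.
    by rewrite ffunE -linearZ /=; congr (eta i _);
      exact: esym (scalerA (phi (c j)) (lam j i : L) (y : Y)).
  by rewrite big1 // => j _; rewrite h scaler0.
have [y|la y x y' x' hx hx'|x hx|g gE] := @lin_of_rel _ Y X (fun y x => forall i,
  ev (xi i) x = eta i y).
- pose G d e := exists a : 'I_m -> k, d = \sum_i a i *: xi i /\ e = \sum_i a i *: eta i y.
  have Gl a d e d' e' : G d e -> G d' e' -> G (a *: d + d') (a *: e + e').
    move=> [b [-> ->]] [c [-> ->]]; exists (fun i => a * b i + c i).
    by split; rewrite scaler_sumr -big_split; apply: eq_bigr => i _ /=; rewrite scalerA scalerDl.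
  have G0 e : G 0 e -> e = 0.
    move=> [a [/esym a0 ->]].
    have /(hrel _ y) e0 : relation_on [ffun i => phi (a i)].
      move=> x; rewrite -[RHS](ev0l dD x) -a0 ev_suml; apply: eq_bigr => i _.
      by rewrite ffunE (evZl dD) -(evZr dD).
    by rewrite -[RHS]e0; apply: eq_bigr => i _; rewrite ffunE -linearZ.
  have [d|Phi PE] := @lin_of_rel _ D E G _ Gl G0.
    by have [a ->] := xiE d; exists (\sum_i a i *: eta i y), a.
  have [x xE] := dual_reflexive uE dD Phi fX; exists x => i; rewrite -xE.
  have Gxi : G (xi i) (eta i y).
    exists (fun j => (j == i)%:R).
    split; rewrite (bigD1 i) //= eqxx scale1r big1 ?addr0 // => j /negbTE ->;
      by rewrite scale0r.
  have := Gl (-1) _ _ _ _ Gxi (PE (xi i)).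
  rewrite !scaleN1r addNr => /G0 /eqP; rewrite addrC subr_eq0 => /eqP //.
- move=> i.
  have [f fE] : exists f : {linear restr X -> E}, forall x, f x = ev (xi i) (la *: (x : X)).
    apply: lin_of_fun => a u v; rewrite -(dual_linr dD); congr (ev _ _).
    by rewrite scalerDr !rscaleE !scalerA (artin_central hL).
  have [d dE] := dual_full dD f; have [a aE] := xiE d.
  have /(hrel _ y) : relation_on [ffun l => (if l == i then la else 0) - phi (a l)].
    move=> z; transitivity (ev (xi i) (la *: z) - ev d z).
      rewrite aE ev_suml [ev (xi i) _](_ : _ = \sum_l ev (xi l) (if l == i then la *: z else 0)).
        rewrite -sumrB; apply: eq_bigr => l _;
          rewrite ffunE scalerBl (evBr dD) (evZl dD) -(evZr dD).
        by case: eqP => // _; rewrite scale0r.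
      rewrite (bigD1 i) //= eqxx big1 ?addr0 // => l /negbTE ->; exact: ev0r dD _.
    by rewrite dE fE subrr.
  rewrite (_ : \sum_l _ = eta i (la *: (y : Y)) - \sum_l a l *: eta l y); last first.
    rewrite [eta i _](_ : _ = \sum_l eta l (if l == i then la *: (y : Y) else 0)).
      rewrite -sumrB; apply: eq_bigr => l _; rewrite ffunE scalerBl -linearZ -linearB.
      by congr (eta l (_ - _)); case: eqP => // _; rewrite scale0r.
    by rewrite (bigD1 i) //= eqxx big1 ?addr0 // => l /negbTE ->; rewrite linear0.
  move=> /eqP; rewrite subr_eq0 => /eqP e.
  rewrite (evDr dD) linearD /= e hx'; congr (_ + _).
  rewrite -fE -dE aE ev_suml; apply: eq_bigr => l _.
  by rewrite (evZl dD) hx.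
- by apply: xisep => i; rewrite hx linear0.
by exists g.
Qed.
End Fact1.
End AR.

Section AR.
Variables (k : comPzRingType) (L : pzRingType) (phi : {rmorphism k -> L}).
Hypothesis hL : artin_algebra phi.
Implicit Types M N A B X Y T : lmodType L.
Local Notation restr M := (restr phi M : lmodType k).
Local Notation finite_klength := (finite_klength phi).

(** Let xi be forms generating the dual of X and lam generators of their relations.
    Choose h such that the sum of the xi_i (g h_i) vanishes for all non-invertible
    endomorphisms g but not for g = 1; such an h exists by separation and reflexivity,
    since the non-invertible g form a proper k-submodule. A solution of the equations in
    X would make the sum for g = 1 vanish. If f h had no solution in Y, a family of
    forms on Y would vanish on all solvable right-hand sides, hence satisfy the
    relations and come from a map g : Y -> X, without vanishing on f h; but the sum for
    g \o f is 0 unless g \o f is invertible, that is, unless f splits. *)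
Lemma left_almost_split X : finite_klength X -> indecomposable X ->
  exists m n (lam : 'I_m -> 'I_n -> L) (h : 'I_m -> X),
    (~ exists x : 'I_n -> X, forall i, h i = \sum_j lam i j *: x j) /\
    forall Y (f : {linear X -> Y}), finite_klength Y -> (~ exists r : {linear Y ->
      X}, forall x, r (f x) = x) ->
      exists y : 'I_n -> Y, forall i, f (h i) = \sum_j lam i j *: y j.
Proof.
move=> flX dX; have [nX fX] := flX.
have [n0 fk] := artinian_length (artin_base hL).
have [E [uE mE]] := matlis_exists fk.
have sep (V : lmodType k) n (V' : V -> Prop) v := @matlis_sep k n0 fk E uE mE V n V' v.
have [D [ev dD]] := dual_exists (restr X) E; have [d1 d2 d3 d4] := dD.
have fD : length_le D nX by exact: (dual_length uE dD fX).
have [xi0 [_ xi0E]] := length_generators fD (submodule_true _).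
pose m := nX; pose xi (i : 'I_m) := xi0 i.
have xiE d : exists a : 'I_m -> k, d = \sum_i a i *: xi i.
  by have [a ->] := xi0E d I; exists (fun i => a i).
have xisep x : (forall i, ev (xi i) x = 0) -> x = 0.
  move=> h; apply: contrapT => x0.
  have [f _ fx] := sep _ _ _ _ fX (submodule_zero _) x0.
  have [d dE] := d4 f; apply: fx; rewrite -dE; have [a ->] := xiE d.
  rewrite (ev_suml dD) big1 // => i _; by rewrite (evZl dD) h scaler0.
have [nL fL] := finite_klength_regular hL.
pose W0 : lmodType k := {ffun 'I_m -> restr L^o}.
pose R (mu : W0) := relation_on ev xi mu.
have hR : submodule R.
  split=> [x|a u v hu hv x].
    by rewrite big1 // => i _; rewrite ffunE scale0r (ev0r dD).
  transitivity (a *: \sum_i ev (xi i) ((u i : L) *: x) + \sum_i ev (xi i) ((v i : L) *: x)).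
    rewrite scaler_sumr -big_split; apply: eq_bigr => i _ /=.
    rewrite -(dual_linr dD); congr (ev _ _); rewrite !ffunE rscaleE scalerDl.
    by congr (_ + _); rewrite -scalerA.
  by rewrite hu hv scaler0 addr0.
have [lam0 [lamR lam0E]] := length_generators (length_ffun m fL) hR.
pose n := (m * nL)%N; pose lam (j : 'I_n) : W0 := lam0 j.
have lamE mu : relation_on ev xi mu -> exists c : 'I_n -> k, mu = \sum_j c j *: lam j.
  by move=> /lam0E[c ->]; exists (fun i => c i).
have fact1 := hom_from_relations hL uE dD fX xiE xisep lamE.
pose V2 : lmodType k := {ffun 'I_m -> restr X}.
have fV2 : length_le V2 (m * nX) by apply: length_ffun fX.
have [D2 [ev2 dD2]] := dual_exists V2 E; have [e1 e2 e3 e4] := dD2.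
have fD2 := dual_length uE dD2 fV2.
pose om (d : D2) (g : {linear X -> X}) := forall h : V2, ev2 d h = \sum_i ev (xi i) (g (h i)).
have omE g : exists d, om d g.
  have [f fE] : exists f : {linear V2 -> E}, forall h : V2, f h = \sum_i ev (xi i) (g (h i)).
    apply: lin_of_fun => a u v; rewrite scaler_sumr -big_split; apply: eq_bigr => i _ /=.
    by rewrite -(dual_linr dD); congr (ev _ _); rewrite !ffunE rscaleE linearP.
  by have [d dE] := e4 f; exists d => h; rewrite dE fE.
pose J d := exists2 g : {linear X -> X}, ~ bijective g & om d g.
have hJ : submodule J.
  split=> [|a d d' [g ng gE] [g' ng' g'E]].
    have [z zE] := lin_zero X X.
    exists z => [zb|h]; first by case: dX => nz _; apply: nz => x; apply: (bij_inj zb);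
      rewrite !zE.
    by rewrite (ev0l dD2) big1 // => i _; rewrite zE (ev0r dD).
  have [s sE] := scale_lin hL X a.
  have [g2 g2E] := lin_add (s \o g) g'.
  exists g2 => [gb|h].
    have [sgb|//] := bij_sum flX dX gb g2E; apply: ng; apply: (endo_inj_bij flX).
    by apply: lin_inj => x gx; apply: (bij_inj sgb); rewrite /= gx !linear0.
  rewrite e1 gE g'E scaler_sumr -big_split; apply: eq_bigr => i _ /=.
  by rewrite -(dual_linr dD) g2E /= sE.
(* The forms xi separate points, so the form belonging to 1 belongs to no other
   endomorphism. *)
have [id1 id1E] := idlin X; have [d_id om_id] := omE id1.
have nJ : ~ J d_id.
  move=> [g ng gE]; apply: ng.
  suff gid x : g x = x by exists id.
  apply/eqP; rewrite -subr_eq0; apply/eqP/xisep => i; rewrite (evBr dD).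
  pose z : V2 := [ffun j => if j == i then (x : restr X) else 0].
  have zE (g' : {linear X -> X}) : om d_id g' -> ev2 d_id z = ev (xi i) (g' x).
    move=> /(_ z) ->; rewrite (bigD1 i) //= ffunE eqxx big1 ?addr0 // => j /negbTE ji.
    by rewrite ffunE ji linear0 (ev0r dD).
  by rewrite -(zE _ gE) (zE _ om_id) id1E subrr.
(* Separation in the dual of X^m, followed by reflexivity of X^m. *)
have [Th ThJ Thid] := sep _ _ _ _ fD2 hJ nJ.
have [h hE] := dual_reflexive uE dD2 Th fV2.
exists m, n, (fun i j => (lam j i : L)), (fun i => (h i : X)); split.
  move=> [x xE]; apply: Thid; rewrite hE om_id.
  under eq_bigr => i _ do rewrite id1E xE.
  have evs (i : 'I_m) (F : 'I_n -> X) : ev (xi i) (\sum_j F j) = \sum_j ev (xi i) (F j).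
    by elim/big_rec2: _ => [|j y z _ <-]; [apply: ev0r dD _ | rewrite (evDr dD)].
  under eq_bigr => i _ do rewrite evs.
  by rewrite exchange_big big1 //= => j _; apply: lamR.
move=> Y f [nY fY] nsplit; apply: contrapT => nyE.
pose V3 : lmodType k := {ffun 'I_m -> restr Y}.
pose W (z : V3) := exists y : 'I_n -> Y, forall i, z i = \sum_j (lam j i : L) *: y j :> Y.
have hW : submodule W.
  split=> [|a u v [y yE] [z zE]].
    by exists (fun=> 0) => i; rewrite ffunE big1 // => j _; rewrite scaler0.
  exists (fun j => phi a *: y j + z j) => i.
  rewrite !ffunE rscaleE yE zE scaler_sumr -big_split; apply: eq_bigr => j _ /=.
  by rewrite scalerDr !scalerA (artin_central hL).
pose z : V3 := [ffun i => f (h i)].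
have nz : ~ W z by move=> [y yE]; apply: nyE; exists y => i; rewrite -yE ffunE.
have [th thW thz] := sep _ _ _ _ (length_ffun m fY) hW nz.
have [eta etaE] := ffun_lin th.
have [j y|g gE] := fact1 Y eta.
  have e0 : th [ffun i => (lam j i : L) *: (y : Y)] = 0.
    apply: thW; exists (fun l => if l == j then y else 0) => i.
    rewrite ffunE (bigD1 j) //= eqxx big1 ?addr0 // => l /negbTE ->.
    by rewrite scaler0.
  by rewrite -[RHS]e0 etaE; apply: eq_bigr => i _; rewrite ffunE.
have [d dE] := omE (g \o f).
apply: thz; rewrite etaE; transitivity (Th d).
  rewrite hE dE; apply: eq_bigr => i _; by rewrite ffunE gE.
apply: ThJ; exists (g \o f) => // gfb; apply: nsplit.
have [r [rK _]] := bij_inv gfb.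
by exists (r \o g) => x; apply: rK.
Qed.
End AR.

(** * Submodule-closed subcategories and critical modules *)

Section Subcat.
Variables (k : comPzRingType) (L : pzRingType) (phi : {rmorphism k -> L}).
Hypothesis hL : artin_algebra phi.
Implicit Types M A B X Y T E F : lmodType L.
Implicit Types C N P : lmodType L -> Prop.
Local Notation finite_klength := (finite_klength phi).
Local Notation has_kchain := (has_kchain phi).

Definition closed_subcat C := subcategory C /\ submodule_closed C.
Lemma closed_finite_klength C M : closed_subcat C -> C M -> finite_klength M.
Proof.
by move=> [[h _ _ _ _] _] /h; apply: finite_length_klength; apply: (finite_klength_regular hL).
Qed.

Lemma closed_iso C M (N : lmodType L) : closed_subcat C -> lmod_iso M N -> C M -> C N.
Proof. by move=> [[_ h _ _ _] _]; apply: h. Qed.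

Lemma closed_zero C M : closed_subcat C -> zero_module M -> C M.
Proof. by move=> [[_ _ h _ _] _]; apply: h. Qed.

Lemma closed_prod C M (N : lmodType L) : closed_subcat C -> C M -> C N -> C (M * N)%type.
Proof. by move=> [[_ _ _ h _] _]; apply: h. Qed.

Lemma closed_inj C A B (f : {linear A -> B}) : closed_subcat C -> injective f -> C B -> C A.
Proof.
move=> gC fi CB; have [_ /(_ B _ (submodule_type (submodule_im f)) CB) CI] := gC.
apply: closed_iso CI => //; pose v : {linear submodule_type (submodule_im f) -> B} := val.
have im x : exists a, f a = v x by case: x => x /= /asboolP.
have vi : injective v by apply: val_inj.
have [||g gE] := @lin_of_rel _ (submodule_type (submodule_im f)) A (fun x a => f a = v x) im.
- by move=> a x y x' y' e e'; rewrite !linearP e e'.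
- by move=> y; rewrite linear0 -(linear0 f) => /fi.
exists g; apply: inj_onto_bij.
  by apply: lin_inj => x gx; apply: vi; rewrite -gE gx !linear0.
move=> a; have Pa : f a \in submodule_pred (submodule_im f) by apply/asboolP; exists a.
by exists (exist _ (f a) Pa); apply: fi; rewrite gE.
Qed.

Lemma submodule_closedP C :
  (forall A B (f : {linear A -> B}), injective f -> C B -> C A) -> submodule_closed C.
Proof.
move=> h M S N; apply: (h N M (val : {linear N -> M})); exact: val_inj.
Qed.

(** Finitely many maps to modules of C already separate the points of Y, because Y
    satisfies the descending chain condition; so Y embeds into a finite product. *)
Lemma closed_cogenerated C Y : closed_subcat C -> finite_klength Y ->
  (forall y : Y, y <> 0 -> exists F (f : {linear Y -> F}), C F /\ f y <> 0) -> C Y.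
Proof.
move=> gC fY cog.
have [|S|S [P [p [CP pE]]] Smin] := @sub_minimal _ _ phi Y
  (fun S => exists F (p : {linear Y -> F}), C F /\ forall y, S y <-> p y = 0) (fun=> True) fY.
- have [id1 _] := idlin Y; have [A zA] := zero_module_exists L.
  have [p pE] := lin_zero Y A.
  by exists A, p; split; [apply: closed_zero | move=> y; rewrite pE].
- by move=> [F [p [_ pE]]]; split=> [|a u v]; rewrite !pE ?linear0 // linearP => -> ->;
  rewrite scaler0 addr0.
apply: (closed_inj (f := p) gC _ CP); apply: lin_inj => y py; apply: contrapT => y0.
have [F [f [CF fy]]] := cog y y0; have [h hE] := lin_pair p f.
apply: fy; have : (h y = 0).
  apply: (Smin (fun y => h y = 0)); last by apply/pE.
  - by exists (P * F)%type, h; split=> //; apply: closed_prod.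
  - by move=> x; rewrite hE => -[px _]; apply/pE.
by rewrite hE => -[].
Qed.

Lemma closed_of_summands C M n (c : nat -> summand M) : closed_subcat C -> finite_klength M ->
    is_decomposition n c ->
  (forall i, (i < n)%N -> C (summand_obj (c i))) -> C M.
Proof.
move=> gC fM [_ _ _ sE] Cc; apply: closed_cogenerated => // y y0.
have [i ni] : exists i : 'I_n, summand_out (c i) y <> 0.
  apply: contrapT => h; apply: y0; rewrite (sE y) big1 // => i _.
  suff -> : summand_out (c i) y = 0 by rewrite linear0.
  by apply: contrapT => h'; apply: h; exists i.
by exists (summand_obj (c i)), (summand_out (c i)); split=> //; apply: Cc.
Qed.

Lemma closed_summand C M n (c : nat -> summand M) i : closed_subcat C -> C M ->
    is_decomposition n c -> (i < n)%N -> C (summand_obj (c i)).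
Proof.
by move=> gC CM [_ r _ _] lin; apply: (closed_inj (f := summand_in (c i)) gC _ CM);
  apply: can_inj => y; apply: r.
Qed.

(** The objects just beyond N: nothing smaller than M leaves N. *)
Definition critical C N M := [/\ C M, indecomposable M, ~ N M &
  forall A (f : {linear A -> M}), injective f -> ~ onto f -> N A].

Section Crit.
Variables C N : lmodType L -> Prop.
Hypotheses (gC : closed_subcat C) (gN : closed_subcat N).
Local Notation critical := (critical C N).

Lemma critical_iso M M' : lmod_iso M M' -> critical M -> critical M'.
Proof.
move=> iso [CM dM nM pM]; split.
- exact: closed_iso CM.
- exact: iso_indec dM.
- by move=> /(closed_iso gN (iso_sym iso)).
move=> A f fi fs; have [g gb] := iso_sym iso; apply: (pM A (g \o f)).
  exact: inj_comp (bij_inj gb) fi.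
move=> s; apply: fs => y; have [x /= e] := s (g y); exists x.
exact: (bij_inj gb).
Qed.

(** A submodule of Y minimal among those outside N is indecomposable, as N is closed
    under finite sums. *)
Lemma critical_exists Y : C Y -> ~ N Y ->
  exists E (e : {linear E -> Y}), injective e /\ critical E.
Proof.
move=> CY nNY; have fY := closed_finite_klength gC CY.
have [||S [E [e [ei eE nNE]]] Smin] := @sub_minimal _ _ phi Y
  (fun S => exists E (e : {linear E -> Y}), [/\ injective e, forall y, S y <-> exists x,
    e x = y & ~ N E])
  (fun=> True) fY.
- have [id1 idE] := idlin Y; exists Y, id1; split=> // [x y|y]; first by rewrite !idE.
  by split=> // _; exists y.
- move=> S [E [e [_ eE _]]]; have [S0 Sl] := submodule_im e.
  by split=> [|a u v]; rewrite !eE //; apply: Sl.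
have small A (f : {linear A -> E}) : injective f -> ~ onto f -> N A.
  move=> fi fs; apply: contrapT => nNA; apply: fs => x.
  have [|||a /ei] := Smin (fun y => exists a, e (f a) = y) _ _ (e x).
  - by exists A, (e \o f); split=> //; apply: inj_comp.
  - by move=> _ [a <-]; apply/eE; exists (f a).
  - by apply/eE; exists x.
  by exists a.
exists E, e; split=> //; split=> //; first exact: closed_inj ei CY.
split=> [z|A B [f fb]]; first by apply: nNE; apply: closed_zero.
have [g [fg gf]] := bij_inv fb; have gi := can_inj gf.
apply: contrapT => /not_orP[nzA nzB]; apply: nNE.
apply: closed_iso (iso_sym (ex_intro _ f fb)) _ => //; apply: closed_prod => //.
  have [l lE] := lin_inl A B; apply: (small A (g \o l)).
    by apply: inj_comp => // x y; rewrite !lE => -[].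
  move=> s; apply: nzB => b; have [a /= /gi] := s (g (0, b)).
  by rewrite lE => -[_ ->].
have [r rE] := lin_inr A B; apply: (small B (g \o r)).
  by apply: inj_comp => // x y; rewrite !rE => -[].
move=> s; apply: nzA => a; have [b /= /gi] := s (g (a, 0)).
by rewrite rE => -[->].
Qed.

(** Maximal length is expressed by chains, which avoids a length function. *)
Definition top_critical M := critical M /\ forall M', critical M' ->
    forall n, has_kchain M' n -> has_kchain M n.

Lemma top_critical_iso M M' : lmod_iso M M' -> top_critical M -> top_critical M'.
Proof.
move=> iso [cM mM]; split; first exact: critical_iso cM.
by move=> M2 c2 n /(mM _ c2); apply: kchain_iso.
Qed.

(** A proper quotient of E would be strictly shorter than E, and E is at most as long as
    F. *)
Lemma critical_onto_top E F (f : {linear E -> F}) : critical E -> top_critical F -> onto f ->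
    bijective f.
Proof.
move=> cE [cF mF] fs; apply: inj_onto_bij => //.
by apply: (klength_onto_inj (phi := phi)) => //;
  [case: cE => /(closed_finite_klength gC) | apply: mF].
Qed.

Definition old_or_top T := N T \/ top_critical T.

(** The image of the critical module E is either a proper submodule of F, hence in N, or
    all of F. *)
Lemma critical_to_old_or_top E F (f : {linear E -> F}) : critical E -> old_or_top F ->
  (top_critical F /\ bijective f) \/
  exists (I : lmodType L) (p : {linear E -> I}) (i : {linear I -> F}),
    [/\ N I, onto p, injective i & forall x, i (p x) = f x].
Proof.
move=> cE lF; have [I [p [i [ps ii ipE]]]] := image_factorization f.
case: lF => [NF|bF].
  by right; exists I, p, i; split=> //; apply: closed_inj ii NF.
case: (pselect (onto i)) => [is_|nis].
  left; split=> //; apply: critical_onto_top => // y.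
  by have [z <-] := is_ y; have [x <-] := ps z; exists x; rewrite ipE.
by right; exists I, p, i; split=> //; case: bF => -[_ _ _ /(_ _ _ ii nis)].
Qed.

(** If Y is outside N it contains a critical module E. Not all images of E in the
    cogenerating modules can lie in N, since otherwise E itself would be cogenerated by
    N; so E maps isomorphically to some F, and the inclusion of E into Y splits. *)
Lemma indecomposable_cogenerated Y (P : lmodType L -> Prop) : indecomposable Y -> C Y ->
  (forall F, P F -> old_or_top F) ->
  (forall y : Y, y <> 0 -> exists F (f : {linear Y -> F}), P F /\ f y <> 0) ->
  N Y \/ exists F, [/\ P F, top_critical F & lmod_iso Y F].
Proof.
move=> dY CY Pl cog; apply: contrapT => /not_orP[nNY nF].
have [E [e [ei cE]]] := critical_exists CY nNY.
have [_ dE nNE _] := cE; apply: nNE; apply: closed_cogenerated => //.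
  by case: cE => /(closed_finite_klength gC).
move=> x x0; have [|F [f [PF fx]]] := cog (e x); first by rewrite -(linear0 e) => /ei.
have [[bF fb]|[I [p [i [NI ps ii ipE]]]]] := critical_to_old_or_top (f \o e) cE (Pl _ PF);
  last first.
  by exists I, p; split=> // px; apply: fx; rewrite -[LHS]ipE px linear0.
case: nF; exists F; split=> //.
have [g [gK _]] := bij_inv fb.
have eb : bijective e.
  by apply: (retract_bij (r := g \o f)) => //; case: dE.
have EY : lmod_iso E Y by exists e.
by apply: iso_trans (iso_sym EY) _; exists (f \o e).
Qed.

(** The direct summands of finite sums of modules in N and of critical modules of
    maximal length: the identity is a sum of maps factoring through such modules. *)
Definition extend Y := factors (fun T _ => old_or_top T) (@id Y).

Lemma old_or_top_extend M : old_or_top M -> extend M.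
Proof.
move=> lM; have [f fE] := idlin M.
by apply: (@factors_one _ _ _ (fun T _ => old_or_top T) _ f f id lM) => x; rewrite !fE.
Qed.

Hypothesis NC : forall M, N M -> C M.

Lemma old_or_top_C M : old_or_top M -> C M.
Proof. by case=> [/NC|[[]]]. Qed.

Lemma extend_cogenerated Y : extend Y -> forall y : Y, y <> 0 -> exists F (f : {linear Y ->
    F}), old_or_top F /\ f y <> 0.
Proof.
rewrite /extend => sf y; rewrite -[y in y <> 0]/(id y).
elim: sf => [f f0|T u v f f' lT _ IH fE]; first by rewrite f0.
case: (pselect (u y = 0)) => [u0|]; last by exists T, u.
by rewrite fE u0 linear0 add0r.
Qed.

Lemma extend_indecomposable Y : indecomposable Y -> C Y -> extend Y -> old_or_top Y.
Proof.
move=> dY CY /extend_cogenerated cog.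
have [|[F [_ bF iso]]] := indecomposable_cogenerated dY CY (P := old_or_top) (fun _ => id) cog;
  first by left.
by right; apply: top_critical_iso bF; apply: iso_sym.
Qed.

Lemma extend_finite_klength Y : extend Y -> finite_klength Y.
Proof.
rewrite /extend => sf.
have H (f : Y -> Y) : factors (fun T _ => old_or_top T) f -> exists T (g : {linear Y ->
  T}), C T /\ forall y, g y = 0 -> f y = 0.
  elim=> [{}f f0|T u v {}f f' lT _ [T' [g [CT' gE]]] fE].
    have [A zA] := zero_module_exists L.
    have [p pE] := lin_zero Y A.
    by exists A, p; split; first exact: closed_zero.
  have [h hE] := lin_pair u g; exists (T * T')%type, h; split.
    by apply: closed_prod => //; apply: old_or_top_C.
  by move=> y; rewrite hE fE => -[-> /gE ->]; rewrite linear0 addr0.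
have [T [g [CT gE]]] := H _ sf.
apply: finite_klength_inj (closed_finite_klength gC CT); apply: (lin_inj gE).
Qed.

Lemma extend_C Y : extend Y -> C Y.
Proof.
move=> nY; apply: closed_cogenerated (extend_finite_klength nY) _ =>
  // y /(extend_cogenerated nY)[F [f [lF fy]]].
by exists F, f; split=> //; apply: old_or_top_C.
Qed.

Lemma extend_factors X Y (f : {linear X -> Y}) : extend Y -> factors (fun T _ => old_or_top T) f.
Proof. exact: (@factors_right _ Y X Y (fun T _ => old_or_top T) (fun T _ =>
  old_or_top T) id f). Qed.

Lemma extend_retract X Y (u : {linear X -> Y}) (v : {linear Y -> X}) : (forall x, v (u x) = x) ->
  extend Y -> extend X.
Proof.
move=> vu nY; have := factors_left v (extend_factors u nY).
by rewrite /extend; congr factors; apply/funext => x; rewrite vu.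
Qed.

Lemma extend_prod X Y : extend X -> extend Y -> extend (X * Y)%type.
Proof.
move=> nX nY; have [l lE] := lin_inl X Y; have [r rE] := lin_inr X Y.
have [p pE] := lin_fst X Y; have [q qE] := lin_snd X Y.
apply: (factors_add (factors_left l (extend_factors p nX)) (factors_left r (extend_factors q
  nY))) => -[x y].
by rewrite lE rE pE qE; apply/eqP; rewrite xpair_eqE /= addr0 add0r !eqxx.
Qed.

(** For a submodule A of such a module, the indecomposable summands of A are cogenerated
    by N and the critical modules of maximal length, so [indecomposable_cogenerated]
    applies to them. *)
Lemma extend_closed : closed_subcat extend.
Proof.
split; first split.
- by move=> M /extend_C; case: gC => -[h _ _ _ _] _; apply: h.
- by move=> M M' /iso_sym[f /bij_inv[g [fg gf]]]; apply: (extend_retract (u := f) (v := g)).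
- by move=> M z; apply: old_or_top_extend; left; apply: closed_zero.
- exact: extend_prod.
- move=> M M'; have [l lE] := lin_inl M M'; have [p pE] := lin_fst M M'.
  by apply: (extend_retract (u := l) (v := p)) => x; rewrite lE pE.
apply: submodule_closedP => A B f fi nB.
have CA : C A by apply: closed_inj fi (extend_C nB).
have fA := closed_finite_klength gC CA.
have [n [c dc]] := decomposition fA.
have [dd dr dorth ds] := dc.
apply: (@factors_sum _ _ _ (fun T _ => old_or_top T) n (fun i x =>
  summand_in (c i) (summand_out (c i) x))) => [i lin|x]; last exact: ds.
suff lc : old_or_top (summand_obj (c i)) by apply: (@factors_one _ _ _ (fun T _ =>
  old_or_top T) _ (summand_out (c i)) (summand_in (c i)) _ lc).
have ci : injective (f \o summand_in (c i)) by apply: inj_comp => //; apply: can_inj => y;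
  apply: dr.
have [||||nc|[F [_ bF iso]]] := @indecomposable_cogenerated (summand_obj (c i)) old_or_top.
- exact: dd.
- exact: closed_summand dc lin.
- by [].
- move=> y y0; have [|F [g [lF gy]]] := extend_cogenerated nB (y := f (summand_in (c i) y)).
    by move=> h; apply: y0; apply: ci; rewrite /= h !linear0.
  by exists F, (g \o (f \o summand_in (c i))).
- by left.
by right; apply: top_critical_iso bF; apply: iso_sym.
Qed.
End Crit.
End Subcat.

(** * Critical modules have bounded length *)

Section Bound.
Variables (k : comPzRingType) (L : pzRingType) (phi : {rmorphism k -> L}).
Hypothesis hL : artin_algebra phi.
Implicit Types M A B X Y T E F U : lmodType L.
Implicit Types C N P : lmodType L -> Prop.
Local Notation finite_klength := (finite_klength phi).
Local Notation klength_le := (klength_le phi).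

Lemma decomposition_klength U n (c : nat -> summand U) b : is_decomposition n c ->
  (forall i, (i < n)%N -> klength_le (summand_obj (c i)) b) -> klength_le U (n * b).
Proof.
move=> [_ _ _ sE] cb.
pose P := fix P j (x : U) : Prop := if j is j'.+1 then exists a,
  P j' (x - summand_in (c j') a) else x = 0.
have fP j : (j <= n)%N -> @part_length_le k (restr phi U) (P j) (j * b).
  elim: j => [_|j IH lj]; first exact: part_length0.
  by rewrite mulSn addnC; apply: klength_extend (IH (ltnW lj)) (cb j lj).
apply: eq_part_length (fP n (leqnn n)) => x; split=> // _; rewrite (sE x).
elim: n {cb sE fP} => [|n IH]; first by rewrite big_ord0.
by exists (summand_out (c n) x); rewrite big_ord_recr /= addrK.
Qed.

Lemma indecomposables_bounded N : closed_subcat N -> finite_subcat N ->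
  exists s (F : 'I_s -> lmodType L) b,
   (forall X, N X -> indecomposable X -> exists i, lmod_iso X (F i)) /\
   (forall X, N X -> indecomposable X -> klength_le X b).
Proof.
move=> gN [s [F FE]].
have /choice[b bE] (i : 'I_s) : exists b, forall X, N X -> lmod_iso X (F i) -> klength_le X b.
  case: (pselect (exists2 X, N X & lmod_iso X (F i))) => [[X NX iX]|h].
    have [b fb] := closed_finite_klength hL gN NX; exists b => Y _ /iso_sym iY.
    by apply: klength_iso fb; apply: iso_trans iX iY.
  by exists 0%N => X NX iX; case: h; exists X.
exists s, F, (\max_i b i); split=> // X NX dX.
have [i iso] := FE X NX dX; apply: part_length_leq (bE i X NX iso).
exact: (leq_bigmax i).
Qed.

(** The elements of L that move m into U form a left ideal I, and M is the pushout of U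
    along the map from I to U sending l to l m. As I is generated by nL elements over k,
    the components of this map at the copies of X are vectors in a k-module of length at
    most nL * b. Among more than nL * b of them there is a linear dependence; it gives a
    map from U to X that vanishes on the image of I, hence extends to M, and that is an
    isomorphism on one of the copies. *)
Lemma split_copies M U nL b (i0 : {linear U -> M}) (m : M) X (Y : nat -> lmodType L)
    (iota : forall j, {linear Y j -> U}) (pi : forall j, {linear U -> Y j})
    (th : forall j, {linear Y j -> X}) :
  klength_le (L^o : lmodType L) nL -> klength_le X b -> injective i0 ->
  (forall x, exists u (l : L), x = i0 u + l *: m) ->
  let d := (nL * b)%N in
  (forall j, (j <= d)%N -> bijective (th j)) ->
  (forall j y, (j <= d)%N -> pi j (iota j y) = y) ->
  (forall i j y, (i <= d)%N -> (j <= d)%N -> i <> j -> pi j (iota i y) = 0) ->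
  exists j (r : {linear M -> Y j}), (j <= d)%N /\ forall y, r (i0 (iota j y)) = y.
Proof.
move=> fL fX ii tot d thb pi1 pi0.
pose I (l : L^o) := exists u, i0 u = (l : L) *: m.
have hI : @submodule k (restr phi L^o) I.
  split=> [|a u v [u' ue] [v' ve]]; first by exists 0; rewrite linear0 scale0r.
  exists (phi a *: u' + v'); rewrite linearP ue ve rscaleE scalerDl.
  by congr (_ + _); rewrite scalerA.
have [l [lI lE]] := length_generators fL hI.
have /choice[u uE] : forall t, exists u, i0 u = (l t : L) *: m by [].
pose v j : {ffun 'I_nL -> restr phi X} := [ffun t : 'I_nL => th j (pi j (u t))].
have [j jd [a aE]] := length_dependent v (length_ffun nL fX).
have [r rE] : exists r : {linear U -> X}, forall u,
    r u = th j (pi j u) - \sum_(i < j) phi (a i) *: th i (pi i u).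
  apply: lin_of_fun => c x y; rewrite !linearP /= scalerBr addrACA -opprD; congr (_ - _).
  rewrite scaler_sumr -big_split; apply: eq_bigr => i _ /=.
  by rewrite !linearP /= scalerDr !scalerA (artin_central hL).
have r0 t : (t < nL)%N -> r (u t) = 0.
  move=> lt; rewrite rE; have /ffunP/(_ (Ordinal lt)) := aE; rewrite ffunE /= => ->.
  rewrite sum_ffunE; apply/eqP; rewrite subr_eq0; apply/eqP; apply: eq_bigr => i _.
  by rewrite !ffunE.
have rI x (y : L) : i0 x = y *: m -> r x = 0.
  move=> e; have /lE[c cE] : I y by exists x.
  have -> : x = \sum_(t < nL) phi (c t) *: u t.
    apply: ii; rewrite e linear_sum cE scaler_suml; apply: eq_bigr => t _.
    by rewrite linearZ /= uE scalerA.
  by rewrite linear_sum big1 // => t _; rewrite linearZ /= r0 ?scaler0.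
pose G x y := exists u (l : L), x = i0 u + l *: m /\ y = r u.
have [x|c x y x' y'|y|r' r'E] := @lin_of_rel _ M X G.
- by have [x' [l' ->]] := tot x; exists (r x'), x', l'.
- move=> [p [q [-> ->]]] [p' [q' [-> ->]]]; exists (c *: p + p'), (c * q + q').
  by rewrite !linearP /= scalerDr scalerDl scalerA addrACA.
- move=> [p [q [/eqP + ->]]]; rewrite eq_sym addr_eq0 => /eqP e.
  by apply: (rI _ (- q)); rewrite scaleNr.
have r'i x : r' (i0 x) = r x.
  have [p [q [e ->]]] := r'E (i0 x); apply/esym/eqP; rewrite -subr_eq0 -linearB.
  by apply/eqP/(rI _ q); rewrite linearB e addrC addKr.
have [g [thK gK]] := bij_inv (thb j jd).
exists j, (g \o r'); split=> // y /=; rewrite r'i rE pi1 // big1 ?subr0 ?thK // => i _.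
have ij : (i <= d)%N by apply: leq_trans jd; apply: ltnW.
rewrite pi0 ?linear0 ?scaler0 //.
by move=> e; have := ltn_ord i; rewrite -e ltnn.
Qed.

(** A critical module M is U + L m with U a maximal submodule, so U lies in N. By
    [split_copies] every indecomposable of N occurs boundedly often in U, since M is
    indecomposable and not in N. *)
Lemma critical_bounded C N : closed_subcat C -> closed_subcat N -> finite_subcat N ->
  exists b, forall M, critical C N M -> klength_le M b.
Proof.
move=> gC gN /(indecomposables_bounded gN)[s [F [b [FE fb]]]].
have [nL fL] := finite_klength_regular hL.
exists (s * (nL * b) * b + nL)%N => M [CM dM nNM pM].
have fM := closed_finite_klength hL gC CM; have [nzM _] := dM.
have [||S [hS [m nSm]] Smax] := @sub_maximal _ _ phi M (fun S => submodule S /\ exists x,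
  ~ S x) (fun x => x = 0) fM.
- split; first exact: submodule_zero.
  by apply: contrapT => h; apply: nzM => x; apply: contrapT => x0; apply: h; exists x.
- by move=> S [].
have [U [i0 [ii iE]]] := submodule_embedding hS.
have NU : N U by apply: (pM U i0) => // su; apply: nSm; apply/iE; apply: su.
have tot x : exists u (l : L), x = i0 u + l *: m.
  suff [l /iE[u uE]] : exists l : L, S (x - l *: m).
    by exists u, l; rewrite uE subrK.
  apply: contrapT => h; apply: nSm; apply: (Smax (fun x => exists l : L, S (x - l *: m))).
  - split; last by exists x.
    split=> [|a p q [l lE] [l' l'E]]; first by exists 0; rewrite scale0r subr0; case: hS.
    exists (a * l + l'); rewrite scalerDl opprD addrACA -scalerA -scalerBr.
    by case: hS => _; apply.
  - by move=> y Sy; exists 0; rewrite scale0r subr0.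
  - by exists 1; rewrite scale1r subrr; case: hS.
have fU := closed_finite_klength hL gN NU.
have [n [c dc]] := decomposition fU; have [dd dr dorth ds] := dc.
have Nc i : (i < n)%N -> N (summand_obj (c i)) by move=> lin; apply: (closed_summand gN NU dc).
have /choice[tau tauE] (l : 'I_n) : exists i, lmod_iso (summand_obj (c l)) (F i).
  by apply: FE; [apply: Nc | apply: dd].
have cardS i : (#|[set l | tau l == i]| <= nL * b)%N.
  rewrite leqNgt; apply/negP; set Si := [set l | _]; set d := (nL * b)%N => ltd.
  have /card_gt0P[l0 _] : (0 < #|Si|)%N by apply: leq_ltn_trans ltd.
  pose e j := nth l0 (enum Si) j.
  have eS j : (j <= d)%N -> tau (e j) = i.
    move=> jd; have : e j \in Si by rewrite -mem_enum mem_nth // -cardE (leq_ltn_trans jd).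
    by rewrite inE => /eqP.
  have ee j j' : (j <= d)%N -> (j' <= d)%N -> j <> j' -> val (e j) <> val (e j').
    move=> jd jd' jj' /val_inj/eqP; rewrite nth_uniq ?enum_uniq -?cardE ?(leq_ltn_trans _ ltd) //.
    by move/eqP.
  pose X := summand_obj (c (e 0%N)).
  have th0 : forall j, exists t : {linear summand_obj (c (e j)) -> X}, (j <= d)%N -> bijective t.
    move=> j; have [jd|_] := leqP j d; last first.
      have [z _] := lin_zero (summand_obj (c (e j))) (X).
      by exists z.
    have iso : lmod_iso (summand_obj (c (e j))) X.
      apply: (iso_trans (tauE (e j))); rewrite eS // -(eS 0%N) //.
      exact: iso_sym (tauE _).
    by case: iso => t tb; exists t.
  pose th j := projT1 (cid (th0 j)); have thE j := projT2 (cid (th0 j)).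
  have [||||||j [r [jd rK]]] := @split_copies M U nL b i0 m X (fun j => summand_obj (c (e j)))
      (fun j => summand_in (c (e j))) (fun j => summand_out (c (e j))) th fL.
  - by apply: fb; [apply: Nc | apply: dd].
  - exact: ii.
  - exact: tot.
  - by move=> j jd; apply: thE.
  - by move=> j y jd; apply: dr.
  - by move=> j j' y jd jd' jj'; apply: dorth => //; apply: ee.
  apply: nNM; apply: (closed_iso gN _ (Nc (e j) (ltn_ord _))).
  exists (i0 \o summand_in (c (e j))).
  by apply: (retract_bij (r := r)) => //; case: (dd (e j) (ltn_ord _)).
have nb : (n <= s * (nL * b))%N.
  rewrite -[n in (n <= _)%N]card_ord -sum1_card (partition_big tau xpredT) //=.
  rewrite -[s in (_ <= s * _)%N]card_ord -sum_nat_const; apply: leq_sum => i _.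
  by rewrite sum1_card; apply: leq_trans (cardS i); rewrite cardsE.
have fUb : klength_le U (n * b).
  by apply: (decomposition_klength dc) => i lin; apply: fb; [apply: Nc | apply: dd].
have [g gE] := lin_orbit m.
have f1 := klength_extend g (klength_extend i0 (part_length0 _) fUb) fL.
apply: (@part_length_leq _ _ _ (0 + n * b + nL));
  first by rewrite add0n leq_add2r leq_mul2r nb orbT.
apply: eq_part_length f1 => x; split=> // _; have [u [l xE]] := tot x.
by exists l, u; rewrite gE xE addrK subrr.
Qed.
End Bound.

(** * Classes with finitely many isomorphism types *)

Section Fin.
Variable L : pzRingType.
Implicit Types M A B X Y T E F U : lmodType L.
Implicit Types C N P : lmodType L -> Prop.

(** Arbitrary finite index types make unions immediate. *)
Definition finitely_many P := exists (I : finType) (F : I -> lmodType L),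
  forall M, P M -> exists i, lmod_iso M (F i).

Lemma finitely_many_sub P P' : (forall M, P M -> P' M) -> finitely_many P' -> finitely_many P.
Proof. by move=> PP' [I [F FE]]; exists I, F => M /PP'; apply: FE. Qed.

Lemma finitely_many_finite_subcat C : finitely_many (fun M => C M /\ indecomposable M) ->
    finite_subcat C.
Proof.
move=> [I [F FE]]; exists #|I|, (fun i => F (enum_val i)) => M CM dM.
by have [//|i iso] := FE M; exists (enum_rank i); rewrite enum_rankK.
Qed.

Lemma finite_subcat_finitely_many C : finite_subcat C ->
    finitely_many (fun M => C M /\ indecomposable M).
Proof. by move=> [n [F FE]]; exists 'I_n, F => M [CM dM]; apply: FE. Qed.

Lemma finitely_many_or P P' : finitely_many P -> finitely_many P' ->
    finitely_many (fun M => P M \/ P' M).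
Proof.
move=> [I [F FE]] [J [G GE]].
exists (I + J)%type, (fun x => match x with inl i => F i | inr j => G j end).
move=> M [/FE[i iso]|/GE[j iso]]; first by exists (inl i).
by exists (inr j).
Qed.

Lemma finitely_many_exists (I : finType) (P : I -> lmodType L -> Prop) :
  (forall i, finitely_many (P i)) -> finitely_many (fun M => exists i, P i M).
Proof.
move=> h; pose J i : finType := projT1 (cid (h i)).
have h2 i : exists F : J i -> lmodType L, forall M, P i M -> exists j, lmod_iso M (F j).
  exact: projT2 (cid (h i)).
pose F i := projT1 (cid (h2 i)); have FE i := projT2 (cid (h2 i)).
exists {i : I & J i}, (fun x => F (tag x) (tagged x)) => M [i /FE[j iso]].
by exists (Tagged J j).
Qed.

(** Representatives can be taken inside the class. *)
Lemma finitely_many_reps P : finitely_many P -> exists (I : finType) (F : I -> lmodType L),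
  (forall i, P (F i)) /\ forall M, P M -> exists i, lmod_iso M (F i).
Proof.
move=> [I [F FE]].
have h (i : {i | `[< exists M, P M /\ lmod_iso M (F i) >]}) : exists M, P M /\
  lmod_iso M (F (val i)).
  by case: i => i /= /asboolP.
exists {i | `[< exists M, P M /\ lmod_iso M (F i) >]}, (fun i => projT1 (cid (h i)));
  split=> [i|M PM].
  by have [] := projT2 (cid (h i)).
have [i iso] := FE M PM.
have hi : `[< exists M, P M /\ lmod_iso M (F i) >] by apply/asboolP; exists M.
exists (exist _ i hi); have [_ iso'] := projT2 (cid (h (exist _ i hi))).
by apply: iso_trans iso _; apply: iso_sym.
Qed.

(** All terms lie in P, also beyond the bound c, so that data on the members can be
    chosen for every index. *)
Lemma infinite_family P c : ~ finitely_many P -> exists M : nat -> lmodType L,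
  (forall j, P (M j)) /\ forall i j, (i < c)%N -> (j < c)%N -> lmod_iso (M i) (M j) -> i = j.
Proof.
move=> nf; elim: c => [|c [M [PM isoM]]].
  have [M PM] : exists M, P M.
    by apply: contrapT => h; apply: nf; exists void, (fun v : void => match v with end) => M PM;
      case: h; exists M.
  by exists (fun=> M).
have [M' [PM' nM']] : exists M', P M' /\ forall i, (i < c)%N -> ~ lmod_iso M' (M i).
  apply: contrapT => h; apply: nf; exists 'I_c, (fun i : 'I_c => M i) => M' PM'.
  apply: contrapT => h'; apply: h; exists M'; split=> // i lic iso; apply: h'.
  by exists (Ordinal lic).
exists (fun i => if (i < c)%N then M i else M'); split=> [j|i j]; first by case: ifP.
rewrite !ltnS; case: (ltnP i c) => ic; case: (ltnP j c) => jc ilc jlc.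
- exact: isoM.
- by move=> /iso_sym /nM' [].
- by move=> /nM' [].
- by move=> _; apply/eqP; rewrite eqn_leq (leq_trans ilc jc) (leq_trans jlc ic).
Qed.
End Fin.

(** * A Nakayama lemma for maps into a module *)

(** Membership in a sequence over a type without decidable equality. *)
Fixpoint listed (T : Type) (x : T) (s : seq T) : Prop :=
  if s is y :: s' then y = x \/ listed x s' else False.

Lemma listed_cat (T : Type) (x : T) s t : listed x s \/ listed x t -> listed x (s ++ t).
Proof.
elim: s => [[]|y s IH] //= [[->|xs]|xt]; first by left.
  by right; apply: IH; left.
by right; apply: IH; right.
Qed.

Lemma listed_flatten (T : Type) (x : T) (ss : seq (seq T)) s : listed s ss -> listed x s ->
    listed x (flatten ss).
Proof.
elim: ss => //= s' ss IH [->|sss] xs; apply: listed_cat; first by left.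
by right; apply: IH.
Qed.

Lemma listed_map (A : eqType) (T : Type) (f : A -> T) a s : a \in s -> listed (f a) (map f s).
Proof.
elim: s => //= b s IH; rewrite inE => /orP[/eqP ->|/IH]; [by left | by right].
Qed.

Lemma listed_mapE (A T : Type) (f : A -> T) y s : listed y (map f s) -> exists a, y = f a.
Proof. by elim: s => //= b s IH [<-|/IH //]; exists b. Qed.

Lemma listed_flattenE (T : Type) (x : T) (ss : seq (seq T)) :
  listed x (flatten ss) -> exists2 s, listed s ss & listed x s.
Proof.
elim: ss => //= s ss IH.
have catE s1 s2 : listed x (s1 ++ s2) -> listed x s1 \/ listed x s2.
  elim: s1 => [|y s1 IH1] /=; first by right.
  by move=> [->|/IH1[]]; [left; left | left; right | right].
move=> /catE[xs|/IH[s' ss' xs']]; first by exists s => //; left.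
by exists s' => //; right.
Qed.

Section Gen.
Variables (k : comPzRingType) (L : pzRingType) (phi : {rmorphism k -> L}).
Implicit Types A B X Y T E F U : lmodType L.
Local Notation finite_klength := (finite_klength phi).

Lemma bij_comp_left X T A (u : {linear X -> T}) (w : {linear T -> A}) : indecomposable T ->
  ~ zero_module X -> bijective (w \o u) -> bijective u.
Proof.
move=> dT nX /bij_inv[g [gK _]].
apply: (retract_bij (r := g \o w)) => //; exact: gK.
Qed.

Variable M : lmodType L.
Record map_to := MapTo { map_dom : lmodType L; map_fun : {linear map_dom -> M} }.

(** f is a sum of composites of the maps in G with maps u satisfying Q, one for each
    member of G. *)
Fixpoint generated X (Q : forall T : lmodType L, {linear X -> T} ->
    Prop) (G : seq map_to) (f : X -> M) : Prop :=
  match G with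
  | [::] => forall x, f x = 0
  | g :: G' => exists (u : {linear X -> map_dom g}) (f' : X -> M),
      [/\ Q _ u, generated Q G' f' & forall x, f x = map_fun g (u x) + f' x]
  end.

Definition any_map X T (u : {linear X -> T}) := True.
Definition not_iso X T (u : {linear X -> T}) := ~ bijective u.

Lemma generated_add X (Q : forall T : lmodType L, {linear X -> T} -> Prop) G f f' h :
  (forall T (u v w : {linear X -> T}), Q T u -> Q T v -> (forall x, w x = u x + v x) -> Q T w) ->
  generated Q G f -> generated Q G f' -> (forall x, h x = f x + f' x) -> generated Q G h.
Proof.
move=> Qa; elim: G f f' h => [|g G IH] f f' h /=.
  by move=> f0 f'0 hE x; rewrite hE f0 f'0 addr0.
move=> [u [f1 [Qu gf1 fE]]] [v [f2 [Qv gf2 f'E]]] hE.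
have [w wE] := lin_add u v.
exists w, (fun x => f1 x + f2 x); split=> [||x].
- exact: Qa Qu Qv wE.
- exact: IH gf1 gf2 _.
by rewrite hE fE f'E wE linearD addrACA.
Qed.

Lemma generated_zero X (Q : forall T : lmodType L, {linear X -> T} -> Prop) G (f : X -> M) :
  (forall T (u : {linear X -> T}), (forall x, u x = 0) -> Q T u) ->
  (forall x, f x = 0) -> generated Q G f.
Proof.
move=> Q0; elim: G f => //= g G IH f f0.
have [z zE] := lin_zero (X) (map_dom g).
exists z, f; split=> [||x]; [exact: Q0 | exact: IH | by rewrite zE linear0 add0r].
Qed.

Lemma generated_comp X X' (Q : forall T : lmodType L, {linear X -> T} -> Prop)
  (Q' : forall T : lmodType L, {linear X' -> T} -> Prop) (w : {linear X' -> X}) G f :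
  (forall g (u : {linear X -> map_dom g}), listed g G -> Q _ u -> Q' _ (u \o w)) ->
  generated Q G f -> generated Q' G (fun x => f (w x)).
Proof.
elim: G f => [|g G IH] f QQ' /=; first by move=> f0 x; rewrite f0.
move=> [u [f' [Qu gf' fE]]]; exists (u \o w), (fun x => f' (w x)); split=> [||x].
- by apply: QQ' => //; left.
- by apply: IH gf' => h v hG; apply: QQ'; right.
by rewrite fE.
Qed.

Lemma generated_in X G g (u : {linear X -> map_dom g}) : listed g G ->
    generated (@any_map X) G (fun x => map_fun g (u x)).
Proof.
elim: G => //= g' G IH [e|gG].
  subst g'; exists u, (fun=> 0); split=> // [|x]; first exact: generated_zero.
  by rewrite addr0.
have [z zE] := lin_zero (X) (map_dom g').
exists z, (fun x => map_fun g (u x)); split=> // [|x]; first exact: IH.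
by rewrite zE linear0 add0r.
Qed.

Lemma generated_vanish X Q G (f : X -> M) : generated Q G f ->
  (forall g, listed g G -> forall x, map_fun g x = 0) -> forall x, f x = 0.
Proof.
elim: G f => //= g G IH f [u [f' [_ gf' fE]]] h x.
rewrite fE h ?add0r; last by left.
by apply: IH gf' _ x => g' gG; apply: h; right.
Qed.

Lemma generated_sum X G n (F : nat -> X -> M) (f : X -> M) :
  (forall i, (i < n)%N -> generated (@any_map X) G (F i)) ->
    (forall x, f x = \sum_(i < n) F i x) ->
  generated (@any_map X) G f.
Proof.
elim: n f => [|n IH] f hF fE; first by apply: generated_zero => // x; rewrite fE big_ord0.
apply: (@generated_add X (@any_map X) G (fun x => \sum_(i < n) F i x) (F n)) => //.
- by apply: IH => // i lin; apply: hF; apply: leqW.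
- exact: hF.
by move=> x; rewrite fE big_ord_recr.
Qed.

(** Eliminate one generator at a time. The coefficient u of the first generator g in the
    expression of g is not an isomorphism, so 1 - u is invertible because the
    endomorphism ring is local; g is thus expressed by the others, and substituting
    keeps all coefficients non-isomorphisms. *)
Lemma nakayama G :
  (forall g, listed g G -> finite_klength (map_dom g) /\ indecomposable (map_dom g)) ->
  (forall g, listed g G -> generated (@not_iso (map_dom g)) G (map_fun g)) ->
  forall g, listed g G -> forall x, map_fun g x = 0.
Proof.
elim: G => // g G IH hG gG.
have [fg dg] := hG g (or_introl erefl).
have nbadd X : finite_klength X -> indecomposable X -> forall T (u v w : {linear X -> T}),
    not_iso u -> not_iso v -> (forall x, w x = u x + v x) -> not_iso w.
  by move=> fX dX T u v w nu nv wE wb; case: (bij_sum fX dX wb wE).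
have /= [u [f' [nu gf' fE]]] := gG g (or_introl erefl).
have [v vE] : exists v : {linear map_dom g -> map_dom g}, forall x, v x = x - u x.
  by apply: lin_of_fun => b y z; rewrite linearP opprD addrACA scalerBr.
have [id1 idE] := idlin (map_dom g).
have vb : bijective v.
  have [|x|/nu//|//] := @bij_sum _ _ _ _ _ id1 u v fg dg.
    by exists id1 => x; rewrite !idE.
  by rewrite idE vE addrC subrK.
have [w [vw wv]] := bij_inv vb.
have wb : bijective w by exists v.
have ggG : generated (@not_iso (map_dom g)) G (map_fun g).
  have -> : map_fun g = (fun x => f' (w x)) :> (map_dom g -> M).
    apply/funext => x; rewrite -{1}(wv x) vE linearB [map_fun g (w x)]fE addrC addKr //.
  apply: generated_comp gf' => g' u' _ nu' b; apply: nu'.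
  suff -> : u' = (u' \o w) \o v :> (_ -> _) by apply: bij_comp.
  by apply/funext => x /=; rewrite vw.
have zG g' : listed g' G -> forall x, map_fun g' x = 0.
  apply: IH => {}g' g'G; first by apply: hG; right.
  have [fg' dg'] := hG g' (or_intror g'G).
  have /= [u1 [f1 [nu1 gf1 f1E]]] := gG g' (or_intror g'G).
  apply: (generated_add (nbadd _ fg' dg') _ gf1 f1E).
  apply: generated_comp ggG => h u' _ nu' b; apply: nu1.
  by apply: bij_comp_left b => //; case: dg'.
move=> g' [<-|]; last exact: zG.
exact: generated_vanish ggG zG.
Qed.
End Gen.

(** * Finitely many critical modules of maximal length *)

Section Layer.
Variables (k : comPzRingType) (L : pzRingType) (phi : {rmorphism k -> L}).
Hypothesis hL : artin_algebra phi.
Implicit Types A B X Y T E F U W Z : lmodType L.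
Local Notation finite_klength := (finite_klength phi).
Local Notation klength_le := (klength_le phi).

(** The partial sums form a chain. *)
Lemma decomposition_size Z n (c : nat -> summand Z) b : is_decomposition n c ->
    klength_le Z b -> (n <= b)%N.
Proof.
move=> [dd dr dorth ds] fZ; apply: (length_chain fZ).
pose S i (z : restr phi Z) := forall l, (l < n)%N -> (i <= l)%N -> summand_out (c l) (z : Z) = 0.
exists S; split.
- move=> i; split=> [l lin il|a u v Su Sv l lin il]; first by rewrite linear0.
  by rewrite rscaleE linearP Su // Sv // scaler0 addr0.
- by move=> i x Sx l lin il; apply: Sx => //; apply: ltnW.
move=> i lin; have [nz _] := dd i lin.
have [y y0] : exists y : summand_obj (c i), y <> 0.
  by apply: contrapT => h; apply: nz => y; apply: contrapT => y0; apply: h; exists y.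
exists (summand_in (c i) y).
  by move=> l ll il; apply: dorth => // e; rewrite e ltnn in il.
by move=> /(_ i lin (leqnn i)); rewrite dr.
Qed.

(** A finite product of the modules Mj, built by iteration and described only by what is
    needed: its projections and that they separate points. *)
Lemma joint_map (C : lmodType L -> Prop) W q (Mj : nat -> lmodType L)
    (f : forall j, {linear W -> Mj j}) :
  closed_subcat C -> (forall j, C (Mj j)) -> exists (P : lmodType L) (g : {linear W -> P}),
  [/\ C P, forall j, (j < q)%N -> exists p : {linear P -> Mj j}, forall w, p (g w) = f j w
    & forall z : P, z <> 0 -> exists2 j, (j < q)%N &
        exists p : {linear P -> Mj j}, (forall w, p (g w) = f j w) /\ p z <> 0].
Proof.
move=> gC CM; elim: q => [|q [P [g [CP gp gz]]]].
  have [A zA] := zero_module_exists L.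
  have [p pE] := lin_zero W A.
  by exists A, p; split=> [|//|z []]; first exact: closed_zero.
have [h hE] := lin_pair g (f q).
have [fs fsE] := lin_fst P (Mj q); have [sn snE] := lin_snd P (Mj q).
exists (P * Mj q)%type, h; split.
- exact: closed_prod.
- move=> j; rewrite ltnS leq_eqVlt => /orP[/eqP ->|/gp[p pE]].
    by exists sn => w; rewrite hE snE.
  by exists (p \o fs) => w; rewrite /= hE fsE pE.
move=> [z z'] nz; case: (pselect (z = 0)) => [z0|/gz[j jq [p [pE pz]]]].
  exists q => //; exists sn; split=> [w|]; first by rewrite hE snE.
  by rewrite snE /= => z'0; apply: nz; rewrite z0 z'0.
exists j; first exact: leqW; exists (p \o fs); split=> [w|]; rewrite /= ?hE fsE //.
exact: pE.
Qed.

Section N.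
Variables C N : lmodType L -> Prop.
Hypotheses (gC : closed_subcat C) (gN : closed_subcat N).
Local Notation top_critical := (top_critical phi C N).
Local Notation critical := (critical C N).

(** As a condition on the first factor in [factors], this describes the maps from X that
    factor through N by non-isomorphisms. *)
Definition radical_over X T (u : {linear X -> T}) := [/\ N T, indecomposable T & ~ bijective u].

(** With Z the submodule of the product of the M_a generated by X and by solutions of a
    left almost split system, X does not split off Z, since that would solve the system
    in X. Each summand of Z lies in N, or is isomorphic to some M_b. For M_a not among
    the summands of Z, the map from X to M_a is a sum of maps through the summands:
    those in N are reached from X by non-isomorphisms, and a map from M_b to M_a is not
    an isomorphism, so that its image is a proper submodule of M_a and lies in N. *)
Lemma nonradical_finitely_many X : finite_klength X -> indecomposable X ->
  finitely_many (fun M => [/\ top_critical M, ~ lmod_iso X M & exists f : {linear X ->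
    M}, ~ factors (@radical_over X) f]).
Proof.
move=> flX dX; have [nzX _] := dX.
(* The bound nW below depends on X only; nW + 1 modules lead to a contradiction. *)
have [m [n [lam [h [hn ARh]]]]] := left_almost_split hL flX dX.
have [nX fX] := flX; have [nL fL] := finite_klength_regular hL.
pose W : lmodType L := (X * {ffun 'I_n -> L^o})%type.
have [nW fW] : finite_klength W.
  suff [b fb] : finite_klength ({ffun 'I_n -> L^o} : lmodType L) by exists (nX + b)%N;
    apply: klength_prod fX fb.
  have [f fE] : exists f : {linear (restr phi {ffun 'I_n -> L^o} : lmodType k) ->
      ({ffun 'I_n -> restr phi L^o} : lmodType k)}, forall x : {ffun 'I_n ->
        L^o}, f x = [ffun i => x i].
    by apply: lin_of_fun => a u v; apply/ffunP => i; rewrite !ffunE.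
  exists (n * nL)%N; apply: (length_inj (f := f)); last exact: length_ffun fL.
  by move=> x y; rewrite !fE => /ffunP e; apply/ffunP => i; have := e i; rewrite !ffunE.
apply: contrapT => /(infinite_family nW.+1)[M [PM isoM]].
have bM j : top_critical (M j) by case: (PM j).
have cM j : critical (M j) by case: (bM j).
have CM j : C (M j) by case: (cM j).
have h1 j : exists f : {linear X -> M j}, ~ factors (@radical_over X) f by case: (PM j).
pose f j := projT1 (cid (h1 j)).
have fE j : ~ factors (@radical_over X) (f j) := projT2 (cid (h1 j)).
have h2 j : exists y : 'I_n -> M j, forall i, f j (h i) = \sum_l lam i l *: y l.
  apply: ARh; first exact: (closed_finite_klength hL gC (CM j)).
  move=> [r rf]; case: (PM j) => _ + _; apply; exists (f j).
  by apply: (retract_bij rf) => //; case: (cM j).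
pose y j := projT1 (cid (h2 j)).
have yE j i : f j (h i) = \sum_l lam i l *: y j l := projT2 (cid (h2 j)) i.
have h3 j : exists g : {linear W -> M j}, forall w : W,
  g w = f j w.1 + \sum_l (w.2 l : L) *: y j l.
  apply: lin_of_fun => a u v; rewrite linearP /= scalerDr addrACA; congr (_ + _).
  rewrite scaler_sumr -big_split; apply: eq_bigr => l _ /=.
  by rewrite !ffunE scalerDl scalerA.
pose g j := projT1 (cid (h3 j)); have gE j := projT2 (cid (h3 j)).
have [P [gg [CP gp gz]]] := joint_map nW.+1 g gC CM.
have [Z [p [i [ps ii ipE]]]] := image_factorization gg.
have CZ : C Z by exact: (closed_inj gC ii CP).
have fZ : klength_le Z nW by exact: (klength_onto ps fW).
have gz0 w : (forall j, g j w = 0) -> p w = 0.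
  move=> gw; apply: ii; rewrite ipE linear0; apply: contrapT => /gz[j _ [q [qE]]].
  by rewrite qE.
have [t [c dc]] := decomposition (ex_intro _ _ fZ).
have [dd dr dorth ds] := dc.
have tle : (t <= nW)%N := decomposition_size dc fZ.
have [a la na] : exists2 a, (a < nW.+1)%N & forall l, (l < t)%N ->
  ~ lmod_iso (summand_obj (c l)) (M a).
  apply: contrapT => hc.
  have /choice[l lE] (a : 'I_nW.+1) : exists l : 'I_t, lmod_iso (summand_obj (c l)) (M a).
    apply: contrapT => ha; apply: hc; exists a => // l lt iso; apply: ha.
    by exists (Ordinal lt).
  have /leq_card : injective l.
    move=> a b e; apply: val_inj; apply: (isoM _ _ (ltn_ord a) (ltn_ord b)).
    by apply: (iso_trans (iso_sym (lE a))); rewrite e; apply: lE.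
  by rewrite !card_ord => /leq_trans/(_ tle); rewrite ltnn.
have [q qE] := gp a la.
have [inX inXE] := lin_inl X ({ffun 'I_n -> L^o} : lmodType L).
apply: (fE a); apply: (@factors_sum _ _ _ (@radical_over X) t (fun l x =>
   (q \o (i \o summand_in (c l))) ((summand_out (c l) \o (p \o inX)) x))) => [l lt|x]; last first.
  transitivity (q (i (p (inX x)))).
    rewrite ipE qE gE inXE /= [X in _ + X]big1 ?addr0 // => j _.
    by rewrite ffunE scale0r.
  by rewrite {1}(ds (p (inX x))) !linear_sum.
set u : {linear X -> summand_obj (c l)} := summand_out (c l) \o (p \o inX).
set w : {linear summand_obj (c l) -> M a} := q \o (i \o summand_in (c l)).
have CY := closed_summand gC CZ dc lt.
have cini : injective (i \o summand_in (c l)) by apply: inj_comp => //; apply: can_inj => z;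
  apply: dr.
have [||||NY|[F [[j Fj] bF iso]]] := @indecomposable_cogenerated _ _ phi hL C N gC gN
  (summand_obj (c l)) (fun F => exists j, F = M j).
- exact: dd.
- exact: CY.
- by move=> F [j ->]; right.
- move=> z z0; have [|j _ [r [_ rz]]] := gz (i (summand_in (c l) z)).
    by move=> e; apply: z0; apply: cini; rewrite /= e !linear0.
  by exists (M j), (r \o (i \o summand_in (c l))); split; first by exists j.
- apply: (@factors_one _ _ _ (@radical_over X) _ u w) => //; split=> //; first exact: dd.
  move=> ub; have [v [vu _]] := bij_inv ub; apply: hn.
  pose e (j : 'I_n) : W := (0, [ffun b => (b == j)%:R]).
  exists (fun j => v (summand_out (c l) (p (e j)))) => b.
  have : p (inX (h b) - \sum_j lam b j *: e j) = 0.
    apply: gz0 => j; rewrite linearB linear_sum gE inXE /= [X in _ + X - _]big1 => [|s _];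
      last first.
      by rewrite ffunE scale0r.
    rewrite addr0 yE; apply/eqP; rewrite subr_eq0; apply/eqP; apply: eq_bigr => s _.
    rewrite linearZ /= gE /= linear0 add0r (bigD1 s) //= ffunE eqxx scale1r big1 ?addr0 // =>
      s' /negbTE s's.
    by rewrite ffunE s's scale0r.
  rewrite linearB => /eqP; rewrite subr_eq0 => /eqP e1.
  rewrite -{1}(vu (h b)) /u /= e1 !linear_sum; apply: eq_bigr => s _.
  by rewrite !linearZ.
rewrite Fj in bF iso.
have cY : critical (summand_obj (c l)) by apply: (critical_iso gC gN (iso_sym iso)); case: bF.
have [[_ wb]|[I [p' [i' [NI _ _ piE]]]]] := critical_to_old_or_top hL gC gN w cY (or_intror (bM
  a)).
  by case: (na l lt); exists w.
have fI := closed_finite_klength hL gN NI.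
have [s [c' dc']] := decomposition fI; have [dd' dr' _ ds'] := dc'.
apply: (@factors_sum _ _ _ (@radical_over X) s (fun b x =>
   (i' \o summand_in (c' b)) ((summand_out (c' b) \o p' \o u) x))) => [b lb|x]; last first.
  rewrite -[LHS]/(w (u x)) -piE {1}(ds' (p' (u x))) linear_sum; apply: eq_bigr => b _ //.
have NT := closed_summand gN NI dc' lb.
apply: (@factors_one _ _ _ (@radical_over X) _ (summand_out (c' b) \o p' \o u) (i' \o summand_in
  (c' b))) => //; split=> //.
  exact: dd'.
move=> /[dup] bb /(bij_comp_left (dd l lt) nzX) ub.
case: cY => _ _ nNY _; apply: nNY; apply: (closed_iso gN _ NT).
have XY : lmod_iso X (summand_obj (c l)) by exists u.
by apply: iso_sym; apply: (iso_trans (iso_sym XY)); exists (summand_out (c' b) \o p' \o u).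
Qed.
End N.
End Layer.

Section LayerFin.
Variables (k : comPzRingType) (L : pzRingType) (phi : {rmorphism k -> L}).
Hypothesis hL : artin_algebra phi.
Implicit Types A B X Y T E F U W Z : lmodType L.
Local Notation finite_klength := (finite_klength phi).
Variables C N : lmodType L -> Prop.
Hypotheses (gC : closed_subcat C) (gN : closed_subcat N) (fN : finite_subcat N).
Local Notation top_critical := (top_critical phi C N).
Local Notation critical := (critical C N).

(** Apply [nonradical_finitely_many] to the indecomposables of N and to the
    indecomposable summands of L. The latter serve to conclude: a module without nonzero
    maps from them is zero. *)
Lemma top_critical_finitely_many : finitely_many top_critical.
Proof.
have [nl [cl dl]] := decomposition (finite_klength_regular hL); have [ddl drl _ dsl] := dl.
pose XX T := indecomposable T /\ (N T \/ exists2 i, (i < nl)%N & lmod_iso T (summand_obj (cl i))).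
have fXX T : XX T -> finite_klength T.
  move=> [_ [NT|[i lin iso]]]; first exact: (closed_finite_klength hL gN NT).
  have [g gb] := iso; apply: (@finite_klength_inj _ _ _ _ _ (summand_in (cl i) \o g));
    last exact: finite_klength_regular hL.
  by apply: inj_comp (bij_inj gb); apply: can_inj => y; apply: drl.
have [I [X [XXX XE]]] : exists (I : finType) (X : I -> lmodType L),
    (forall i, XX (X i)) /\ forall M, XX M -> exists i, lmod_iso M (X i).
  apply: finitely_many_reps; apply: (finitely_many_sub _ (finitely_many_or
    (finite_subcat_finitely_many fN) (P' := fun T =>
    exists2 i, (i < nl)%N & lmod_iso T (summand_obj (cl i))) _)).
    by move=> T [dT [NT|iT]]; [left | right].
  by exists 'I_nl, (fun i : 'I_nl => summand_obj (cl i)) => T [i lin iso]; exists (Ordinal lin).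
have dX i : indecomposable (X i) by case: (XXX i).
have fX i := fXX _ (XXX i).
suff H M : top_critical M -> (forall i, ~ lmod_iso (X i) M) ->
    (forall i (f : {linear X i -> M}), factors (@radical_over _ N (X i)) f) -> False.
  have F1 := finitely_many_exists (fun i => nonradical_finitely_many hL gC gN (fX i) (dX i)).
  have F2 : finitely_many (fun M => exists i, lmod_iso (X i) M).
    by exists I, X => M [i iso]; exists i; apply: iso_sym.
  (* The modules isomorphic to one of the X i fall into finitely many types. *)
  apply: (finitely_many_sub _ (finitely_many_or F2 F1)) => M bM.
  apply: contrapT => /not_orP[ni nb]; apply: (H M bM) => [i iso|i f].
    by apply: ni; exists i.
  apply: contrapT => nf; apply: nb; exists i; split=> //; last by exists f.
  by move=> iso; apply: ni; exists i.
move=> bM niso radf.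
have [[CM dM nNM pM] _] := bM; have fM := closed_finite_klength hL gC CM.
have h i := hom_generators hL (fX i) fM.
pose q i := projT1 (cid (h i)); have h2 i := projT2 (cid (h i)).
pose f i := projT1 (cid (h2 i)); have fE i := projT2 (cid (h2 i)).
(* G lists k-generators of Hom (X i, M) for all i. *)
pose Gi i : seq (map_to M) := [seq MapTo (f i b) | b <- iota 0 (q i)].
pose G := flatten [seq Gi i | i <- enum I].
have inG i b : (b < q i)%N -> listed (MapTo (f i b)) G.
  move=> bq; apply: (@listed_flatten _ _ _ (Gi i)).
    by apply: listed_map; rewrite mem_enum.
  by apply: (@listed_map _ _ (fun b => MapTo (f i b))); rewrite mem_iota.
have GX g : listed g G -> exists i b, g = MapTo (f i b).
  move=> gG; have [s hs gs] := listed_flattenE gG; have [i e] := listed_mapE hs; rewrite e in gs.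
  by have [b ->] := listed_mapE gs; exists i, b.
have genX i (g : {linear X i -> M}) : generated (@any_map L (X i)) G g.
  have [a aE] := fE i g.
  apply: (@generated_sum _ _ _ G (q i) (fun b x => phi (a b) *: f i b x)) => // b bq.
  have [s sE] := scale_lin hL (X i) (a b).
  suff -> : (fun x => phi (a b) *: f i b x) = (fun x => f i b (s x)).
    exact: (@generated_in _ M (X i) G (MapTo (f i b)) s (inG i b bq)).
  by apply/funext => x; rewrite sE linearZ.
have genR i (g : {linear X i -> M}) : generated (@not_iso L (X i)) G g.
  have nb0 Y T (u : {linear Y -> T}) : ~ zero_module Y -> (forall x, u x = 0) -> not_iso u.
    by move=> nz u0 ub; apply: nz => x; apply: (bij_inj ub); rewrite !u0.
  have [nzX _] := dX i.
  elim: (radf i g) => [f0 f00|T u v f0 f' [NT dT nu] _ IH f0E].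
    by apply: generated_zero => // T u; apply: nb0.
  have [j [th thb]] : exists j, lmod_iso T (X j) by apply: XE; split=> //; left.
  have [th' [thK _]] := bij_inv thb.
  apply: (@generated_add _ _ _ _ _ (fun x => (v \o th') ((th \o u) x)) f') =>
    // [T' u1 u2 w n1 n2 wE wb||x].
  - by case: (bij_sum (fX i) (dX i) wb wE).
  - apply: generated_comp (genX j (v \o th')) => g' u' _ _ b; apply: nu.
    by apply: (@bij_comp_left _ _ _ _ u (u' \o th)) b.
  by rewrite f0E /= thK.
have zG : forall g, listed g G -> forall x, map_fun g x = 0.
  apply: (@nakayama k L phi M G) => g' gG; have [j [b ->]] := GX _ gG; last exact: genR.
  by split; [apply: fX | apply: dX].
have z0 i (g : {linear X i -> M}) x : g x = 0 by apply: (generated_vanish (genX i g)).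
case: dM => nzM _; apply: nzM => x.
have [g gE] := lin_orbit x.
rewrite -[x]scale1r -gE {1}(dsl (1 : L^o)) linear_sum big1 // => i _.
have [j [th thb]] : exists j, lmod_iso (summand_obj (cl i)) (X j).
  by apply: XE; split; [apply: ddl | right; exists i => //; apply: iso_refl].
have [th' [thK _]] := bij_inv thb.
set y := summand_out (cl i) 1.
by rewrite -(thK y) -(z0 j (g \o (summand_in (cl i) \o th')) (th y)).
Qed.
End LayerFin.

(** * Construction of the minimal subcategory *)

Section Main.
Variables (k : comPzRingType) (L : pzRingType) (phi : {rmorphism k -> L}).
Hypothesis hL : artin_algebra phi.
Implicit Types M A B X Y T E F U W Z : lmodType L.
Local Notation finite_klength := (finite_klength phi).
Local Notation has_kchain := (has_kchain phi).
Variable C : lmodType L -> Prop.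
Hypothesis gC : closed_subcat C.
Hypothesis infC : ~ finite_subcat C.

Lemma finite_subcat_sub (P P' : lmodType L -> Prop) :
  (forall M, P M -> P' M) -> finite_subcat P' -> finite_subcat P.
Proof. by move=> PP' [n [F FE]]; exists n, F => M /PP'; apply: FE. Qed.

Lemma zero_closed_subcat : closed_subcat (@zero_module L).
Proof.
split; first split.
- by move=> M z; have [[h _ _ _ _] _] := gC; apply: h; apply: closed_zero.
- exact: iso_zero.
- by [].
- by move=> M N zM zN [x y]; rewrite (zM x) (zN y).
- by move=> M N z x; have [] := z (x, 0).
apply: submodule_closedP => A B f fi z a; apply: fi.
by rewrite linear0; apply: z.
Qed.

Section Step.
Variable N : lmodType L -> Prop.
Hypotheses (gN : closed_subcat N) (NC : forall M, N M -> C M) (fN : finite_subcat N).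

Lemma extend_finite : finite_subcat (extend phi C N).
Proof.
apply: finitely_many_finite_subcat.
apply: (finitely_many_sub _ (finitely_many_or (finite_subcat_finitely_many fN)
  (top_critical_finitely_many hL gC gN fN))).
move=> M [nM dM]; have CM : C M by exact: (extend_C hL gC NC nM).
by have [NM|bM] := extend_indecomposable hL gC gN dM CM nM; [left | right].
Qed.

Lemma exists_outside : exists Y, C Y /\ ~ N Y.
Proof.
apply: contrapT => h; apply: infC; apply: finite_subcat_sub fN => M CM.
by apply: contrapT => nNM; apply: h; exists M.
Qed.

Lemma top_critical_exists : exists M, top_critical phi C N M.
Proof.
have [b bE] := critical_bounded hL gC gN fN.
have [Y [CY nNY]] := exists_outside.
have [E [_ [_ cE]]] := critical_exists hL gC gN CY nNY.
pose P n := exists2 M, critical C N M & has_kchain M n.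
have [n [M cM chM] nmax] : exists2 n, P n & ~ P n.+1.
  apply: contrapT => h.
  have [M cM /(length_chain (bE M cM))] : P b.+1; last by rewrite ltnn.
  elim: b.+1 => [|n IH]; first by exists E => //; apply: chain0.
  by apply: contrapT => h'; apply: h; exists n.
exists M; split=> // M' cM' n' ch'; apply: chain_leq chM.
rewrite leqNgt; apply/negP => lt; apply: nmax; exists M' => //.
exact: chain_leq ch'.
Qed.
End Step.

Fixpoint stage t : lmodType L -> Prop :=
  if t is t'.+1 then extend phi C (stage t') else @zero_module L.

Lemma stageP t :
  [/\ closed_subcat (stage t), forall M, stage t M -> C M & finite_subcat (stage t)].
Proof.
elim: t => [|t [gN NC fN]] /=.
  split; [exact: zero_closed_subcat | by move=> M; apply: closed_zero | ].
  exists 0%N, (fun i : 'I_0 => match i with Ordinal n p => match notF p with end end).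
  by move=> M z [].
by split; [apply: extend_closed | move=> M; apply: extend_C | apply: extend_finite].
Qed.

Lemma stage_closed t : closed_subcat (stage t). Proof. by case: (stageP t). Qed.
Lemma stage_C t M : stage t M -> C M. Proof. by case: (stageP t) => _ h _; apply: h. Qed.
Lemma stage_finite t : finite_subcat (stage t). Proof. by case: (stageP t). Qed.

Lemma stage_leq s t M : (s <= t)%N -> stage s M -> stage t M.
Proof.
move=> /subnKC <-; elim: (t - s)%N => [|d IH] h; first by rewrite addn0.
by rewrite addnS; apply: old_or_top_extend; left; apply: IH.
Qed.

Definition stages M := exists t, stage t M.

Lemma stages_C M : stages M -> C M. Proof. by case=> t; apply: stage_C. Qed.

Lemma stages_closed : closed_subcat stages.
Proof.
split; first split.
- by move=> M /stages_C; case: gC => -[h _ _ _ _] _; apply: h.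
- by move=> M N iso [t h]; exists t; apply: closed_iso iso h; apply: stage_closed.
- by move=> M z; exists 0%N.
- move=> M N [t h] [s h']; exists (maxn t s); apply: closed_prod; first exact: stage_closed.
    by apply: stage_leq h; apply: leq_maxl.
  by apply: stage_leq h'; apply: leq_maxr.
- move=> M N [t h]; exists t; have [[_ _ _ _ hs] _] := stage_closed t.
  exact: hs h.
by apply: submodule_closedP => A B f fi [t h]; exists t; apply: closed_inj fi h;
  apply: stage_closed.
Qed.

(** Finitely many indecomposables, each in some stage, lie in a common one. *)
Lemma finite_in_stage (P : lmodType L -> Prop) :
  closed_subcat P -> (forall M, P M -> stages M) -> finite_subcat P ->
  exists t, forall M, P M -> stage t M.
Proof.
move=> gP PD [n [F FE]].
have /choice[t tE] (i : 'I_n) : exists t, forall M, P M -> lmod_iso M (F i) -> stage t M.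
  case: (pselect (exists2 M, P M & lmod_iso M (F i))) => [[M PM iso]|h]; last first.
    by exists 0%N => M PM iso; case: h; exists M.
  have [t Nt_M] := PD M PM; exists t => M' _ /iso_sym iso'.
  by apply: (closed_iso (stage_closed t)) Nt_M; apply: iso_trans iso iso'.
exists (\max_i t i) => M PM; have fM := closed_finite_klength hL gP PM.
have [m [c dc]] := decomposition fM; have [dd _ _ _] := dc.
apply: (closed_of_summands (stage_closed _) fM dc) => j jm.
have Pc := closed_summand gP PM dc jm; have [i iso] := FE _ Pc (dd j jm).
by apply: stage_leq (tE i _ Pc iso); apply: leq_bigmax.
Qed.

Lemma stages_infinite : ~ finite_subcat stages.
Proof.
move=> fD; have [t h] := finite_in_stage stages_closed (fun _ => id) fD.
have [M bM] := top_critical_exists (stage_closed t) (stage_finite t).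
have := h M; case: (bM) => -[_ _ nM _] _; move=> h'; apply/nM/h'.
by exists t.+1; apply: old_or_top_extend; right.
Qed.

(** Induction on the length e of the critical modules. If one of length e over stage t
    enters at stage r + 1, then e is the maximal length of critical modules over stage
    r. Every other module of length e critical over stage t is already in stage r or
    still critical over it, and then enters at r + 1 as well. *)
Lemma stages_critical t : exists s, forall M, critical C (stage t) M -> stages M -> stage s M.
Proof.
have [b bE] := critical_bounded hL gC (stage_closed t) (stage_finite t).
suff H e : exists2 s, (t <= s)%N & forall M, critical C (stage t) M -> stages M ->
  ~ has_kchain M e -> stage s M.
  have [s _ sE] := H b.+1; exists s => M cM dM; apply: sE => //.
  by move=> /(length_chain (bE M cM)); rewrite ltnn.
elim: e => [|e [s ts sE]]; first by exists t => // M _ _ []; apply: chain0.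
case: (pselect (exists M, [/\ critical C (stage t) M, stages M, ~ has_kchain M e.+1 &
  ~ stage s M])); last first.
  move=> h; exists s => // M cM dM ch; apply: contrapT => nM; apply: h.
  by exists M.
move=> [M0 [c0 D0 ch0 n0]].
have [r sr [nr Nr]] : exists2 r, (s <= r)%N & ~ stage r M0 /\ stage r.+1 M0.
  have [r0 Nr0] := D0; apply: contrapT => h.
  have : forall d, ~ stage (s + d)%N M0.
    elim=> [|d IH]; first by rewrite addn0.
    rewrite addnS => Nd; apply: h; exists (s + d)%N; first exact: leq_addr.
    by split.
  by move=> /(_ r0); apply; apply: stage_leq Nr0; apply: leq_addl.
have tr : (t <= r)%N := leq_trans ts sr.
have [C0 d0 _ _] := c0.
have [//|[_ max0]] := extend_indecomposable hL gC (stage_closed r) d0 C0 Nr.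
exists r.+1 => [|M cM dM chM]; first exact: leqW.
case: (pselect (stage s M)) => [|nsM]; first by apply: stage_leq; apply: leqW.
have chMe : has_kchain M e by apply: contrapT => h; apply: nsM; apply: sE.
case: (pselect (stage r M)) => [|nrM]; first exact: stage_leq.
have [CM dM' _ pM] := cM.
have cMr : critical C (stage r) M.
  by split=> // A f fi fs; apply: stage_leq tr _; apply: (pM A f).
apply: old_or_top_extend; right; split=> // M' cM' n ch'.
have ch0' := max0 _ cM' _ ch'.
apply: chain_leq chMe; rewrite leqNgt; apply/negP => en; apply: ch0.
exact: chain_leq ch0'.
Qed.

Definition infinite_closed (P : lmodType L -> Prop) := closed_subcat P /\ ~ finite_subcat P.

(** Minimize the number of indecomposables of stage t. An infinite closed subcategory of
    the result contains the same ones. *)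
Lemma shrink_exists t (D0 : lmodType L -> Prop) : infinite_closed D0 ->
  exists D1, [/\ infinite_closed D1, forall M, D1 M -> D0 M &
    forall D2, infinite_closed D2 -> (forall M, D2 M -> D1 M) ->
      forall M, stage t M -> D1 M -> D2 M].
Proof.
move=> i0.
have [I [X [XN XE]]] := finitely_many_reps (finite_subcat_finitely_many (stage_finite t)).
pose S (P : lmodType L -> Prop) : {set I} := [set i | `[< P (X i) >]].
pose Q n := `[< exists P, [/\ infinite_closed P, forall M, P M -> D0 M & #|S P| = n] >].
have exQ : exists n, Q n by exists #|S D0|; apply/asboolP; exists D0.
have [n /asboolP[D1 [i1 D10 S1]] nmin] := ex_minnP exQ.
exists D1; split=> // D2 i2 D21 M NM D1M.
have S21 : S D2 = S D1.
  apply/eqP; rewrite eqEcard S1; apply/andP; split.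
    by apply/subsetP => i; rewrite !inE => /asboolP /D21 h; apply/asboolP.
  by apply: nmin; apply/asboolP; exists D2; split=> // M' /D21; apply: D10.
have [[g1 _] [g2 _]] := (i1, i2); have fM := closed_finite_klength hL g1 D1M.
have [m [c dc]] := decomposition fM; have [dd _ _ _] := dc.
apply: (closed_of_summands g2 fM dc) => j jm.
have [|i iso] := XE (summand_obj (c j)).
  by split; [apply: (closed_summand (stage_closed t) NM dc jm) | apply: dd].
apply: (closed_iso g2 (iso_sym iso)).
have : i \in S D1.
  by rewrite inE; apply/asboolP; apply: (closed_iso g1 iso); apply: (closed_summand g1 D1M dc jm).
by rewrite -S21 inE => /asboolP.
Qed.

Definition shrink t (P : {P | infinite_closed P}) : {P | infinite_closed P} :=
  let h := cid (shrink_exists t (projT2 P)) in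
  exist infinite_closed (projT1 h) (let: And3 a _ _ := projT2 h in a).

Definition shrunk : nat -> {P | infinite_closed P} := fix shrunk t :=
  if t is t'.+1 then shrink t' (shrunk t')
  else exist infinite_closed stages (conj stages_closed stages_infinite).

Lemma shrunk_sub t M : sval (shrunk t.+1) M -> sval (shrunk t) M.
Proof. by rewrite /= /shrink; case: cid => P [/= _ h _]; apply: h. Qed.

Lemma shrunk_min t D2 : infinite_closed D2 -> (forall M, D2 M -> sval (shrunk t.+1) M) ->
  forall M, stage t M -> sval (shrunk t.+1) M -> D2 M.
Proof. by rewrite /= /shrink; case: cid => P [/= _ _ h]; apply: h. Qed.

Lemma shrunk_leq s t M : (s <= t)%N -> sval (shrunk t) M -> sval (shrunk s) M.
Proof.
move=> /subnKC <-; elim: (t - s)%N => [|d IH]; first by rewrite addn0.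
by rewrite addnS => /shrunk_sub.
Qed.

Lemma shrunk_infinite t : infinite_closed (sval (shrunk t)). Proof. exact: svalP. Qed.

Definition core M := forall t, sval (shrunk t) M.

Lemma core_closed : closed_subcat core.
Proof.
have g t : closed_subcat (sval (shrunk t)) by case: (shrunk_infinite t).
split; first split.
- by move=> M /(_ 0%N); case: (g 0%N) => -[h _ _ _ _] _; apply: h.
- by move=> M N iso h t; apply: (closed_iso (g t) iso).
- by move=> M z t; apply: (closed_zero (g t)).
- by move=> M N h h' t; apply: (closed_prod (g t)).
- by move=> M N h t; case: (g t) => -[_ _ _ _ hs] _; apply: hs (h t).
by apply: submodule_closedP => A B f fi h t; apply: (closed_inj (g t) fi).
Qed.

Lemma core_stages M : core M -> stages M. Proof. by move/(_ 0%N). Qed.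

(** If the core were contained in stage T, take s such that all modules of the union
    that are critical over stage T lie in stage s. The (s+1)-st subcategory contains
    such a module E; as E is in stage s, it belongs to all later subcategories and hence
    to the core, although it is not in stage T. *)
Lemma core_infinite : ~ finite_subcat core.
Proof.
move=> fC; have [T CT] := finite_in_stage core_closed core_stages fC.
have [s sE] := stages_critical T.
have [gD nfD] := shrunk_infinite s.+1.
have [Y [DY nY]] : exists Y, sval (shrunk s.+1) Y /\ ~ stage T Y.
  apply: contrapT => h; apply: nfD; apply: finite_subcat_sub (stage_finite T) => M DM.
  by apply: contrapT => nM; apply: h; exists M.
have DDY : stages Y by apply: (@shrunk_leq 0 s.+1).
have [E [e [ei cE]]] := critical_exists hL gC (stage_closed T) (stages_C DDY) nY.
have DE : sval (shrunk s.+1) E by apply: (closed_inj gD ei).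
have NE : stage s E by apply: sE => //; apply: (@shrunk_leq 0 s.+1).
case: cE => _ _ nE _; apply: nE; apply: CT => r.
have [rs|/ltnW sr] := leqP r s.+1; first exact: shrunk_leq DE.
apply: (shrunk_min (shrunk_infinite r) _ NE DE) => M; exact: shrunk_leq.
Qed.

Lemma core_minimal D2 : infinite_closed D2 -> (forall M, D2 M -> core M) ->
  forall M, core M -> D2 M.
Proof.
move=> i2 D2C M CM; have [t Nt_M] := core_stages CM.
by apply: (shrunk_min i2 _ Nt_M (CM _)) => M' /D2C.
Qed.
End Main.

Theorem theorem1 (k : comPzRingType) (L : pzRingType)
    (phi : {rmorphism k -> L}) (hL : artin_algebra phi)
    (C : lmodType L -> Prop) (hC : infinite_submodule_closed C) :
  exists C' : lmodType L -> Prop,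
    minimal_subcat C' /\ (forall M : lmodType L, C' M -> C M).
Proof.
have [sC nfC cC] := hC; have gC : closed_subcat C by [].
exists (core hL gC nfC); split; last by move=> M /core_stages /(stages_C hL gC).
split.
  by have [s c] := core_closed hL gC nfC; split=> //; apply: core_infinite.
move=> D [sD nfD cD] DC; by apply: core_minimal.
Qed.
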